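(* If $(A_n,L_n,\mu_n)_{n\in\mathbb N}$ is a sequence of pointed quantum compact metric spaces converging for the pointed propinquity to a pointed quantum compact metric space $(A,L,\mu)$, then $$\lim_{n\to\infty}\ \sup_{M\ge1}\ \eth_M\bigl((A_n,L_n,\mathbb C1_{A_n},\mu_n),(A,L,\mathbb C1_A,\mu)\bigr)=0,$$ and in particular $$\lim_{n\to\infty}\mathsf D\bigl((A_n,L_n,\mathbb C1_{A_n},\mu_n),(A,L,\mathbb C1_A,\mu)\bigr)=0 .$$
   Context: **Basics.** For a C*-algebra $A$: $\mathrm{sa}(A)$ is its self-adjoint part, $S(A)$ its state space, $Q(A)$ the set of positive linear functionals of norm at most $1$; $\mathfrak uA=A$ if $A$ is unital and otherwise $\mathfrak uA=A\oplus\mathbb C$ is the minimal unitization; $1_A$ is the unit of $\mathfrak uA$. An element $h\in\mathrm{sa}(A)$ is strictly positive when $\varphi(h)>0$ for all $\varphi\in S(A)$. A seminorm $L$ on a subspace $\mathrm{dom}(L)\subseteq A$ is hermitian when $a\in\mathrm{dom}(L)$ implies $a^*\in\mathrm{dom}(L)$ and $L(a^* )=L(a)$; then $\mathrm{dom}_{sa}(L)=\mathrm{dom}(L)\cap\mathrm{sa}(A)$. It is a norm modulo constants when it is a norm if $A$ has no unit, and $\{a:L(a)=0\}=\mathbb C1_A$ if $A$ is unital. It is Leibniz when $\mathrm{dom}(L)$ is a subalgebra and $L(ab)\le\|a\|L(b)+L(a)\|b\|$. For $M\ge1$, $\|a\|_{L,M}=\max\{\frac1M\|a\|_A,L(a)\}$.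 For positive linear functionals $\varphi,\psi$, $\mathsf{bl}_{L,M}(\varphi,\psi)=\sup\{|\varphi(a)-\psi(a)|:a\in\mathrm{dom}_{sa}(L),\|a\|_{L,M}\le1\}$, and $\mathsf{bl}_L=\mathsf{bl}_{L,1}$. For states, $\mathsf{mk}_L(\varphi,\psi)=\sup\{|\varphi(a)-\psi(a)|:a\in\mathrm{dom}_{sa}(L),L(a)\le1\}\in[0,\infty]$, and $\mathrm{qdiam}(A,L)=\sup_{\varphi,\psi\in S(A)}\mathsf{mk}_L(\varphi,\psi)$. **Quantum compact metric spaces and propinquity.** A quantum compact metric space $(A,L)$ is a unital C*-algebra $A$ with a hermitian, Leibniz norm modulo constants $L$ on a dense *-subalgebra $\mathrm{dom}(L)$ such that $\{a\in\mathrm{dom}_{sa}(L):L(a)\le1\}$ is norm closed and $\mathsf{mk}_L$ metrizes the weak* topology of $S(A)$. It is pointed, $(A,L,\mu)$, when a state $\mu\in S(A)$ is chosen; then $(A,L,\mathbb C1_A,\mu)$ is a pointed proper quantum metric space (defined below). A quantum isometry $\pi:(D,L_D)\to(A,L_A)$ of quantum compact metric spaces is a *-epimorphism with $L_A(a)=\inf\{L_D(d):d\in\mathrm{dom}_{sa}(L_D),\pi(d)=a\}$ for $a\in\mathrm{dom}_{sa}(L_A)$. A compact tunnel $(D,L_D,\pi,\rho)$ from $(A,L_A)$ to $(B,L_B)$ is a quantum compact metric space $(D,L_D)$ with quantum isometries $\pi$ onto $(A,L_A)$, $\rho$ onto $(B,L_B)$; its pointed extent for $\mu_A,\mu_B$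 is the maximum of the Hausdorff distances, for $\mathsf{mk}_{L_D}$, between $S(D)$ and $\pi^*(S(A))$ and between $S(D)$ and $\rho^*(S(B))$, and of $\mathsf{mk}_{L_D}(\mu_A\circ\pi,\mu_B\circ\rho)$. The pointed propinquity between $(A,L_A,\mu_A)$ and $(B,L_B,\mu_B)$ is the infimum of the pointed extents of compact tunnels from $(A,L_A)$ to $(B,L_B)$. **Locally compact spaces.** A separable quantum locally compact metric space (sqlcms) $(A,L)$ is a separable C*-algebra $A$ with a Leibniz hermitian norm modulo constants $L$ on a dense *-subalgebra $\mathrm{dom}(L)$ of $A$ such that: (i) $\mathsf{bl}_L$ induces the weak* topology on $S(A)$; (ii) $\{a\in\mathrm{dom}_{sa}(L):L(a)\le1\}$ is norm closed in $\mathrm{sa}(A)$; (iii) there are a strictly positive $h\in\mathrm{sa}(A)$ and $\mu\in S(A)$ with $\mu(h)=1$ such that $\{hah\in\mathfrak uA:a=b+t1_A,\ t\in\mathbb R,\ b\in\mathrm{dom}_{sa}(L),\ L(b)\le1,\ \mu(b)=-t\}$ is bounded. A pin of $(A,L)$ is a state $\mu$ such that $\{\varphi\in S(A):\mathsf{mk}_L(\varphi,\mu)<\infty\}$ is weak* dense in $S(A)$; then $(A,L,\mu)$ is called pinned. An $L$-Lipschitz $\mu$-pinned exhaustive sequence is a sequence $(h_n)$ in $\mathrm{dom}_{sa}(L)$ with $L(h_n)\to0$, $\mu(h_n)\to1$, $\|h_n\|_A\to1$. A topography of $(A,L)$ is an Abelian C*-subalgebra $\mathfrak M$ of $A$ containing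 some $h\in\mathrm{dom}(L)$ strictly positive in $A$ such that $\{hah\in\mathfrak uA:a=b+t1_A,\ t\in\mathbb R,\ b\in\mathrm{dom}_{sa}(L),\ L(b)\le1,\ \mu(b)=-t\}$ is bounded for some state $\mu$ of $A$ restricting to a character of $\mathfrak M$; $(A,L,\mathfrak M)$ is then a topographic sqlcms. A pointed proper quantum metric space $(A,L,\mathfrak M,\mu)$ is a pinned sqlcms $(A,L,\mu)$ with a topography $\mathfrak M$ such that $\mu$ restricts to a character of $\mathfrak M$ and there is an $L$-Lipschitz $\mu$-pinned exhaustive sequence contained in $\mathfrak M$. **Isometries.** A quantum $M$-isometry $\pi:(D,L_D)\to(A,L_A)$ between sqlcms is a surjective *-morphism, proper (mapping an approximate unit to an approximate unit), with $\pi(\mathrm{dom}(L_D))=\mathrm{dom}(L_A)$, $\|a\|_{L_A,M}=\inf\{\|d\|_{L_D,M}:d\in\mathrm{dom}_{sa}(L_D),\pi(d)=a\}$ for all $a\in\mathrm{dom}_{sa}(L_A)$, and $L_A(\pi(d))\le L_D(d)$ for all $d\in\mathrm{dom}_{sa}(L_D)$. It is topographic from $(D,L_D,\mathfrak M_D)$ to $(A,L_A,\mathfrak M_A)$ when $\pi(\mathfrak M_D)\subseteq\mathfrak M_A$ and for all $a\in\mathrm{dom}_{sa}(L_A)\cap\mathfrak M_A$, $\varepsilon>0$ there is $d\in\mathfrak M_D\cap\mathrm{dom}_{sa}(L_D)$ with $\pi(d)=a$, $\|d\|_D\le e^\varepsilon\|a\|_A$, $L_D(d)\le e^{\varepsilon}L_A(a)$.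 **Tunnels.** An $M$-tunnel $\tau=(D,L_D,\mathfrak M_D,\pi_A,\pi_B,e)$ from $(A,L_A,\mathfrak M_A,\mu_A)$ to $(B,L_B,\mathfrak M_B,\mu_B)$ consists of a topographic sqlcms $(D,L_D,\mathfrak M_D)$, an element $e\in\mathrm{dom}_{sa}(L_D)\cap\mathfrak M_D$, and topographic quantum $M$-isometries $\pi_A:(D,L_D,\mathfrak M_D)\to(A,L_A,\mathfrak M_A)$, $\pi_B:(D,L_D,\mathfrak M_D)\to(B,L_B,\mathfrak M_B)$, such that $\mu_A\circ\pi_A$ is a pin of $(D,L_D)$. Write $eQ(D)e=\{\varphi(e\cdot e):\varphi\in Q(D)\}$, $\pi^*(\varphi)=\varphi\circ\pi$, and $X\subseteq_\varepsilon^{d}Y$ when every $x\in X$ satisfies $\inf_{y\in Y}d(x,y)\le\varepsilon$. The extent $\chi(\tau)$ is the maximum of: $\inf\{\varepsilon>0:eQ(D)e\subseteq_\varepsilon^{\mathsf{bl}_{L_D,M}}\pi_A^*(Q(A))\text{ and }eQ(D)e\subseteq_\varepsilon^{\mathsf{bl}_{L_D,M}}\pi_B^*(Q(B))\}$; $\mathsf{mk}_{L_D}(\mu_A\circ\pi_A,\mu_B\circ\pi_B)$; and $\max\{2M L_D(e),|1-\mu_A(\pi_A(e))|,|1-\mu_B(\pi_B(e))|\}$. The $M$-local quantum metametric is $\eth_M(\mathbb A,\mathbb B)=\inf\{\chi(\tau):\tau\text{ an }M\text{-tunnel from }\mathbb A\text{ to }\mathbb B\}$. **Quantum metametric.** With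 $e^{-\infty}=0$ and $\sup\emptyset=0$, $$\mathsf D(\mathbb A,\mathbb B)=\max\Bigl\{\inf\bigl\{\varepsilon>0:\sup_{r\in[1,1/\varepsilon]}\eth_r(\mathbb A,\mathbb B)<\varepsilon\bigr\},\ \bigl|e^{-\mathrm{qdiam}(A,L_A)}-e^{-\mathrm{qdiam}(B,L_B)}\bigr|\Bigr\}.$$
   Formalization: Quantum isometries π:(D,L_D)→(A,L_A) of quantum compact metric spaces are also required to satisfy π(dom(L_D)) ⊆ dom(L_A) (the convention L=∞ off its domain); without it the pointed propinquity can vanish between spaces of different quantum diameter and the claim fails. *)

(* Defs.v *)
From HB Require Import structures.
From mathcomp Require Import all_boot all_order all_algebra complex.
From mathcomp Require Import all_classical all_reals all_analysis.

Set Implicit Arguments.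
Unset Strict Implicit.
Unset Printing Implicit Defensive.

Import Order.TTheory GRing.Theory Num.Theory.
Import numFieldNormedType.Exports.

Local Open Scope classical_set_scope.
Local Open Scope complex_scope.
Local Open Scope ring_scope.

(* MathComp rings are unital, so a possibly non-unital C*-algebra is a complex
   Banach space carrying its own product. *)
HB.mixin Record CompleteNormedModule_isCStarAlgebra (R : realType) A
    & CompleteNormedModule R[i] A := {
  cmul : A -> A -> A ;
  star : A -> A ;
  cmulA : forall a b c : A, cmul a (cmul b c) = cmul (cmul a b) c ;
  cmulDl : forall a b c : A, cmul (a + b) c = cmul a c + cmul b c ;
  cmulDr : forall a b c : A, cmul a (b + c) = cmul a b + cmul a c ;
  cmulZl : forall (z : R[i]) (a b : A), cmul (z *: a) b = z *: cmul a b ;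
  cmulZr : forall (z : R[i]) (a b : A), cmul a (z *: b) = z *: cmul a b ;
  starK : forall a : A, star (star a) = a ;
  starD : forall a b : A, star (a + b) = star a + star b ;
  starZ : forall (z : R[i]) (a : A), star (z *: a) = z^* *: star a ;
  starM : forall a b : A, star (cmul a b) = cmul (star b) (star a) ;
  norm_cmul : forall a b : A, `|cmul a b| <= `|a| * `|b| ;
  norm_cstar : forall a : A, `|cmul (star a) a| = `|a| ^+ 2
}.

#[short(type="cstarType")]
HB.structure Definition CStarAlgebra (R : realType) :=
  {A of CompleteNormedModule R[i] A & CompleteNormedModule_isCStarAlgebra R A}.

Notation "a ** b" := (cmul a b) (at level 40, left associativity) : ring_scope.

(* Norms over R[i] take values in R[i], in its nonnegative reals; this is the
   same number in R. *)
Definition rnorm (R : realType) (V : normedZmodType R[i]) (v : V) : R :=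
  complex.Re `|v|.

Section Algebra.
Context {R : realType}.
Implicit Types A B : cstarType R.

Definition self_adjoint A : set A := [set a | star a = a].

Definition positive_element A (a : A) : Prop := exists b : A, a = star b ** b.

Definition is_unit A (u : A) : Prop := forall a : A, u ** a = a /\ a ** u = a.

Definition unital A : Prop := exists u : A, is_unit u.

(* C 1_A; the empty set when A has no unit *)
Definition scalars A : set A :=
  [set a | exists2 u : A, is_unit u & exists z : R[i], a = z *: u].

Definition positive_functional A (phi : A -> R[i]) : Prop :=
  scalar phi /\ forall a : A, 0 <= phi (star a ** a).

Definition functional_norm A (phi : A -> R[i]) : \bar R :=
  ereal_sup [set (rnorm (phi a))%:E | a in [set a : A | rnorm a <= 1]].

(* S(A) *)
Definition states A : set (A -> R[i]) :=
  [set phi | positive_functional phi /\ functional_norm phi = 1%E].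

(* Q(A) *)
Definition quasi_states A : set (A -> R[i]) :=
  [set phi | positive_functional phi /\ (functional_norm phi <= 1)%E].

End Algebra.

Arguments self_adjoint {R} A _.
Arguments scalars {R} A _.
Arguments states {R} A _.
Arguments quasi_states {R} A _.

Section StarMorphisms.
Context {R : realType}.
Implicit Types A B : cstarType R.

Definition separable A : Prop := exists2 S : set A, countable S & dense S.

Definition star_subalgebra A (S : set A) : Prop :=
  [/\ S 0,
      forall a b : A, S a -> S b -> S (a + b),
      forall (z : R[i]) (a : A), S a -> S (z *: a),
      forall a b : A, S a -> S b -> S (a ** b) &
      forall a : A, S a -> S (star a)].

Definition abelian_cstar_subalgebra A (S : set A) : Prop :=
  [/\ star_subalgebra S, closed S &
      forall a b : A, S a -> S b -> a ** b = b ** a].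

Definition star_morphism A B (f : A -> B) : Prop :=
  [/\ linear f,
      forall a b : A, f (a ** b) = f a ** f b &
      forall a : A, f (star a) = star (f a)].

Definition approximate_unit A (I : Type) (le : I -> I -> Prop) (e : I -> A) :
    Prop :=
  [/\ [/\ exists i : I, True,
          forall i, le i i,
          forall i j k, le i j -> le j k -> le i k &
          forall i j, exists k, le i k /\ le j k],
      forall i, positive_element (e i) /\ rnorm (e i) <= 1,
      forall i j, le i j -> positive_element (e j - e i) &
      forall (a : A) (eps : R), 0 < eps -> exists i, forall j, le i j ->
        rnorm (e j ** a - a) < eps /\ rnorm (a ** e j - a) < eps].

Definition proper_morphism A B (f : A -> B) : Prop :=
  exists (I : Type) (le : I -> I -> Prop) (e : I -> A),
    approximate_unit le e /\ approximate_unit le (f \o e).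

(* functionals with the weak* topology *)
Definition weakstar A := {ptws A -> R[i]^o}.

Definition strictly_positive A (h : A) : Prop :=
  self_adjoint A h /\ forall phi : A -> R[i], states A phi -> 0 < phi h.

(* phi restricts to a character of M *)
Definition character_on A (M : set A) (phi : A -> R[i]) : Prop :=
  (forall a b : A, M a -> M b -> phi (a ** b) = phi a * phi b) /\
  (exists2 a : A, M a & phi a != 0).

(* (A, d) induces the weak* topology: the relatively weak* open subsets of
   S(A) are the d-open ones *)
Definition induces_weakstar A
    (d : (A -> R[i]) -> (A -> R[i]) -> \bar R) : Prop :=
  forall U : set (A -> R[i]), U `<=` states A ->
    (exists2 V : set (weakstar A), open V &
       forall phi : A -> R[i], U phi <-> V phi /\ states A phi) <->
    (forall phi : A -> R[i], U phi -> exists2 eps : R, 0 < eps &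
       forall psi : A -> R[i], states A psi -> (d phi psi < eps%:E)%E -> U psi).

Definition metrizes_weakstar A
    (d : (A -> R[i]) -> (A -> R[i]) -> \bar R) : Prop :=
  [/\ forall phi psi : A -> R[i], states A phi -> states A psi ->
        [/\ (0 <= d phi psi < +oo)%E, d phi psi = 0%E <-> phi = psi &
            d phi psi = d psi phi],
      forall phi psi chi : A -> R[i],
        states A phi -> states A psi -> states A chi ->
        (d phi chi <= d phi psi + d psi chi)%E &
      induces_weakstar d].

End StarMorphisms.

Section Lipschitz.
Context {R : realType}.

(* A seminorm defined on the subspace [dom L]; the values of [lip L] outside
   [dom L] are meaningless. *)
Record lipPair (A : cstarType R) := LipPair {
  dom : set A ;
  lip : A -> R
}.

Implicit Types A B D : cstarType R.

Definition dom_sa A (L : lipPair A) : set A := dom L `&` self_adjoint A.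

Definition hermitian_seminorm A (L : lipPair A) : Prop :=
  [/\ [/\ forall a, dom L a -> 0 <= lip L a,
          forall a b, dom L a -> dom L b -> lip L (a + b) <= lip L a + lip L b &
          forall (z : R[i]) a, dom L a -> lip L (z *: a) = rnorm z * lip L a] &
      forall a, dom L a -> lip L (star a) = lip L a].

Definition norm_modulo_constants A (L : lipPair A) : Prop :=
  (unital A -> [set a | dom L a /\ lip L a = 0] = scalars A) /\
  (~ unital A -> forall a, dom L a -> lip L a = 0 -> a = 0).

Definition leibniz A (L : lipPair A) : Prop :=
  forall a b, dom L a -> dom L b ->
    lip L (a ** b) <= rnorm a * lip L b + lip L a * rnorm b.

Definition lip_norm A (L : lipPair A) : Prop :=
  [/\ star_subalgebra (dom L), dense (dom L), hermitian_seminorm L,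
      norm_modulo_constants L & leibniz L].

Definition norm_LM A (L : lipPair A) (M : R) (a : A) : R :=
  Num.max (M^-1 * rnorm a) (lip L a).

Definition mk A (L : lipPair A) (phi psi : A -> R[i]) : \bar R :=
  ereal_sup [set (rnorm (phi a - psi a))%:E |
             a in [set a | dom_sa L a /\ lip L a <= 1]].

Definition bl A (L : lipPair A) (M : R) (phi psi : A -> R[i]) : \bar R :=
  ereal_sup [set (rnorm (phi a - psi a))%:E |
             a in [set a | dom_sa L a /\ norm_LM L M a <= 1]].

Definition qdiam A (L : lipPair A) : \bar R :=
  ereal_sup [set mk L p.1 p.2 |
             p in [set p | states A p.1 /\ states A p.2]].

(* The elements h (b + t 1_A) h, with L(b) <= 1 and mu(b) = - t: these lie in A
   and are computed there, also when 1_A is the unit of the unitization,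
   of which A is an isometric ideal. *)
Definition lip_sandwich A (L : lipPair A) (h : A) (mu : A -> R[i]) : set A :=
  [set c | exists (b : A) (t : R),
     [/\ dom_sa L b, lip L b <= 1, mu b = - t%:C &
         c = h ** b ** h + t%:C *: (h ** h)]].

Definition quantum_compact A (L : lipPair A) : Prop :=
  [/\ unital A, lip_norm L,
      closed [set a | dom_sa L a /\ lip L a <= 1] &
      metrizes_weakstar (mk L)].

Definition sqlcms A (L : lipPair A) : Prop :=
  [/\ separable A, lip_norm L,
      induces_weakstar (bl L 1),
      closed [set a | dom_sa L a /\ lip L a <= 1] &
      exists (h : A) (mu : A -> R[i]),
        [/\ strictly_positive h, states A mu, mu h = 1 &
            bounded_set (lip_sandwich L h mu)]].

Definition pin A (L : lipPair A) (mu : A -> R[i]) : Prop :=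
  states A mu /\
  states A `<=`
    closure ([set phi | states A phi /\ (mk L phi mu < +oo)%E] :
               set (weakstar A)).

Definition exhaustive_sequence A (L : lipPair A) (mu : A -> R[i])
    (h : nat -> A) : Prop :=
  [/\ forall n, dom_sa L (h n),
      lip L (h n) @[n --> \oo] --> (0 : R),
      (mu (h n) : R[i]^o) @[n --> \oo] --> (1 : R[i]^o) &
      rnorm (h n) @[n --> \oo] --> (1 : R)].

Definition topography A (L : lipPair A) (M : set A) : Prop :=
  abelian_cstar_subalgebra M /\
  exists h : A, [/\ M h, dom L h, strictly_positive h &
    exists mu : A -> R[i],
      [/\ states A mu, character_on M mu & bounded_set (lip_sandwich L h mu)]].

Definition topographic_sqlcms A (L : lipPair A) (M : set A) : Prop :=
  sqlcms L /\ topography L M.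

Definition pointed_proper A (L : lipPair A) (M : set A) (mu : A -> R[i]) :
    Prop :=
  [/\ topographic_sqlcms L M, pin L mu, character_on M mu &
      exists2 h : nat -> A, exhaustive_sequence L mu h & forall n, M (h n)].

(* The inclusion of domains is the reading "L = +oo outside its domain" of
   L_A(a) = inf {L_D(d) : pi(d) = a}. *)
Definition quantum_isometry D A (LD : lipPair D) (LA : lipPair A)
    (pi : D -> A) : Prop :=
  [/\ star_morphism pi,
      (forall a, exists d, pi d = a),
      pi @` dom LD `<=` dom LA &
      forall a, dom_sa LA a ->
        (lip LA a)%:E =
        ereal_inf [set (lip LD d)%:E | d in [set d | dom_sa LD d /\ pi d = a]]].

Definition quantum_M_isometry (M : R) D A (LD : lipPair D) (LA : lipPair A)
    (pi : D -> A) : Prop :=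
  [/\ star_morphism pi /\ (forall a, exists d, pi d = a),
      proper_morphism pi,
      pi @` dom LD = dom LA,
      (forall a, dom_sa LA a ->
        (norm_LM LA M a)%:E =
        ereal_inf [set (norm_LM LD M d)%:E |
                   d in [set d | dom_sa LD d /\ pi d = a]]) &
      (forall d, dom_sa LD d -> lip LA (pi d) <= lip LD d)].

Definition topographic_isometry D A (LD : lipPair D) (MD : set D)
    (LA : lipPair A) (MA : set A) (pi : D -> A) : Prop :=
  pi @` MD `<=` MA /\
  forall a (eps : R), dom_sa LA a -> MA a -> 0 < eps ->
    exists d, [/\ MD d, dom_sa LD d, pi d = a,
                  rnorm d <= expR eps * rnorm a &
                  lip LD d <= expR eps * lip LA a].

Definition included_upto (T : Type) (d : T -> T -> \bar R) (eps : R)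
    (X Y : set T) : Prop :=
  forall x, X x -> (ereal_inf [set d x y | y in Y] <= eps%:E)%E.

Definition hausdorff_dist (T : Type) (d : T -> T -> \bar R) (X Y : set T) :
    \bar R :=
  maxe (ereal_sup [set ereal_inf [set d x y | y in Y] | x in X])
       (ereal_sup [set ereal_inf [set d x y | x in X] | y in Y]).

(* pi^*(F) *)
Definition pullback D A (pi : D -> A) (F : set (A -> R[i])) :
    set (D -> R[i]) := [set phi \o pi | phi in F].

(* e Q(D) e *)
Definition compressed_quasi_states D (e : D) : set (D -> R[i]) :=
  [set (fun d => phi (e ** d ** e)) | phi in quasi_states D].

End Lipschitz.

Record pointedQCMS (R : realType) := PointedQCMS {
  qcms_alg : cstarType R ;
  qcms_lip : lipPair qcms_alg ;
  qcms_pt : qcms_alg -> R[i] ;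
  qcms_compact : quantum_compact qcms_lip ;
  qcms_state : states qcms_alg qcms_pt
}.

Arguments qcms_pt {R} p _.

(* Only the data (A, L, M, mu) of a pointed proper quantum metric space: the
   axioms [pointed_proper] are required of both ends of a [tunnel]. *)
Record pointedPQMS (R : realType) := PointedPQMS {
  pqms_alg : cstarType R ;
  pqms_lip : lipPair pqms_alg ;
  pqms_topo : set pqms_alg ;
  pqms_pt : pqms_alg -> R[i]
}.

Arguments pqms_topo {R} p _.
Arguments pqms_pt {R} p _.

(* (A, L, C 1_A, mu) *)
Definition proper_of_compact (R : realType) (X : pointedQCMS R) :
    pointedPQMS R :=
  PointedPQMS (qcms_lip X) (scalars (qcms_alg X)) (qcms_pt X).

Section Tunnels.
Context {R : realType}.

Record compactTunnel (X Y : pointedQCMS R) := CompactTunnel {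
  ct_alg : cstarType R ;
  ct_lip : lipPair ct_alg ;
  ct_left : ct_alg -> qcms_alg X ;
  ct_right : ct_alg -> qcms_alg Y ;
  ct_compact : quantum_compact ct_lip ;
  ct_leftP : quantum_isometry ct_lip (qcms_lip X) ct_left ;
  ct_rightP : quantum_isometry ct_lip (qcms_lip Y) ct_right
}.

Arguments ct_left {X Y} c _.
Arguments ct_right {X Y} c _.

Definition pointed_extent (X Y : pointedQCMS R) (t : compactTunnel X Y) :
    \bar R :=
  let d := mk (ct_lip t) in
  maxe (maxe (hausdorff_dist d (states _)
                (pullback (ct_left t) (states _)))
             (hausdorff_dist d (states _)
                (pullback (ct_right t) (states _))))
       (d (qcms_pt X \o ct_left t) (qcms_pt Y \o ct_right t)).

Definition pointed_propinquity (X Y : pointedQCMS R) : \bar R :=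
  ereal_inf [set x | exists t : compactTunnel X Y, x = pointed_extent t].

Record tunnel (M : R) (X Y : pointedPQMS R) := Tunnel {
  tun_alg : cstarType R ;
  tun_lip : lipPair tun_alg ;
  tun_topo : set tun_alg ;
  tun_left : tun_alg -> pqms_alg X ;
  tun_right : tun_alg -> pqms_alg Y ;
  tun_elt : tun_alg ;
  tun_source : pointed_proper (pqms_lip X) (pqms_topo X) (pqms_pt X) ;
  tun_target : pointed_proper (pqms_lip Y) (pqms_topo Y) (pqms_pt Y) ;
  tun_sqlcms : topographic_sqlcms tun_lip tun_topo ;
  tun_eltP : dom_sa tun_lip tun_elt /\ tun_topo tun_elt ;
  tun_leftP : quantum_M_isometry M tun_lip (pqms_lip X) tun_left ;
  tun_left_topo :
    topographic_isometry tun_lip tun_topo (pqms_lip X) (pqms_topo X) tun_left ;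
  tun_rightP : quantum_M_isometry M tun_lip (pqms_lip Y) tun_right ;
  tun_right_topo :
    topographic_isometry tun_lip tun_topo (pqms_lip Y) (pqms_topo Y) tun_right ;
  tun_pin : pin tun_lip (pqms_pt X \o tun_left)
}.

Arguments tun_left {M X Y} t _.
Arguments tun_right {M X Y} t _.

Definition extent (M : R) (X Y : pointedPQMS R) (t : tunnel M X Y) : \bar R :=
  let L := tun_lip t in
  let e := tun_elt t in
  let piX := tun_left t in
  let piY := tun_right t in
  maxe (maxe
    (ereal_inf [set eps%:E | eps in [set eps : R |
       [/\ 0 < eps,
           included_upto (bl L M) eps (compressed_quasi_states e)
             (pullback piX (quasi_states _)) &
           included_upto (bl L M) eps (compressed_quasi_states e)
             (pullback piY (quasi_states _))]]])
    (mk L (pqms_pt X \o piX) (pqms_pt Y \o piY)))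
    (Num.max (2 * M * lip L e)
       (Num.max (rnorm (1 - pqms_pt X (piX e)))
                (rnorm (1 - pqms_pt Y (piY e)))))%:E.

Definition local_metametric (M : R) (X Y : pointedPQMS R) : \bar R :=
  ereal_inf [set x | exists t : tunnel M X Y, x = extent t].

(* [maxe 0] is the convention sup set0 = 0, needed when 1 < eps. *)
Definition metametric (X Y : pointedPQMS R) : \bar R :=
  maxe
    (ereal_inf [set eps%:E | eps in [set eps : R | 0 < eps /\
       (maxe 0 (ereal_sup [set local_metametric r X Y |
                           r in [set r : R | (1 <= r <= 1 / eps)%R]])
          < eps%:E)%E]])
    `|expeR (- qdiam (pqms_lip X)) - expeR (- qdiam (pqms_lip Y))|%E.

End Tunnels.

(* Main.v *)
Require Import Defs.
From HB Require Import structures.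
From mathcomp Require Import all_boot all_order all_algebra complex.
From mathcomp Require Import all_classical all_reals all_analysis.
From mathcomp Require Import ring lra.
Import Order.TTheory GRing.Theory Num.Theory.
Import numFieldNormedType.Exports.
Set Implicit Arguments.
Unset Strict Implicit.
Unset Printing Implicit Defensive.
Local Open Scope classical_set_scope.
Local Open Scope complex_scope.
Local Open Scope ring_scope.

(* A compact tunnel (D, L_D, pi, rho) of pointed extent less than e does not
   give an M-tunnel directly, because the lift of a given by a quantum isometry
   may have a larger norm than a. Instead, A + D + B is given the seminorm
     max (L_A a, L_D d, L_B b, |a - pi d| / e, |b - rho d| / e).
   A lift d of a with L_D d <= l satisfies |d| <= |a| + l e, since every state
   of D is within e of a state of A; rescaling d to norm at most |a| moves pi d
   by at most l e, so (a, d, rho d) is a lift of a which increases neither the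
   norm nor the seminorm. With the element (1, 1, 1) this is an M-tunnel of
   extent at most 3 e, for every M, and quantum diameters change by at most 2 e
   across the tunnel.

   The axioms of pointed proper spaces reduce to the total boundedness of the
   Lipschitz balls, which follows from the weak* compactness of the state space
   and from |a| = sup |phi a| over the states phi, for self-adjoint a. The
   latter requires enough states, hence the positivity of the elements x* x. *)

(** * Norms and products in a C*-algebra *)

(** The estimate must hold for all [M] at once, whereas a quantum isometry says nothing about norms.
    A lift that increases neither the norm nor the seminorm does not increase their maximum,
    whatever the weight [M^-1] of the norm; this is what the sum buys, at the price of letting [a]
    and [pi d] differ by [e]. The constant 3 counts comparisons: from an element of the Lipschitz
    ball to the diagonal element over its middle coordinate, from a functional on D to one on A or
    B, and from [pi d] back to [a]. The seminorm on the sum is Leibniz because [pi] and [rho] are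
    multiplicative and contractive. Total boundedness, rather than the weak* metrization, is carried
    through the construction because it passes to a finite sum coordinate by coordinate, while the
    metrization would call for a study of the states of the sum. The topographies are the scalars,
    which lift to scalars of the same norm and of seminorm zero. *)

Section RealNorm.
Context {R : realType}.
Implicit Types V : normedZmodType R[i].

Lemma normE V (v : V) : `|v| = (rnorm v)%:C.
Proof. by rewrite /rnorm RRe_real ?normr_real. Qed.

Lemma rnorm_ge0 V (v : V) : 0 <= rnorm v.
Proof. by rewrite -lecR -normE normr_ge0. Qed.

Lemma rnorm0 V : rnorm (0 : V) = 0.
Proof. by rewrite /rnorm normr0. Qed.

Lemma rnorm_eq0 V (v : V) : rnorm v = 0 -> v = 0.
Proof. by move=> v0; apply/eqP; rewrite -normr_eq0 normE v0. Qed.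

Lemma rnormN V (v : V) : rnorm (- v) = rnorm v.
Proof. by rewrite /rnorm normrN. Qed.

Lemma rnormD V (v w : V) : rnorm (v + w) <= rnorm v + rnorm w.
Proof. by rewrite -lecR rmorphD /= -!normE ler_normD. Qed.

Lemma rnormB V (v w : V) : rnorm (v - w) <= rnorm v + rnorm w.
Proof. by rewrite -(rnormN w) rnormD. Qed.

Lemma rnorm_distC V (v w : V) : rnorm (v - w) = rnorm (w - v).
Proof. by rewrite -rnormN opprB. Qed.

Lemma rnorm_dist_tri V (y x z : V) :
  rnorm (x - z) <= rnorm (x - y) + rnorm (y - z).
Proof. by rewrite (le_trans _ (rnormD _ _))// addrA subrK. Qed.

Lemma rnormZ (V : normedModType R[i]) (z : R[i])
  (v : V) : rnorm (z *: v) = rnorm z * rnorm v.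
Proof. by apply: complexI; rewrite rmorphM /= -!normE normrZ. Qed.

Lemma rnormM (z w : R[i]) : rnorm (z * w) = rnorm z * rnorm w.
Proof. by apply: complexI; rewrite rmorphM /= -!normE normrM. Qed.

Lemma rnorm_real (t : R) : rnorm (t%:C) = `|t|.
Proof. by rewrite /rnorm normc_def /= expr0n /= addr0 sqrtr_sqr. Qed.

Lemma rnormi : rnorm ('i%C : R[i]) = 1.
Proof. by rewrite /rnorm normc_def /= expr0n /= add0r expr1n sqrtr1. Qed.

Lemma rnormZr (V : normedModType R[i]) (t : R)
  (v : V) : rnorm (t%:C *: v) = `|t| * rnorm v.
Proof. by rewrite rnormZ rnorm_real. Qed.

Lemma Re_le_rnorm (z : R[i]) : `|complex.Re z| <= rnorm z.
Proof.
case: z => a b; rewrite /rnorm normc_def /= -sqrtr_sqr.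
by rewrite ler_sqrt ?addr_ge0 ?sqr_ge0// lerDl sqr_ge0.
Qed.

Lemma Im_le_rnorm (z : R[i]) : `|complex.Im z| <= rnorm z.
Proof.
case: z => a b; rewrite /rnorm normc_def /= -sqrtr_sqr.
by rewrite ler_sqrt ?addr_ge0 ?sqr_ge0// lerDr sqr_ge0.
Qed.

Lemma rnorm_le_ReIm (z : R[i]) :
  rnorm z <= `|complex.Re z| + `|complex.Im z|.
Proof.
case: z => a b; rewrite [X in rnorm X](_ : _ = a%:C + 'i%C * b%:C);
  last by simpc.
by rewrite (le_trans (rnormD _ _))// rnormM rnormi mul1r !rnorm_real.
Qed.

End RealNorm.

Section CStarRing.
Context {R : realType} {A : cstarType R}.
Implicit Types a b c : A.

Lemma cmul0l a : 0 ** a = 0.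
Proof. by rewrite -(scale0r a) cmulZl !scale0r. Qed.

Lemma cmul0r a : a ** 0 = 0.
Proof. by rewrite -(scale0r a) cmulZr !scale0r. Qed.

Lemma cmulNl a b : (- a) ** b = - (a ** b).
Proof. by rewrite -scaleN1r cmulZl scaleN1r. Qed.

Lemma cmulNr a b : a ** (- b) = - (a ** b).
Proof. by rewrite -scaleN1r cmulZr scaleN1r. Qed.

Lemma conjCR (t : R) : (t%:C : R[i])^* = t%:C.
Proof. exact: conjc_real. Qed.

Lemma star0 : star (0 : A) = 0.
Proof. by rewrite -(scale0r 0) starZ rmorph0 !scale0r. Qed.

Lemma starN a : star (- a) = - star a.
Proof. by rewrite -scaleN1r starZ rmorphN1 scaleN1r. Qed.

Lemma starB a b : star (a - b) = star a - star b.
Proof. by rewrite starD starN. Qed.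

Lemma starZr (t : R) a : star (t%:C *: a) = t%:C *: star a.
Proof. by rewrite starZ conjCR. Qed.

Lemma rnorm_cmul a b : rnorm (a ** b) <= rnorm a * rnorm b.
Proof. by rewrite -lecR rmorphM /= -!normE norm_cmul. Qed.

Lemma rnorm_cstar a : rnorm (star a ** a) = rnorm a ^+ 2.
Proof. by apply: complexI; rewrite rmorphXn /= -!normE norm_cstar. Qed.

Lemma rnorm_star a : rnorm (star a) = rnorm a.
Proof.
have le b : rnorm b <= rnorm (star b).
  have [->|b0] := eqVneq (rnorm b) 0; first exact: rnorm_ge0.
  have bp : 0 < rnorm b by rewrite lt_neqAle eq_sym b0 rnorm_ge0.
  by rewrite -(ler_pM2r bp) -expr2 -rnorm_cstar rnorm_cmul.
by apply/eqP; rewrite eq_le le andbT -{2}(starK a) le.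
Qed.

Lemma unit_unique (u v : A) : is_unit u -> is_unit v -> u = v.
Proof. by move=> /(_ v) [uv _] /(_ u) [_]; rewrite uv. Qed.

Lemma star_unit (u : A) : is_unit u -> star u = u.
Proof.
move=> uU; apply: unit_unique => // a.
by split; rewrite -(starK a) -starM ?(uU _).1 ?(uU _).2.
Qed.

End CStarRing.

(* A decision procedure for linear identities between noncommutative
   polynomials: both sides are expanded into combinations of words, whose
   coefficients are compared with [ring] or [field]. *)
Section WordExpansion.
Context {R : realType} {A : cstarType R}.

Inductive wexp :=
  WVar of nat | WOne | WZero | WAdd of wexp & wexp | WOpp of wexp
| WScale of R[i] & wexp | WMul of wexp & wexp.

Section Eval.
Variables (u : A) (env : list A).

Fixpoint weval (e : wexp) : A :=
  match e with
  | WVar n => seq.nth 0 env n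
  | WOne => u
  | WZero => 0
  | WAdd e f => weval e + weval f
  | WOpp e => - weval e
  | WScale z e => z *: weval e
  | WMul e f => weval e ** weval f
  end.

Fixpoint word_eval (w : list nat) : A :=
  match w with nil => u | cons n w => seq.nth 0 env n ** word_eval w end.

Fixpoint comb_eval (l : list (R[i] * list nat)) : A :=
  match l with nil => 0 | cons p l => p.1 *: word_eval p.2 + comb_eval l end.

End Eval.

Fixpoint lcat T (l m : list T) : list T :=
  match l with nil => m | cons x l => cons x (lcat l m) end.

Fixpoint comb_scale (z : R[i]) (l : list (R[i] * list nat)) :=
  match l with nil => nil | cons (y, w) l =>
    cons (z * y, w) (comb_scale z l) end.

Fixpoint comb_word (z : R[i]) (v : list nat) (l : list (R[i] * list nat)) :=
  match l with
  | nil => nil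
  | cons (y, w) l => cons (z * y, lcat v w) (comb_word z v l)
  end.

Fixpoint comb_mul (l m : list (R[i] * list nat)) :=
  match l with
  | nil => nil
  | cons (z, v) l => lcat (comb_word z v m) (comb_mul l m)
  end.

Fixpoint wnorm (e : wexp) : list (R[i] * list nat) :=
  match e with
  | WVar n => cons (1, cons n nil) nil
  | WOne => cons (1, nil) nil
  | WZero => nil
  | WAdd e f => lcat (wnorm e) (wnorm f)
  | WOpp e => comb_scale (- 1) (wnorm e)
  | WScale z e => comb_scale z (wnorm e)
  | WMul e f => comb_mul (wnorm e) (wnorm f)
  end.

Fixpoint word_eqb (v w : list nat) : bool :=
  match v, w with
  | nil, nil => true
  | cons m v, cons n w => if Nat.eqb m n then word_eqb v w else false
  | _, _ => false
  end.

Fixpoint coef (w : list nat) (l : list (R[i] * list nat)) : R[i] :=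
  match l with
  | nil => 0
  | cons (z, v) l => if word_eqb v w then z + coef w l else coef w l
  end.

Fixpoint strip (w : list nat) (l : list (R[i] * list nat)) :=
  match l with
  | nil => nil
  | cons (z, v) l => if word_eqb v w then strip w l else cons (z, v) (strip w l)
  end.

(** Each round collects the coefficient of the leading word and strips that word. The result of
    [strip] is not a structural subterm, hence the fuel, which must reach the number of distinct
    words; running out yields [False], so the test stays sound. *)
Fixpoint all_coef0 (fuel : nat) (l : list (R[i] * list nat)) : Prop :=
  match fuel, l with
  | _, nil => True
  | 0%N, _ => False
  | fuel.+1, cons (z, v) m =>
      z + coef v m = 0 /\ all_coef0 fuel (strip v m)
  end.

Lemma word_eqb_eq v w : word_eqb v w -> v = w.
Proof.
elim: v w => [|m v IH] [|n w] //=.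
by case: PeanoNat.Nat.eqb_spec => // -> /IH ->.
Qed.

Variables (u : A) (env : list A).
Hypothesis uU : is_unit u.

Lemma comb_eval_cat l m :
  comb_eval u env (lcat l m) = comb_eval u env l + comb_eval u env m.
Proof. by elim: l => [|p l /= ->]; rewrite ?add0r ?addrA. Qed.

Lemma comb_eval_scale z l :
  comb_eval u env (comb_scale z l) = z *: comb_eval u env l.
Proof.
by elim: l => [|[y w] l /= ->]; rewrite ?scaler0// scalerDr scalerA.
Qed.

Lemma word_eval_cat v w :
  word_eval u env (lcat v w) = word_eval u env v ** word_eval u env w.
Proof. by elim: v => [|n v /= ->]; rewrite ?(uU _).1 ?cmulA. Qed.

Lemma comb_eval_word z v l :
  comb_eval u env (comb_word z v l) =
  z *: (word_eval u env v ** comb_eval u env l).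
Proof.
elim: l => [|[y w] l /= ->]; first by rewrite cmul0r scaler0.
by rewrite cmulDr scalerDr cmulZr scalerA word_eval_cat.
Qed.

Lemma comb_eval_mul l m :
  comb_eval u env (comb_mul l m) = comb_eval u env l ** comb_eval u env m.
Proof.
elim: l => [|[z v] l /= IH]; first by rewrite cmul0l.
by rewrite comb_eval_cat comb_eval_word IH cmulDl cmulZl.
Qed.

Lemma wnormE e : comb_eval u env (wnorm e) = weval u env e.
Proof.
elim: e => [n|||e IHe f IHf|e IHe|z e IHe|e IHe f IHf] //=.
- by rewrite scale1r addr0 (uU _).2.
- by rewrite scale1r addr0.
- by rewrite comb_eval_cat IHe IHf.
- by rewrite comb_eval_scale IHe scaleN1r.
- by rewrite comb_eval_scale IHe.
- by rewrite comb_eval_mul IHe IHf.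
Qed.

Lemma comb_eval_strip w l :
  comb_eval u env l =
  coef w l *: word_eval u env w + comb_eval u env (strip w l).
Proof.
elim: l => [|[z v] l /= IH]; first by rewrite scale0r add0r.
case: ifP => [/word_eqb_eq ->|_]; rewrite IH.
  by rewrite scalerDl addrA.
by rewrite /= addrCA.
Qed.

Lemma all_coef0P n l : all_coef0 n l -> comb_eval u env l = 0.
Proof.
elim: n l => [|n IH] [|[z v] l] //= [zv /IH l0].
by rewrite (comb_eval_strip v) addrA -scalerDl zv scale0r add0r.
Qed.

Lemma wexp_eq n e f : all_coef0 n (wnorm (WAdd e (WOpp f))) ->
  weval u env e = weval u env f.
Proof.
by move=> /all_coef0P; rewrite wnormE /= => /eqP; rewrite subr_eq0 => /eqP.
Qed.

End WordExpansion.

Ltac env_index x env :=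
  lazymatch env with
  | cons x _ => constr:(0%N)
  | cons _ ?env => let n := env_index x env in constr:(S n)
  end.

Ltac env_add x env :=
  lazymatch env with
  | context [cons x _] => env
  | _ => constr:(cons x env)
  end.

Ltac env_of u e env :=
  lazymatch e with
  | u => env
  | ?a + ?b => let env := env_of u a env in env_of u b env
  | - ?a => env_of u a env
  | ?z *: ?a => env_of u a env
  | ?a ** ?b => let env := env_of u a env in env_of u b env
  | 0 => env
  | ?a => env_add a env
  end.

Ltac wreify R u e env :=
  lazymatch e with
  | u => constr:(@WOne R)
  | ?a + ?b => let x := wreify R u a env in let y := wreify R u b env in
      constr:(@WAdd R x y)
  | - ?a => let x := wreify R u a env in constr:(@WOpp R x)
  | ?z *: ?a => let x := wreify R u a env in constr:(@WScale R z x)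
  | ?a ** ?b => let x := wreify R u a env in let y := wreify R u b env in
      constr:(@WMul R x y)
  | 0 => constr:(@WZero R)
  | ?a => let n := env_index a env in constr:(@WVar R n)
  end.

Ltac expand_words uU :=
  lazymatch type of uU with
  | @is_unit ?R ?A ?u =>
    lazymatch goal with
    | |- ?e = ?f =>
      let env := env_of u e constr:(@nil A) in
      let env := env_of u f env in
      let x := wreify R u e env in
      let y := wreify R u f env in
      apply: (@wexp_eq R A u env uU 100 x y);
      (* Only the word machinery is unfolded, so that the coefficients remain ring expressions; 100
         is the fuel of [all_coef0]. *)
      cbv beta iota zeta delta [wnorm lcat comb_scale comb_word comb_mul
        word_eqb coef strip all_coef0 Nat.eqb]
    end
  end.

Ltac walg uU := expand_words uU; repeat split; try (first [by ring | by field]).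

(** * Topology and completeness in terms of the real-valued norm *)

Section RealNbhs.
Context {R : realType}.

Lemma posCE (z : R[i]) : 0 < z -> exists2 e : R, 0 < e & z = e%:C.
Proof.
move=> z0; have zr : z \is Num.real by rewrite gtr0_real.
exists (complex.Re z); last by rewrite RRe_real.
by rewrite -ltcR RRe_real.
Qed.

Lemma nbhs_rnormP (V : normedModType R[i]) (x : V) (P : set V) :
  nbhs x P <-> exists2 e : R, 0 < e & forall y, rnorm (x - y) < e -> P y.
Proof.
split=> [/nbhs_normP[z /= /posCE[e e0 ->] sub]|[e e0 sub]].
  by exists e => // y xy; apply: sub; rewrite /= /ball_ /= normE ltcR.
apply/nbhs_normP; exists (e%:C); first by rewrite /= ltcR.
by move=> y; rewrite /ball_ /= normE ltcR => /sub.
Qed.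

Lemma closed_rnormP (V : normedModType R[i]) (S : set V) :
  closed S <->
  forall x, (forall e : R, 0 < e -> exists2 y, S y & rnorm (x - y) < e) -> S x.
Proof.
split=> clS x xS.
  apply: clS => B /nbhs_rnormP[e e0 sub].
  by have [y Sy xy] := xS e e0; exists y; split => //; apply: sub.
apply: clS => e e0.
have /xS [y [Sy xy]] : nbhs x [set y | rnorm (x - y) < e].
  by apply/nbhs_rnormP; exists e.
by exists y.
Qed.

Lemma dense_rnormP (V : normedModType R[i]) (S : set V) :
  dense S <->
  forall x (e : R), 0 < e -> exists2 y, S y & rnorm (x - y) < e.
Proof.
split=> dS.
  move=> x e e0.
  have /nbhs_rnormP : nbhs x [set y | rnorm (x - y) < e] by apply/nbhs_rnormP;
    exists e.
  move=> [e' e'0 sub].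
  have [] := dS (ball x (e'%:C)).
  - by exists x; apply: ballxx; rewrite ltcR.
  - exact: ball_open.
  move=> y [+ Sy]; rewrite -ball_normE /ball_ /= normE ltcR => /sub xy.
  by exists y.
move=> O [x Ox]; rewrite openE => /(_ x Ox) /nbhs_rnormP [e e0 sub].
by have [y Sy /sub Oy] := dS x e e0; exists y.
Qed.

(** A majorant argument: [t] is nondecreasing because its increments dominate norms, so being
    bounded it converges, and its Cauchy property passes to [w]. *)
Lemma complete_rnorm (V : completeNormedModType R[i]) (w : nat -> V)
    (t : nat -> R) (K : R) :
  (forall n m, (n <= m)%N -> rnorm (w m - w n) <= t m - t n) ->
  (forall n, t n <= K) ->
  exists l, forall e : R, 0 < e -> \forall n \near \oo, rnorm (w n - l) < e.
Proof.
move=> wt tK.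
have t_mono : nondecreasing_seq t.
  by move=> n m nm; rewrite -subr_ge0 (le_trans (rnorm_ge0 _) (wt _ _ nm)).
have /cauchy_cvgP/cauchyP tC : cvgn t.
  by apply: nondecreasing_is_cvgn => //; exists K => _ [n _ <-].
have wC : cauchy (w @ \oo).
  apply: cauchy_exP => z /posCE[e e0 ->].
  have [x [N _ xN]] := tC _ (divr_gt0 e0 (ltr0Sn _ 1)).
  exists (w N), N => // n /= Nn.
  rewrite /= -ball_normE /ball_ /= normE ltcR rnorm_distC.
  rewrite (le_lt_trans (wt _ _ Nn))//.
  have := xN n Nn; have := xN N (leqnn N).
  rewrite /= -!ball_normE /ball_ /=.
  by rewrite !ltr_norml => /andP[? ?] /andP[? ?]; lra.
have /cauchy_cvg/cvg_ex[l wl] := wC.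
exists l => e e0; have /wl : nbhs l [set y | rnorm (y - l) < e].
  by apply/nbhs_rnormP; exists e => // y; rewrite rnorm_distC.
by [].
Qed.

(** Identities between limits are obtained by bounding their defect by a multiple of an arbitrary
    tolerance; the factor [C] may depend on the elements at hand, but not on the tolerance. *)
Lemma rnorm_small0 (V : normedZmodType R[i]) (x : V) (C : R) :
  (forall e : R, 0 < e -> rnorm x <= C * e) -> x = 0.
Proof.
move=> xe; apply: rnorm_eq0; apply/eqP; rewrite eq_le rnorm_ge0 andbT.
apply/ler_addgt0Pl => e e0; rewrite addr0.
have C1 : 0 < `|C| + 1 by rewrite ltr_wpDl.
rewrite (le_trans (xe (e / (`|C| + 1)) (divr_gt0 e0 C1)))//.
rewrite mulrA ler_pdivrMr// mulrC ler_pM2l// (le_trans (ler_norm C))//.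
by rewrite lerDl.
Qed.

End RealNbhs.

(** * The positive cone of a unital C*-algebra *)

Section Cone.
Context {R : realType} {A : cstarType R}.
Variables (u : A) (uU : is_unit u).
Implicit Types (a b c x y z w : A) (r s t : R).

Let mulu a : u ** a = a. Proof. exact: (uU a).1. Qed.
Let umul a : a ** u = a. Proof. exact: (uU a).2. Qed.

Lemma rnorm_unit_le1 : rnorm u <= 1.
Proof.
have := rnorm_cstar u; rewrite (star_unit uU) mulu => u2.
have [->|u0] := eqVneq (rnorm u) 0 => //.
by move: u2; rewrite expr2 => /eqP;
  rewrite -{1}[rnorm u]mulr1 (inj_eq (mulfI u0))
  => /eqP <-.
Qed.

Lemma rnorm_unit : u != 0 -> rnorm u = 1.
Proof.
move=> u0; have := rnorm_cstar u; rewrite (star_unit uU) mulu => u2.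
have ru0 : rnorm u != 0 by apply: contra u0 => /eqP/rnorm_eq0 ->.
by move: u2; rewrite expr2 => /eqP;
  rewrite -{1}[rnorm u]mulr1 (inj_eq (mulfI ru0))
  => /eqP <-.
Qed.

Lemma rnormZu_le r : rnorm (r%:C *: u) <= `|r|.
Proof. by rewrite rnormZr ler_piMr// rnorm_unit_le1. Qed.

Lemma star_Zu r : star (r%:C *: u) = r%:C *: u.
Proof. by rewrite starZr (star_unit uU). Qed.

(** The substitute for [w] being a limit of polynomials in [z]: in place of a functional calculus,
    this provides the commutations between square roots. *)
Definition commutant_incl z w := forall x, x ** z = z ** x -> x ** w = w ** x.

(* [u - w] is the square root of [u - z]: [w] is the limit of the iteration
   w' = (z + w w) / 2, whose increments are dominated by those of the scalar
   iteration t' = (1 + t t) / 2, which increases to at most 1. *)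
Lemma sqrt_iteration z : star z = z -> rnorm z <= 1 ->
  exists w, [/\ star w = w, rnorm w <= 1, w + w = z + w ** w &
                commutant_incl z w].
Proof.
move=> zsa z1.
pose t := fix t n := if n is n.+1 then (1 + t n ^+ 2) / 2 else 0 : R.
pose w := fix w n := if n is n.+1 then (2^-1)%:C *: (z + w n ** w n) else 0 : A.
have t01 n : 0 <= t n <= 1.
  elim: n => [|n /andP[t0 t1]] /=; first by rewrite lexx ler01.
  by apply/andP; split; nra.
have tS n : t n.+1 = (1 + t n ^+ 2) / 2 by [].
have wE n : w n.+1 = (2^-1)%:C *: (z + w n ** w n) by [].
have t0 : t 0%N = 0 by [].
have w0 : w 0%N = 0 by [].
clearbody t w.
have wt n : rnorm (w n) <= t n.
  elim: n => [|n IH]; first by rewrite w0 rnorm0 t0.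
  rewrite wE tS rnormZr ger0_norm ?invr_ge0// mulrC ler_pM2r ?invr_gt0//.
  rewrite (le_trans (rnormD _ _))// lerD// (le_trans (rnorm_cmul _ _))//.
  by rewrite expr2 ler_pM ?rnorm_ge0.
have wcomm n x : x ** z = z ** x -> x ** w n = w n ** x.
  move=> xz; elim: n => [|n IH]; first by rewrite w0 cmul0l cmul0r.
  rewrite wE cmulZr cmulZl cmulDr cmulDl xz; congr (_ *: (_ + _)).
  by rewrite cmulA IH -cmulA IH cmulA.
have wz n : w n ** z = z ** w n by rewrite -wcomm.
have ww n m : w n ** w m = w m ** w n by apply: wcomm; rewrite wz.
have wS n : rnorm (w n.+1 - w n) <= t n.+1 - t n.
  elim: n => [|n IH].
    rewrite wE tS t0 w0 subr0 cmul0l addr0 rnormZr ger0_norm ?invr_ge0//.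
    by rewrite expr0n addr0 subr0 mulrC ler_pM2r ?invr_gt0.
  have -> : w n.+2 - w n.+1 =
      (2^-1)%:C *: ((w n.+1 + w n) ** (w n.+1 - w n)).
    rewrite (wE n.+1) [X in _ - X = _]wE -scalerBr; congr (_ *: _).
    rewrite cmulDl !cmulDr !cmulNr (ww n.+1 n).
    by walg uU.
  have -> : t n.+2 - t n.+1 = 2^-1 * ((t n.+1 + t n) * (t n.+1 - t n)).
    by rewrite (tS n.+1) {2}(tS n); field.
  rewrite rnormZr ger0_norm ?invr_ge0// ler_pM2l ?invr_gt0//.
  rewrite (le_trans (rnorm_cmul _ _))// ler_pM ?rnorm_ge0//.
  by rewrite (le_trans (rnormD _ _))// lerD.
have wnm n m : (n <= m)%N -> rnorm (w m - w n) <= t m - t n.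
  move=> /subnKC <-; elim: (m - n)%N => [|k IH].
    by rewrite addn0 !subrr rnorm0.
  rewrite (le_trans (rnorm_dist_tri (w (n + k)%N) _ _))//.
  by have := wS (n + k)%N; rewrite -addnS; move: IH; lra.
have [l wl] := complete_rnorm wnm (fun n => (andP (t01 n)).2).
have l1 : rnorm l <= 1.
  apply/ler_addgt0Pl => e e0; have [N _ /(_ N (leqnn N)) lN] := wl e e0.
  rewrite -[l](subrK (w N)) (le_trans (rnormD _ _))// rnorm_distC.
  by have := wt N; have /andP[_] := t01 N; move: lN => /=; lra.
exists l; split => //.
- apply/eqP; rewrite -subr_eq0; apply/eqP/(@rnorm_small0 _ _ _ 2) => e e0.
  have [N _ /(_ N (leqnn N)) lN] := wl e e0.
  have wsa n : star (w n) = w n.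
    by elim: n => [|n IH]; rewrite ?w0 ?star0// wE starZr starD starM zsa IH.
  have := rnorm_dist_tri (w N) (star l) l.
  have -> : rnorm (star l - w N) = rnorm (w N - l).
    by rewrite -{1}(wsa N) -starB rnorm_star rnorm_distC.
  by move: lN => /=; lra.
- apply/eqP; rewrite -subr_eq0; apply/eqP/(@rnorm_small0 _ _ _ 4) => e e0.
  have [N _ lN] := wl e e0; have := lN N (leqnn N); have := lN _ (leqnSn N).
  move=> /= l1N l0N.
  (* The recursion at [N] expresses the defect through the distances of [l] to [w N.+1] and to
     [w N]; the constant is 4 = 2 + 1 + 1. *)
  have -> : l + l - (z + l ** l) =
      2%:R%:C *: (l - w N.+1) + ((w N - l) ** w N + l ** (w N - l)).
    rewrite wE; walg uU.
  rewrite (le_trans (rnormD _ _))// rnormZr rnorm_distC (ger0_norm (ler0n _ 2)).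
  have H : rnorm ((w N - l) ** w N + l ** (w N - l)) <= e * 1 + 1 * e.
    rewrite (le_trans (rnormD _ _))// lerD// (le_trans (rnorm_cmul _ _))//.
      by rewrite ler_pM ?rnorm_ge0 ?(ltW l0N)// (le_trans (wt N))// (andP (t01
        N)).2.
    by rewrite ler_pM ?rnorm_ge0 ?(ltW l0N).
  lra.
- move=> x xz; apply/eqP; rewrite -subr_eq0; apply/eqP.
  apply/(@rnorm_small0 _ _ _ (2 * rnorm x)) => e e0.
  have [N _ /(_ N (leqnn N)) /= /ltW lN] := wl e e0.
  have -> : x ** l - l ** x = (w N - l) ** x - x ** (w N - l).
    by rewrite cmulDl cmulDr cmulNl cmulNr (wcomm N x xz) opprD opprK addrACA
      subrr add0r addrC.
  have l1' : rnorm ((w N - l) ** x) <= rnorm x * e.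
    by rewrite (le_trans (rnorm_cmul _ _))// mulrC ler_wpM2l ?rnorm_ge0.
  have l2' : rnorm (x ** (w N - l)) <= rnorm x * e.
    by rewrite (le_trans (rnorm_cmul _ _))// ler_wpM2l ?rnorm_ge0.
  by rewrite (le_trans (rnormB _ _))//; lra.
Qed.


(** As [b] and [c] commute, [v = b + i c] satisfies [star v ** v = b ** b + c ** c]. The C*-identity
    bounds [v], and [b] is its real part. *)
Lemma sum_squares_norm b c r : 0 <= r -> star b = b -> star c = c ->
  b ** c = c ** b -> b ** b + c ** c = r%:C *: u -> rnorm b ^+ 2 <= r.
Proof.
move=> r0 bsa csa bc bbcc; pose v := b + 'i%C *: c.
have vsa : star v = b - 'i%C *: c.
  rewrite /v starD starZ bsa csa -scaleNr; congr (_ + _ *: _).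
  exact: conjCi.
have v2 : rnorm v ^+ 2 <= r.
  rewrite -rnorm_cstar (_ : star v ** v = r%:C *: u).
    by rewrite (le_trans (rnormZu_le _))// ger0_norm.
  rewrite -bbcc vsa /v; have ii : 'i%C * 'i%C = -1 :> R[i] by rewrite -expr2
    sqr_i.
  rewrite cmulDl !cmulDr !cmulNl !cmulZl !cmulZr scalerA ii -bc.
  by walg uU.
have bv : rnorm b <= rnorm v.
  have -> : b = (2^-1)%:C *: (v + star v).
    rewrite vsa /v addrACA subrr addr0 scalerDr -scalerDl -rmorphD /=.
    by rewrite (_ : 2^-1 + 2^-1 = 1 :> R) ?scale1r//; field.
  rewrite rnormZr ger0_norm ?invr_ge0//.
  by have := rnormD v (star v); rewrite rnorm_star; lra.
by rewrite (le_trans _ v2)// lerXn2r ?nnegrE ?rnorm_ge0.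
Qed.

(* The order-theoretic positive elements; [positive_star_mul] below shows that
   they include the elements [star x ** x]. *)
Definition pos y := star y = y /\
  exists2 s, 0 <= s & rnorm (s%:C *: u - y) <= s.

Lemma pos_unit_sub r y : star y = y -> rnorm y <= r -> pos (r%:C *: u - y).
Proof.
move=> ysa yr; split; first by rewrite starB star_Zu ysa.
exists r; first by rewrite (le_trans (rnorm_ge0 y)).
by rewrite opprB addrC subrK.
Qed.

Lemma pos_unit_add r y : star y = y -> rnorm y <= r -> pos (r%:C *: u + y).
Proof.
move=> ysa yr; rewrite -[y]opprK; apply: pos_unit_sub; rewrite ?rnormN//.
by rewrite starN ysa.
Qed.

Lemma posD x y : pos x -> pos y -> pos (x + y).
Proof.
move=> [xsa [s s0 xs]] [ysa [t t0 yt]]; split; first by rewrite starD xsa ysa.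
exists (s + t); first exact: addr_ge0.
rewrite rmorphD /= scalerDl opprD addrACA (le_trans (rnormD _ _))//.
exact: lerD.
Qed.

Lemma posZ r y : 0 <= r -> pos y -> pos (r%:C *: y).
Proof.
move=> r0 [ysa [s s0 ys]]; split; first by rewrite starZr ysa.
exists (r * s); first exact: mulr_ge0.
rewrite rmorphM /= -scalerA -scalerBr rnormZr ger0_norm//.
exact: ler_wpM2l.
Qed.

Lemma posu r : 0 <= r -> pos (r%:C *: u).
Proof.
move=> r0; have := @pos_unit_add r 0; rewrite addr0; apply; first exact: star0.
by rewrite rnorm0.
Qed.

Lemma pos0 : pos 0.
Proof. by have := posu (lexx 0); rewrite scale0r. Qed.

(** For a radius [r] of positivity, [z = u - y / r] has norm at most 1, and the iteration gives [w]
    with [(u - w) ** (u - w) = y / r]; the root is [u - w] times the square root of [r]. *)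
Lemma pos_sqrt y : pos y ->
  exists a, [/\ star a = a, pos a, y = a ** a & commutant_incl y a].
Proof.
move=> [ysa [s s0 ys]].
have [r r0 yr] : exists2 r, 0 < r & rnorm (r%:C *: u - y) <= r.
  (* The radius is enlarged to be positive, since it is about to be inverted. *)
  exists (s + 1); first by rewrite ltr_wpDl.
  rewrite rmorphD /= scalerDl addrAC (le_trans (rnormD _ _))// lerD//.
  by rewrite (le_trans (rnormZu_le _))// normr1.
pose z := u - (r^-1)%:C *: y.
have rz : r%:C *: z = r%:C *: u - y.
  by rewrite /z scalerBr scalerA -rmorphM /= divff ?gt_eqF// scale1r.
have [||w [wsa w1 wz wy]] := @sqrt_iteration z.
- by rewrite /z starB starZr ysa (star_unit uU).
- by rewrite -(ler_pM2l r0) mulr1 -{1}(ger0_norm (ltW r0)) -rnormZr rz.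
exists ((Num.sqrt r)%:C *: (u - w)); split.
- by rewrite starZr starB wsa (star_unit uU).
- apply: posZ; first exact: sqrtr_ge0.
  by have := pos_unit_sub wsa w1; rewrite scale1r.
- rewrite cmulZl cmulZr scalerA -rmorphM /= -expr2 sqr_sqrtr ?(ltW r0)//.
  have -> : (u - w) ** (u - w) = u - z.
    have -> : z = w + w - w ** w by rewrite wz addrK.
    by walg uU.
  by rewrite scalerBr rz subKr.
- move=> x xy; rewrite cmulZr cmulZl cmulDr cmulDl umul mulu cmulNl cmulNr wy//.
  by rewrite /z cmulDr cmulDl umul mulu cmulNl cmulNr cmulZr cmulZl xy.
Qed.

(** After rescaling [a] to [b] of norm at most 1, the iteration produces [c = u - w] with
    [b ** b + c ** c = u]. Then [sum_squares_norm] bounds [c], and the norm of [u - b ** b] is the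
    square of that of [c]. *)
Lemma pos_sqr a : star a = a -> pos (a ** a).
Proof.
move=> asa; pose r := rnorm a + 1.
have r0 : 0 < r by rewrite ltr_wpDl ?rnorm_ge0.
pose b := (r^-1)%:C *: a.
have bsa : star b = b by rewrite starZr asa.
have b1 : rnorm b <= 1.
  by rewrite rnormZr ger0_norm ?invr_ge0 ?(ltW r0)// mulrC ler_pdivrMr// mul1r
    lerDl.
have bbsa : star (b ** b) = b ** b by rewrite starM bsa.
have bb1 : rnorm (b ** b) <= 1.
  by rewrite (le_trans (rnorm_cmul _ _))// mulr_ile1 ?rnorm_ge0.
have [w [wsa w1 wz wb]] := sqrt_iteration bbsa bb1.
have bw : b ** w = w ** b by apply: wb; rewrite cmulA.
have -> : a ** a = (r ^+ 2)%:C *: (b ** b).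
  rewrite /b cmulZl cmulZr !scalerA -!rmorphM /=.
  by rewrite (_ : _ * _ = 1) ?scale1r//; field; rewrite gt_eqF.
apply: posZ; first exact: sqr_ge0.
have csa : star (u - w) = u - w by rewrite starB (star_unit uU) wsa.
have cc : (u - w) ** (u - w) = u - b ** b.
  have -> : b ** b = w + w - w ** w by rewrite wz addrK.
  by walg uU.
split => //; exists 1 => //; rewrite scale1r -cc -{1}csa rnorm_cstar.
apply: (sum_squares_norm ler01 csa bsa).
  by rewrite cmulDl cmulDr umul mulu cmulNl cmulNr bw.
by rewrite cc subrK scale1r.
Qed.

(** The roots [a] of [y] and [c] of [r u - y] commute and their squares add up to [r u], which is
    the situation of [sum_squares_norm]. *)
Lemma pos_norm_le r y : 0 <= r -> pos y -> pos (r%:C *: u - y) -> rnorm y <= r.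
Proof.
move=> r0 /pos_sqrt[a [asa _ ya ay]] /pos_sqrt[c [csa _ yc cy]].
rewrite ya -{1}asa rnorm_cstar; apply: (sum_squares_norm r0 asa csa).
  symmetry; apply: ay; symmetry; rewrite -[y](subKr (r%:C *: u)) yc.
  by rewrite cmulDr cmulDl cmulNr cmulNl cmulZr cmulZl mulu umul cmulA.
by rewrite -ya -yc addrC subrK.
Qed.

Lemma pos_anti y : pos y -> pos (- y) -> y = 0.
Proof.
move=> y0 y'0; apply: rnorm_eq0; apply/eqP; rewrite eq_le rnorm_ge0 andbT.
by apply: pos_norm_le => //; rewrite scale0r sub0r.
Qed.

Lemma pos_commM x y : pos x -> pos y -> x ** y = y ** x -> pos (x ** y).
Proof.
move=> /pos_sqrt[a [asa _ xa ax]] /pos_sqrt[c [csa _ yc cy]] xy.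
have ac : a ** c = c ** a.
  symmetry; apply: ax; symmetry; exact: cy.
have -> : x ** y = (a ** c) ** (a ** c).
  by rewrite xa yc !cmulA -(cmulA a c a) -ac !cmulA.
by apply: pos_sqr; rewrite starM asa csa.
Qed.

Lemma rnorm_sqr_sa y : star y = y -> rnorm (y ** y) = rnorm y ^+ 2.
Proof. by move=> ysa; rewrite -rnorm_cstar ysa. Qed.

(** The two positive elements commute, so their product [r ^+ 2 u - y ** y] is positive and
    [pos_norm_le] applies to [y ** y]. *)
Lemma pos_interval_norm r y : 0 <= r ->
  pos (r%:C *: u - y) -> pos (r%:C *: u + y) -> rnorm y <= r.
Proof.
move=> r0 py py'.
have ysa : star y = y.
  by case: py' => + _; rewrite starD star_Zu => /addrI.
rewrite -(@ler_pXn2r _ 2) ?nnegrE ?rnorm_ge0// -rnorm_sqr_sa//.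
apply: pos_norm_le; [exact: sqr_ge0|exact: pos_sqr|].
have -> : (r ^+ 2)%:C *: u - y ** y = (r%:C *: u - y) ** (r%:C *: u + y).
  by walg uU.
apply: pos_commM => //.
by walg uU.
Qed.

(* Kaplansky's argument. With [c = x* x], [d = |c|] and [k = d - c], the element
   [y = x k] satisfies [y* y <= 0], and hence [0 <= y y*]; the comparison of the
   norms of [y (r + y* y)^2 y*] and [v (r + v)^2], where [v = y y*] and
   [r = |y|^2], gives [y = 0] and [c = d]. *)
Lemma neg_star_mul0 y : pos (- (star y ** y)) -> y = 0.
Proof.
have [q qE] : exists q, q = - (star y ** y) by exists (- (star y ** y)).
have [v vE] : exists v, v = y ** star y by exists (y ** star y).
rewrite -qE => pq; have [qsa _] := pq.
have pv : pos v.
  (* With [y = h + i l], the sum of [star y ** y] and [y ** star y] is twice [h ** h + l ** l]; this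
     yields the positivity of [v] from that of [q]. *)
  pose h := (2^-1)%:C *: (y + star y);
    pose l := ('i%C * (2^-1)%:C) *: (star y - y).
  have hsa : star h = h by rewrite /h starZr starD starK addrC.
  have lsa : star l = l.
    rewrite /l starZ starB starK -opprB scalerN -scaleNr; congr (_ *: _).
    by rewrite rmorphM /= conjCR [X in X * _]conjCi mulNr opprK.
  have -> : v = (2%:R%:C *: (h ** h) + 2%:R%:C *: (l ** l)) + q.
    have ii : 'i%C ^+ 2 = -1 :> R[i] by rewrite sqr_i.
    have ll : l ** l = - ((2^-1)%:C * (2^-1)%:C) *: ((star y - y) ** (star y -
      y)).
      rewrite cmulZl cmulZr scalerA; congr (_ *: _).
      by rewrite mulrACA -expr2 ii mulN1r.
    have half : (2^-1)%:C * 2%:R%:C = 1 :> R[i].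
      by rewrite -rmorphM /= mulVf ?pnatr_eq0.
    by rewrite vE ll /h qE; walg uU.
  by apply: posD => //; apply: posD; apply: posZ => //; apply: pos_sqr.
pose r := rnorm y ^+ 2; have r0 : 0 <= r by exact: sqr_ge0.
have vr : rnorm v = r by rewrite vE -{1}(starK y) rnorm_cstar rnorm_star.
have qr : rnorm q = r by rewrite qE rnormN rnorm_cstar.
have vsa := pv.1.
have pqr : rnorm (r%:C *: u - q) <= r.
  apply: pos_interval_norm => //.
    by rewrite subKr.
  apply: posD; first exact: posu.
  by apply: pos_unit_sub; rewrite ?qr.
(* Written with [y] outside, [p] has norm at most [r * r ^+ 2]; written in [v], it dominates
   [2 r v ** v], whose norm is twice that number. Hence [r = 0]. *)
pose p := (r%:C *: u + v) ** (r%:C *: u + v) ** v.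
have pE : p = y ** ((r%:C *: u - q) ** (r%:C *: u - q)) ** star y.
  by rewrite /p vE qE; walg uU.
have ple : rnorm p <= r * r ^+ 2.
  rewrite pE (le_trans (rnorm_cmul _ _))// rnorm_star.
  have H : rnorm ((r%:C *: u - q) ** (r%:C *: u - q)) <= r ^+ 2.
    by rewrite (le_trans (rnorm_cmul _ _))// expr2 ler_pM ?rnorm_ge0.
  rewrite {1}/r expr2 mulrAC ler_wpM2r ?rnorm_ge0//.
  by rewrite (le_trans (rnorm_cmul _ _))// ler_wpM2l ?rnorm_ge0.
have pv2 : pos (v ** v) by exact: pos_sqr.
have pv3 : pos (v ** v ** v) by apply: pos_commM; rewrite // cmulA.
have pE' : p = (r ^+ 2)%:C *: v + v ** v ** v + (2%:R * r)%:C *: (v ** v).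
  by rewrite /p; walg uU.
have pge : rnorm ((2%:R * r)%:C *: (v ** v)) <= r * r ^+ 2.
  apply: pos_norm_le.
  - by rewrite mulr_ge0// exprn_ge0.
  - by apply: posZ; [rewrite mulr_ge0|].
  have -> : (r * r ^+ 2)%:C *: u - (2%:R * r)%:C *: (v ** v) =
      ((r * r ^+ 2)%:C *: u - p) + ((r ^+ 2)%:C *: v + v ** v ** v).
    by rewrite /p; walg uU.
  apply: posD; last by apply: posD => //; apply: posZ; rewrite ?sqr_ge0.
  apply: pos_unit_sub => //.
  have vD a b : star a = a -> star b = b -> star (a + b) = a + b.
    by move=> ea eb; rewrite starD ea eb.
  rewrite pE'; apply: (vD _ _ (vD _ _ _ pv3.1)).
    by rewrite starZr vsa.
  by rewrite starZr pv2.1.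
move: pge; rewrite rnormZr rnorm_sqr_sa// vr (ger0_norm (mulr_ge0 (ler0n _ 2)
  r0)) => pge.
have [/eqP|rn0] := eqVneq r 0; first by rewrite sqrf_eq0 => /eqP/rnorm_eq0.
have : 0 < r * r ^+ 2 by rewrite -exprS exprn_gt0// lt_neqAle eq_sym rn0.
by move=> rp; exfalso; clear -pge rp; lra.
Qed.

Theorem positive_star_mul x : pos (star x ** x).
Proof.
have [c cE] : exists c, c = star x ** x by exists (star x ** x).
have csa : star c = c by rewrite cE starM starK.
rewrite -cE.
have [d [dsa pd ccd cd]] := pos_sqrt (pos_sqr csa).
have dc : d ** c = c ** d by symmetry; apply: cd; rewrite cmulA.
have [g [gsa pg dg gd]] := pos_sqrt pd.
pose k := d - c.
have ksa : star k = k by rewrite starB dsa csa.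
have kk : k ** k = 2%:R%:C *: (d ** k).
  rewrite /k cmulDl !cmulDr !cmulNl !cmulNr -ccd dc.
  by walg uU.
have dk : d ** k = - (c ** k).
  by rewrite /k !cmulDr !cmulNr -ccd dc opprD opprK addrC.
have ck : k ** c = c ** k by rewrite cmulDl cmulDr cmulNl cmulNr dc.
(* Since [d ** d = c ** c], compressing [c] by [k] gives [- d ** (k ** k)]. With [g] the root of
   [d], the element [x ** k] then satisfies the hypothesis of [neg_star_mul0]. *)
have kck : k ** c ** k = - (d ** (k ** k)).
  rewrite ck -cmulA kk dk !(cmulZr, cmulNr) (cmulA d) dc -cmulA dk cmulNr.
  by walg uU.
have kg : k ** g = g ** k.
  by apply: gd; rewrite /k cmulDl cmulDr cmulNl cmulNr dc.
have gksa : star (g ** k) = g ** k by rewrite starM gsa ksa.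
have xk : - (star (x ** k) ** (x ** k)) = (g ** k) ** (g ** k).
  rewrite starM ksa -cmulA (cmulA (star x)) -cE cmulA kck opprK dg.
  by rewrite -!cmulA (cmulA k g) kg !cmulA.
have xk0 : x ** k = 0.
  by apply: neg_star_mul0; rewrite xk; apply: pos_sqr.
have gk0 : g ** k = 0.
  apply: rnorm_eq0; apply/eqP; rewrite -sqrf_eq0 -rnorm_sqr_sa// -xk xk0.
  by rewrite cmul0r oppr0 rnorm0.
have k0 : k = 0.
  apply: rnorm_eq0; apply/eqP; rewrite -sqrf_eq0 -rnorm_cstar ksa kk dg.
  by rewrite -cmulA gk0 cmul0r scaler0 rnorm0.
by move: k0 => /eqP; rewrite subr_eq0 => /eqP <-.
Qed.

End Cone.

(** * States *)
Section Morphism.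
Context {R : realType} {A B : cstarType R}.
Variables (u : A) (uU : is_unit u) (f : A -> B).
Hypothesis (fM : star_morphism f) (fsurj : forall b, exists a, f a = b).

Lemma star_morphism_unit : is_unit (f u).
Proof.
have [_ fmul _] := fM => b; have [a <-] := fsurj b.
by rewrite -!fmul (uU a).1 (uU a).2.
Qed.

Lemma star_morphism_pos y : pos u y -> pos (f u) (f y).
Proof.
have [_ fmul fstar] := fM => /(pos_sqrt uU)[a [asa _ -> _]].
by rewrite fmul; apply: (pos_sqr star_morphism_unit); rewrite -fstar asa.
Qed.

(** For self-adjoint [y], positivity carries the bounds of [y] by multiples of [u] over to [f y];
    the C*-identity reduces the general case to [star a ** a]. *)
Lemma star_morphism_contractive a : rnorm (f a) <= rnorm a.
Proof.
have [flin fmul fstar] := fM.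
have f0 : f 0 = 0.
  by have := flin (-1) 0 0; rewrite !scaleN1r oppr0 addr0 addNr.
have fD x y : f (x + y) = f x + f y.
  by have := flin 1 x y; rewrite !scale1r.
have fZ z x : f (z *: x) = z *: f x.
  by have := flin z x 0; rewrite f0 !addr0.
have le y : star y = y -> rnorm (f y) <= rnorm y.
  move=> ysa; apply: (pos_interval_norm star_morphism_unit (rnorm_ge0 y)).
    rewrite -fZ -scaleN1r -fZ -fD scaleN1r.
    exact/star_morphism_pos/pos_unit_sub.
  by rewrite -fZ -fD; apply/star_morphism_pos/pos_unit_add.
rewrite -(@ler_pXn2r _ 2) ?nnegrE ?rnorm_ge0// -!rnorm_cstar -fstar -fmul.
by apply: le; rewrite starM starK.
Qed.

End Morphism.

Section ScalarFunctional.
Context {R : realType} {A : cstarType R}.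
Variables (phi : A -> R[i]) (phi_lin : scalar phi).

Lemma linform0 : phi 0 = 0.
Proof.
by have := phi_lin (-1) 0 0; rewrite scaleN1r oppr0 addr0 mulN1r addNr.
Qed.

Lemma linformD a b : phi (a + b) = phi a + phi b.
Proof. by have := phi_lin 1 a b; rewrite scale1r mul1r. Qed.

Lemma linformZ z a : phi (z *: a) = z * phi a.
Proof. by have := phi_lin z a 0; rewrite linform0 !addr0. Qed.

Lemma linformN a : phi (- a) = - phi a.
Proof. by rewrite -scaleN1r linformZ mulN1r. Qed.

Lemma linformB a b : phi (a - b) = phi a - phi b.
Proof. by rewrite linformD linformN. Qed.

End ScalarFunctional.

Section CartesianDecomposition.
Context {R : realType} {A : cstarType R}.
Implicit Types a b : A.

Definition re_part a : A := (2^-1)%:C *: (a + star a).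
Definition im_part a : A := ('i%C * (2^-1)%:C) *: (star a - a).

Lemma re_part_sa a : star (re_part a) = re_part a.
Proof. by rewrite starZr starD starK addrC. Qed.

Lemma im_part_sa a : star (im_part a) = im_part a.
Proof.
rewrite starZ starB starK -opprB scalerN -scaleNr; congr (_ *: _).
by rewrite rmorphM /= conjCR [X in X * _]conjCi mulNr opprK.
Qed.

Lemma half_add_half : (2^-1)%:C + (2^-1)%:C = 1 :> R[i].
Proof. by rewrite -rmorphD /= (_ : 2^-1 + 2^-1 = 1 :> R)//; field. Qed.

Lemma re_im_part a : a = re_part a + 'i%C *: im_part a.
Proof.
rewrite /im_part scalerA mulrA -expr2 sqr_i mulN1r scaleNr -scalerN opprB.
rewrite -scalerDr addrACA subrr addr0 scalerDr -scalerDl half_add_half.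
by rewrite scale1r.
Qed.

Lemma re_part_norm a : rnorm (re_part a) <= rnorm a.
Proof.
rewrite rnormZr ger0_norm ?invr_ge0//.
by have := rnormD a (star a); rewrite rnorm_star; lra.
Qed.

Lemma re_partD a b : re_part (a + b) = re_part a + re_part b.
Proof. by rewrite /re_part starD addrACA scalerDr. Qed.

Lemma im_partD a b : im_part (a + b) = im_part a + im_part b.
Proof. by rewrite /im_part starD opprD addrACA scalerDr. Qed.

Lemma re_partB a b : re_part (a - b) = re_part a - re_part b.
Proof. by rewrite re_partD /re_part starN -opprD scalerN. Qed.

Lemma re_partZr t a : re_part (t%:C *: a) = t%:C *: re_part a.
Proof. by rewrite /re_part starZr -scalerDr !scalerA mulrC. Qed.

Lemma im_partZr t a : im_part (t%:C *: a) = t%:C *: im_part a.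
Proof. by rewrite /im_part starZr -scalerBr !scalerA mulrC. Qed.

Lemma re_partZi a : re_part ('i%C *: a) = - im_part a.
Proof.
rewrite /re_part /im_part starZ [X in X *: star a]conjCi scaleNr -scalerBr.
by rewrite -opprB !scalerN scalerA mulrC.
Qed.

Lemma im_partZi a : im_part ('i%C *: a) = re_part a.
Proof.
rewrite /re_part /im_part starZ [X in X *: star a]conjCi scaleNr -opprD.
rewrite -scalerDr scalerN scalerA mulrAC -expr2 sqr_i mulN1r scaleNr opprK.
by rewrite addrC.
Qed.

Lemma re_part_id a : star a = a -> re_part a = a.
Proof. by move=> asa; rewrite /re_part asa scalerDr -scalerDl half_add_half
  scale1r. Qed.

Lemma im_part_sa0 a : star a = a -> im_part a = 0.
Proof. by move=> asa; rewrite /im_part asa subrr scaler0. Qed.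

End CartesianDecomposition.

Section PositiveFunctional.
Context {R : realType} {A : cstarType R}.
Variables (u : A) (uU : is_unit u).
Implicit Types (a y : A) (phi : A -> R[i]).

Lemma positive_functional_pos phi y :
  positive_functional phi -> pos u y -> 0 <= phi y.
Proof.
by move=> [_ phi0] /(pos_sqrt uU)[a [asa _ -> _]]; rewrite -{1}asa phi0.
Qed.

Lemma ge0_Re (z : R[i]) : 0 <= z -> z = (complex.Re z)%:C.
Proof. by move=> z0; rewrite RRe_real// ger0_real. Qed.

Lemma positive_functional_unit phi : positive_functional phi -> 0 <= phi u.
Proof.
move=> pphi; have := positive_functional_pos pphi (posu uU ler01).
by rewrite scale1r.
Qed.

Lemma positive_functional_sa phi y : positive_functional phi -> star y = y ->
  exists2 t : R, phi y = t%:C & `|t| <= complex.Re (phi u) * rnorm y.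
Proof.
move=> pphi ysa; have [lphi _] := pphi.
have phiu := ge0_Re (positive_functional_unit pphi).
have := positive_functional_pos pphi (pos_unit_sub uU ysa (lexx _)).
have := positive_functional_pos pphi (pos_unit_add uU ysa (lexx _)).
rewrite linformB// linformD// !linformZ// phiu -rmorphM /=.
case: (phi y) => p q; rewrite lecE /= lecE /= => /andP[/eqP q0 p1] /andP[_ p2].
have -> : q = 0 by move: q0; rewrite add0r.
exists p => //; rewrite ler_norml [complex.Re _ * _]mulrC.
apply/andP; split; lra.
Qed.

(** Multiplying [a] by a phase [z] makes the value real and nonnegative. Only the real part of
    [z *: a] then contributes, its norm is at most that of [a], and the self-adjoint case applies
    with the same constant. *)
Lemma positive_functional_norm_le phi a : positive_functional phi ->
  rnorm (phi a) <= complex.Re (phi u) * rnorm a.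
Proof.
move=> pphi; have [lphi _] := pphi.
have phiu : 0 <= complex.Re (phi u).
  by have := positive_functional_unit pphi; rewrite lecE => /andP[].
have [->|p0] := eqVneq (phi a) 0; first by rewrite rnorm0 mulr_ge0 ?rnorm_ge0.
have n0 : rnorm (phi a) != 0 by apply: contra p0 => /eqP/rnorm_eq0 ->.
pose z := `|phi a| / phi a.
have z1 : rnorm z = 1.
  by rewrite /z /rnorm normrM normfV normr_id divff ?normr_eq0.
have za : phi (z *: a) = (rnorm (phi a))%:C.
  by rewrite linformZ// /z divfK// normE.
have [s sE sle] := positive_functional_sa pphi (re_part_sa (z *: a)).
have [t tE _] := positive_functional_sa pphi (im_part_sa (z *: a)).
have : (rnorm (phi a))%:C = s%:C + 'i%C * t%:C.
  by rewrite -za {1}(re_im_part (z *: a)) linformD// (linformZ _ 'i%C)// sE tE.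
move=> /(congr1 (@complex.Re _)).
rewrite (_ : complex.Re (s%:C + 'i%C * t%:C) = s); last by simpc.
move=> /= ->; rewrite (le_trans (ler_norm _))// (le_trans sle)// ler_wpM2l//.
by rewrite (le_trans (re_part_norm _))// rnormZ z1 mul1r.
Qed.

Lemma positive_functional_norm phi : positive_functional phi ->
  functional_norm phi = (complex.Re (phi u))%:E.
Proof.
move=> pphi; have phiu0 := positive_functional_unit pphi.
have phiu : 0 <= complex.Re (phi u) by move: phiu0; rewrite lecE => /andP[].
apply/eqP; rewrite eq_le; apply/andP; split.
  apply: ge_ereal_sup => _ [a /= a1 <-]; rewrite lee_fin.
  by rewrite (le_trans (positive_functional_norm_le a pphi))// ler_piMr.
apply: ereal_sup_ubound; exists u; first exact: rnorm_unit_le1.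
by rewrite (ge0_Re phiu0) rnorm_real ger0_norm.
Qed.

Lemma statesE phi :
  states A phi <-> positive_functional phi /\ phi u = 1.
Proof.
split=> -[pphi n1]; split => //; move: n1; rewrite positive_functional_norm//.
  by move=> [phiu]; rewrite (ge0_Re (positive_functional_unit pphi)) phiu.
by move=> ->.
Qed.

Lemma quasi_statesE phi : quasi_states A phi <->
  positive_functional phi /\ complex.Re (phi u) <= 1.
Proof.
by split=> -[pphi n1]; split => //; move: n1;
  rewrite positive_functional_norm// lee_fin.
Qed.

Lemma quasi_state_norm_le phi a : quasi_states A phi ->
  rnorm (phi a) <= rnorm a.
Proof.
move=> /quasi_statesE[phip phi1].
by rewrite (le_trans (positive_functional_norm_le a phip))// ler_piMl
  ?rnorm_ge0.
Qed.

Lemma state_norm_le phi a : states A phi -> rnorm (phi a) <= rnorm a.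
Proof.
move=> /statesE[pphi phiu].
by have := positive_functional_norm_le a pphi; rewrite phiu mul1r.
Qed.

Lemma state_sa phi y : states A phi -> star y = y ->
  exists2 t : R, phi y = t%:C & `|t| <= rnorm y.
Proof.
move=> /statesE[pphi phiu] ysa; have := positive_functional_sa pphi ysa.
by rewrite phiu mul1r.
Qed.

End PositiveFunctional.

(* A maximal convex cone which contains the positive elements and [y0 - r u] but
   not [- u] is a half-space of the self-adjoint part, the nonnegative side of
   a state. *)
Section StateExistence.
Context {R : realType} {A : cstarType R}.
Variables (u : A) (uU : is_unit u).
Implicit Types (x y : A) (r s t : R) (Q : set A).

Definition proper_cone Q :=
  [/\ pos u `<=` Q, Q `<=` self_adjoint A, forall x y, Q x -> Q y -> Q (x + y),
      forall t x, 0 <= t -> Q x -> Q (t%:C *: x) & ~ Q (- u)].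

Lemma maximal_cone Q0 : proper_cone Q0 ->
  exists Q, [/\ proper_cone Q, Q0 `<=` Q &
    forall y, self_adjoint A y -> Q y \/ Q (- y)].
Proof.
(* Zorn's lemma is applied to the sets whose union with [Q0] is a proper cone, so that the union of
   the empty chain qualifies as well. *)
move=> Q0P; pose C S := proper_cone (S `|` Q0).
have [F FC Ftot|S [CS Smax]] := @Zorn_bigcup _ C.
  have [posQ0 Q0sa Q0D Q0Z Q0u] := Q0P; split.
  - by move=> x /posQ0; right.
  - move=> x [[X FX Xx]|/Q0sa//].
    by have [_ sa _ _ _] := FC X FX; apply: sa; left.
  - have sub X x y : F X -> (X `|` Q0) x -> (X `|` Q0) y ->
        (\bigcup_(X in F) X `|` Q0) (x + y).
      move=> FX Xx Xy; have [_ _ + _ _] := FC X FX.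
      by move=> /(_ x y Xx Xy) [?|?]; [left; exists X|right].
    move=> x y [[X FX Xx]|Qx] [[Y FY Yy]|Qy].
    + have [XY|YX] := Ftot X Y FX FY.
        by apply: (sub Y) => //; left => //; apply: XY.
      by apply: (sub X) => //; left => //; apply: YX.
    + by apply: (sub X) => //; [left|right].
    + by apply: (sub Y) => //; [right|left].
    + by right; apply: Q0D.
  - move=> t x t0 [[X FX Xx]|Qx]; last by right; apply: Q0Z.
    have [_ _ _ + _] := FC X FX.
    by move=> /(_ t x t0 (or_introl Xx)) [?|?]; [left; exists X|right].
  - move=> [[X FX Xx]|//].
    by have [_ _ _ _] := FC X FX; apply; left.
have [posQ Qsa QD QZ Qu] := CS; exists (S `|` Q0); split;
  [exact: CS|by move=> x Q0x; right|].
move=> y ysa; have [|Qy] := pselect ((S `|` Q0) y); first by left.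
right; pose B := [set x | exists q t, [/\ (S `|` Q0) q,
  0 <= t & x = q + t%:C *: y]].
have SB : S `|` Q0 `<=` B.
  by move=> x Sx; exists x, 0; rewrite scale0r addr0.
have BQ0 : B `|` Q0 = B.
  by apply/seteqP; split=> [x [//|Qx]|x Bx]; [apply: SB; right|left].
(* [B] is the cone spanned by the maximal cone and [y]. It is strictly larger, so by maximality it
   can only fail to be proper by containing [- u = q + t y]; here [t] is not 0, and
   [- y = (q + u) / t] lies in the maximal cone. *)
have [q [t [Sq t0 uE]]] : B (- u).
  apply: contrapT => Bu; apply: (Smax B).
    split; first by move=> x Sx; apply: SB; left.
    move=> BS; apply: Qy; left; apply: BS.
    by exists 0, 1; rewrite scale1r add0r; split => //; apply: posQ;
      exact: pos0.
  rewrite /C BQ0; split => //.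
  - by move=> x /posQ/SB.
  - by move=> _ [q [t [/Qsa qsa _ ->]]];
      rewrite /self_adjoint/= starD starZr qsa ysa.
  - move=> _ _ [q [t [Sq t0 ->]]] [q' [t' [Sq' t'0 ->]]].
    exists (q + q'), (t + t'); split; [exact: QD|exact: addr_ge0|].
    by rewrite rmorphD /= scalerDl addrACA.
  - move=> s _ s0 [q [t [Sq t0 ->]]]; exists (s%:C *: q), (s * t).
    split; [exact: QZ|exact: mulr_ge0|].
    by rewrite scalerDr scalerA rmorphM.
have tp : 0 < t.
  rewrite lt_neqAle t0 andbT; apply/eqP => t00; apply: Qu.
  by move: uE; rewrite -t00 scale0r addr0 => ->.
have -> : - y = (t^-1)%:C *: (q + u).
  have -> : q = - u - t%:C *: y by rewrite uE addrK.
  rewrite addrAC addNr add0r scalerN scalerA -rmorphM /= mulVf ?gt_eqF//.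
  by rewrite scale1r.
apply: QZ; first by rewrite invr_ge0.
by apply: QD => //; apply: posQ; have := posu uU ler01; rewrite scale1r.
Qed.

Section HalfSpace.
Variables (Q : set A) (QP : proper_cone Q).
Hypothesis (Qtot : forall y, self_adjoint A y -> Q y \/ Q (- y)).

Let posQ y : pos u y -> Q y. Proof. by case: QP => + _ _ _ _; apply. Qed.
Let QD x y : Q x -> Q y -> Q (x + y). Proof. by case: QP => _ _ + _ _;
  apply. Qed.
Let QZ t x : 0 <= t -> Q x -> Q (t%:C *: x).
Proof. by case: QP => _ _ _ + _; apply. Qed.

Let Q_unit t : Q (t%:C *: u) -> 0 <= t.
Proof.
case: QP => _ _ _ _ Qu Qt; rewrite leNgt; apply/negP => t0; apply: Qu.
have -> : - u = (- t^-1)%:C *: (t%:C *: u).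
  by rewrite scalerA -rmorphM /= mulNr mulVf ?lt_eqF// rmorphN1 scaleN1r.
by apply: QZ => //; rewrite oppr_ge0 invr_le0 ltW.
Qed.

(** The cone plays the role of a total preorder; the value of [y] is the cut at which [y - t u]
    leaves it. *)
Definition half_space_value y : R := sup [set t | Q (y - t%:C *: u)].

Let f := half_space_value.

Let level_sup y : self_adjoint A y -> has_sup [set t | Q (y - t%:C *: u)].
Proof.
move=> ysa; split.
  exists (- rnorm y); rewrite /= rmorphN scaleNr opprK addrC.
  exact/posQ/pos_unit_add.
exists (rnorm y) => t /= Qt; rewrite -subr_ge0; apply: Q_unit.
have -> : (rnorm y - t)%:C *: u = ((rnorm y)%:C *: u - y) + (y - t%:C *: u).
  by rewrite subrKA rmorphB scalerBl.
by apply: QD => //; apply/posQ/pos_unit_sub.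
Qed.

Let level_lt y t : self_adjoint A y -> t < f y -> Q (y - t%:C *: u).
Proof.
move=> ysa tf; have ft : 0 < f y - t by rewrite subr_gt0.
have [s Qs] := sup_adherent ft (level_sup ysa).
rewrite -/(half_space_value y) -/f subKr => /ltW ts.
have -> : y - t%:C *: u = (y - s%:C *: u) + (s - t)%:C *: u.
  by rewrite rmorphB /= scalerBl addrA subrK.
by apply: QD => //; apply/posQ/posu; rewrite ?subr_ge0.
Qed.

Let level_gt y t : self_adjoint A y -> f y < t -> Q (t%:C *: u - y).
Proof.
move=> ysa ft; have : self_adjoint A (y - t%:C *: u).
  by rewrite /self_adjoint /= starB ysa star_Zu.
move=> /Qtot[Qt|]; last by rewrite opprB.
have /ub_le_sup : has_ubound [set t | Q (y - t%:C *: u)] by case: (level_sup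
  ysa).
by move=> /(_ t Qt); rewrite leNgt ft.
Qed.

(** The cone is not known to be closed, so nothing is said at the level [c] itself: the value is
    pinned down by the levels on either side of it. *)
Let value_eq y c : self_adjoint A y ->
  (forall e, 0 < e -> Q (y - (c - e)%:C *: u)) ->
  (forall e, 0 < e -> Q ((c + e)%:C *: u - y)) -> f y = c.
Proof.
move=> ysa Q1 Q2; have lift s t : Q (y - s%:C *: u) -> Q (t%:C *: u - y) ->
  s <= t.
  move=> Qs Qt; rewrite -subr_ge0; apply: Q_unit.
  have -> : (t - s)%:C *: u = (t%:C *: u - y) + (y - s%:C *: u).
    by rewrite subrKA rmorphB scalerBl.
  exact: QD.
apply/eqP; rewrite eq_le; apply/andP; split; apply/ler_addgt0Pl => e e0.
  have e20 : 0 < e / 2 by rewrite divr_gt0.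
  have fe : f y - e / 2 < f y by rewrite ltrBlDr ltrDl.
  by have := lift _ _ (level_lt ysa fe) (Q2 _ e20); lra.
have e20 : 0 < e / 2 by rewrite divr_gt0.
have fe : f y < f y + e / 2 by rewrite ltrDl.
by have := lift _ _ (Q1 _ e20) (level_gt ysa fe); lra.
Qed.

Let valueD x y : self_adjoint A x -> self_adjoint A y -> f (x + y) = f x + f y.
Proof.
move=> xsa ysa; apply: value_eq => [|e e0|e e0].
- by rewrite /self_adjoint /= starD xsa ysa.
- have e20 : 0 < e / 2 by rewrite divr_gt0.
  have -> : x + y - (f x + f y - e)%:C *: u =
      (x - (f x - e / 2)%:C *: u) + (y - (f y - e / 2)%:C *: u).
    rewrite addrACA -opprD -scalerDl -rmorphD /=; congr (_ - _%:C *: _).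
    by field.
  by apply: QD; apply: level_lt => //; rewrite ltrBlDr ltrDl.
- have e20 : 0 < e / 2 by rewrite divr_gt0.
  have -> : (f x + f y + e)%:C *: u - (x + y) =
      ((f x + e / 2)%:C *: u - x) + ((f y + e / 2)%:C *: u - y).
    rewrite addrACA -opprD -scalerDl -rmorphD /=; congr (_%:C *: _ - _).
    by field.
  by apply: QD; apply: level_gt => //; rewrite ltrDl.
Qed.

Let valueN x : self_adjoint A x -> f (- x) = - f x.
Proof.
move=> xsa; apply: value_eq => [|e e0|e e0].
- by rewrite /self_adjoint /= starN xsa.
- rewrite -(opprD (f x)) rmorphN scaleNr opprK addrC.
  by apply: level_gt => //; rewrite ltrDl.
- rewrite opprK addrC -[_ + e]opprK opprD opprK rmorphN scaleNr.
  by apply: level_lt => //; rewrite ltrBlDr ltrDl.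
Qed.

Let valueZ t x : self_adjoint A x -> f (t%:C *: x) = t * f x.
Proof.
have pZ s y : self_adjoint A y -> 0 < s -> f (s%:C *: y) = s * f y.
  move=> ysa s0; apply: value_eq => [|e e0|e e0].
  - by rewrite /self_adjoint /= starZr ysa.
  - have -> : s%:C *: y - (s * f y - e)%:C *: u =
        s%:C *: (y - (f y - e / s)%:C *: u).
      rewrite scalerBr scalerA -rmorphM /=; congr (_ - _%:C *: _).
      by field; rewrite gt_eqF.
    apply: QZ; first exact: ltW.
    by apply: level_lt => //; rewrite ltrBlDr ltrDl divr_gt0.
  - have -> : (s * f y + e)%:C *: u - s%:C *: y =
        s%:C *: ((f y + e / s)%:C *: u - y).
      rewrite scalerBr scalerA -rmorphM /=; congr (_%:C *: _ - _).
      by field; rewrite gt_eqF.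
    apply: QZ; first exact: ltW.
    by apply: level_gt => //; rewrite ltrDl divr_gt0.
move=> xsa; have [t0|t0|->] := ltgtP t 0.
- rewrite -[t]opprK rmorphN scaleNr valueN ?pZ ?oppr_gt0 ?mulNr//.
  by rewrite /self_adjoint /= starZr xsa.
- exact: pZ.
have s0 : self_adjoint A 0 by exact: star0.
by have := valueD s0 s0; rewrite scale0r mul0r addr0 => /eqP;
  rewrite addrC -subr_eq subrr => /eqP <-.
Qed.

Let value_ge0 x : Q x -> 0 <= f x.
Proof.
move=> Qx; have xsa : self_adjoint A x by case: QP => _ + _ _ _; apply.
have /ub_le_sup : has_ubound [set t | Q (x - t%:C *: u)] by case: (level_sup
  xsa).
by apply; rewrite /= scale0r subr0.
Qed.

Let value_unit : f u = 1.
Proof.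
apply: value_eq => [|e e0|e e0]; first exact: star_unit.
  have -> : u - (1 - e)%:C *: u = e%:C *: u.
    by rewrite rmorphB /= scalerBl scale1r subKr.
  by apply/posQ/posu => //; exact: ltW.
have -> : (1 + e)%:C *: u - u = e%:C *: u.
  by rewrite rmorphD /= scalerDl scale1r addrC addKr.
by apply/posQ/posu => //; exact: ltW.
Qed.

Definition half_space_functional a : R[i] :=
  (f (re_part a))%:C + 'i%C * (f (im_part a))%:C.

Lemma half_space_functional_ge0 x : Q x -> 0 <= half_space_functional x.
Proof.
move=> Qx; have xsa : self_adjoint A x by case: QP => _ + _ _ _; apply.
rewrite /half_space_functional re_part_id// im_part_sa0//.
have := valueZ 0 xsa; rewrite scale0r mul0r => ->.
by rewrite mulr0 addr0 lecR value_ge0.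
Qed.

Lemma half_space_state : states A half_space_functional.
Proof.
have fD a b : half_space_functional (a + b) =
    half_space_functional a + half_space_functional b.
  rewrite /half_space_functional re_partD im_partD.
  rewrite !valueD;
    [|exact: im_part_sa|exact: im_part_sa|exact: re_part_sa|exact: re_part_sa].
  by rewrite !rmorphD /= mulrDr addrACA.
have fZr t a : half_space_functional (t%:C *: a) = t%:C * half_space_functional
  a.
  rewrite /half_space_functional re_partZr im_partZr.
  rewrite (valueZ t (re_part_sa a)) (valueZ t (im_part_sa a)).
  by rewrite !rmorphM /= mulrDr mulrCA.
have fZi a : half_space_functional ('i%C *: a) = 'i%C * half_space_functional a.
  rewrite /half_space_functional re_partZi im_partZi.
  rewrite valueN; last exact: im_part_sa.
  by rewrite rmorphN /= mulrDr mulrA -expr2 sqr_i mulN1r addrC.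
apply/(statesE uU); split; last first.
  rewrite /half_space_functional re_part_id ?im_part_sa0 ?(star_unit uU)//.
  have := valueZ 0 (star_unit uU); rewrite value_unit scale0r mul0r => ->.
  by rewrite mulr0 addr0.
split.
  move=> [p q] a b /=; rewrite fD.
  have -> : p +i* q = p%:C + 'i%C * q%:C by simpc.
  by rewrite scalerDl fD -scalerA fZi !fZr mulrDl mulrA.
move=> a; have asa : star (star a ** a) = star a ** a by rewrite starM starK.
by apply/half_space_functional_ge0/posQ/positive_star_mul.
Qed.

End HalfSpace.

(** The cone spanned by the positive elements and [y0 - r u] is proper: from
    [- u = p + s (y0 - r u)] with [s > 0] one would get [r u - y0 = (p + u) / s], which is
    positive. *)
Lemma exists_state y0 r : star y0 = y0 -> ~ pos u (r%:C *: u - y0) ->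
  exists2 phi, states A phi & exists2 t, phi y0 = t%:C & r <= t.
Proof.
move=> ysa nr.
pose Q0 := [set x | exists p s, [/\ pos u p,
  0 <= s & x = p + s%:C *: (y0 - r%:C *: u)]].
have [|Q [QP Q0Q Qtot]] := @maximal_cone Q0.
  split.
  - by move=> x px; exists x, 0; rewrite scale0r addr0.
  - move=> _ [p [s [[psa _] s0 ->]]]; rewrite /self_adjoint /=.
    by rewrite starD starZr starB star_Zu// ysa psa.
  - move=> _ _ [p [s [pp s0 ->]]] [p' [s' [pp' s'0 ->]]];
      exists (p + p'), (s + s').
    split; [exact: posD|exact: addr_ge0|].
    by rewrite rmorphD /= scalerDl addrACA.
  - move=> t _ t0 [p [s [pp s0 ->]]]; exists (t%:C *: p), (t * s).
    split; [exact: posZ|exact: mulr_ge0|].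
    by rewrite scalerDr scalerA rmorphM.
  - move=> [p [s [pp s0 uE]]].
    have pu : pos u u by have := posu uU ler01; rewrite scale1r.
    (* For [s = 0] both [u] and [- u] are positive, so [u = 0], the algebra is zero, and [r u - y0]
       is trivially positive. *)
    have [s00|sn0] := eqVneq s 0.
      have u0 : u = 0.
        apply: (pos_anti uU pu); rewrite uE s00 scale0r addr0.
        exact: pp.
      apply: nr; rewrite (_ : _ - _ = 0); first exact: pos0.
      by rewrite -[LHS](uU _).1 {1}u0 cmul0l.
    apply: nr; have -> : r%:C *: u - y0 = (s^-1)%:C *: (p + u).
      have -> : p + u = s%:C *: (r%:C *: u - y0).
        have -> : p = - u - s%:C *: (y0 - r%:C *: u) by rewrite uE addrK.
        by rewrite addrAC addNr add0r -scalerN opprB.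
      by rewrite scalerA -rmorphM /= mulVf// scale1r.
    apply: posZ; first by rewrite invr_ge0.
    exact: posD.
have phiS := half_space_state QP Qtot.
exists (half_space_functional Q) => //.
have Qy : Q (y0 - r%:C *: u).
  by apply: Q0Q; exists 0, 1; rewrite add0r scale1r; split => //; exact: pos0.
have := half_space_functional_ge0 QP Qtot Qy.
have [t tE _] := state_sa uU phiS ysa.
have [[lphi _] phiu] := (statesE uU _).1 phiS.
rewrite linformB// linformZ// phiu mulr1 tE -rmorphB lecR subr_ge0.
by exists t.
Qed.

(** If the norm exceeded [K + e], one of [(K + e) u - y] and [(K + e) u + y] would not be positive,
    and some state would take a value at least [K + e] on [y] or [- y]. The margin [e] is there
    because [exists_state] yields only a weak inequality. *)
Lemma state_norm_sa y K : star y = y ->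
  (forall phi, states A phi -> rnorm (phi y) <= K) -> 0 <= K -> rnorm y <= K.
Proof.
move=> ysa yK K0; apply/ler_addgt0Pl => e e0; rewrite addrC.
apply: (pos_interval_norm uU); first by rewrite addr_ge0 // ltW.
  apply: contrapT => /(exists_state ysa)[phi phiS [t yt tK]].
  have := yK phi phiS; rewrite yt rnorm_real =>
    /(le_trans (ler_norm _))/(le_trans tK).
  by rewrite gerDl leNgt e0.
apply: contrapT; rewrite -{1}[y]opprK => /exists_state[|phi phiS].
  by rewrite starN ysa.
have [[lphi _] _] := phiS; rewrite linformN// => -[t yt tK].
have := yK phi phiS; rewrite -rnormN yt rnorm_real.
move=> /(le_trans (ler_norm _))/(le_trans tK).
by rewrite gerDl leNgt e0.
Qed.

End StateExistence.

(** * Weak* compactness of the state space *)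

(** Were there no such list, the complements in [K] of the finite unions of sets [N x] would
    generate a proper filter; a cluster point [p] of it would contradict its own neighbourhood
    [N p]. *)
Lemma compact_finite_net (T : topologicalType) (K : set T) (N : T -> set T) :
  compact K -> (forall x, K x -> nbhs x (N x)) ->
  exists l : list T, (forall x, List.In x l -> K x) /\
    forall y, K y -> exists2 x, List.In x l & N x y.
Proof.
move=> cK KN; apply: contrapT => nonet.
pose sub l := forall x, List.In x l -> K x.
pose rest (l : list T) := [set y | K y /\ forall x, List.In x l -> ~ N x y].
pose F := filter_from sub rest.
have FF : ProperFilter F.
  apply: filter_from_proper; last first.
    move=> l lK; apply: contrapT => l0; apply: nonet; exists l;
      split => // y Ky.
    apply: contrapT => yN; apply: l0; exists y; split => // x lx Nxy.
    by apply: yN; exists x.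
  apply: filter_from_filter; first by exists nil.
  move=> l m lK mK; exists (List.app l m).
    by move=> x /List.in_app_iff[/lK|/mK].
  move=> y [Ky yN]; split; split => // x xl; apply: yN; apply/List.in_app_iff.
    by left.
  by right.
have FK : F K by exists nil => // y [].
have [p [Kp Fp]] := cK F FF FK.
have Frest : F (rest (cons p nil)).
  by exists (cons p nil) => // x [<-|].
have [y [[_ /(_ p (or_introl erefl)) yN] Ny]] := Fp _ _ Frest (KN p Kp).
exact: yN.
Qed.

Section WeakStar.
Context {R : realType} {A : cstarType R}.
Variables (u : A) (uU : is_unit u).
Implicit Types (a b : A) (phi psi mu : A -> R[i]).

Lemma weakstar_nbhs_eval phi a (e : R) : 0 < e ->
  nbhs (phi : weakstar A) [set psi | rnorm (phi a - psi a) < e].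
Proof.
move=> e0.
have : nbhs (phi a : R[i]^o) [set z | rnorm (phi a - z) < e].
  by apply/nbhs_rnormP; exists e.
exact: (@proj_continuous A (fun=> R[i]^o : topologicalType) a phi).
Qed.

Lemma weakstar_nbhs_seq phi (l : seq A) (e : R) : 0 < e ->
  nbhs (phi : weakstar A)
    [set psi | forall a, a \in l -> rnorm (phi a - psi a) < e].
Proof.
have FF := nbhs_filter (phi : weakstar A).
move=> e0; elim: l => [|a l IH];
  first exact: filterS (@filterT _ _ (nbhs_filter (phi : weakstar A))).
apply: filterS (filterI (weakstar_nbhs_eval phi a e0) IH) => psi [/= ea el] b.
by rewrite inE => /orP[/eqP ->|/el].
Qed.

(** A square is enough: Tychonoff's theorem asks only for some compact set containing the possible
    values. *)
Lemma disc_compact (r : R) :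
  exists2 D : set R[i]^o, compact D & forall z : R[i], rnorm z <= r -> D z.
Proof.
pose g (p : R * R) : R[i]^o := p.1 +i* p.2.
exists (g @` (`[- r, r] `*` `[- r, r])).
  apply: continuous_compact; last first.
    by apply: compact_setX; exact: segment_compact.
  apply: continuous_subspaceT => p U /nbhs_rnormP[e e0 sub].
  have e20 : 0 < e / 2 by rewrite divr_gt0.
  exists (ball p.1 (e / 2), ball p.2 (e / 2)).
    by split; exact: nbhsx_ballx.
  move=> q [/= q1 q2]; apply: sub; rewrite /g.
  rewrite (le_lt_trans (rnorm_le_ReIm _))//=.
  move: q1 q2; rewrite -!ball_normE /= => q1 q2.
  by rewrite [e]splitr ltrD.
move=> z zr; exists (complex.Re z, complex.Im z); last by case: z zr.
split; rewrite /= in_itv /= -ler_norml (le_trans _ zr)//.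
  exact: Re_le_rnorm.
exact: Im_le_rnorm.
Qed.

(** Banach-Alaoglu by Tychonoff's theorem. The conditions of [statesE] each involve finitely many
    evaluations, so they pass to pointwise limits; it is the unit that makes normalization,
    [phi u = 1], a closed condition. *)
Lemma states_compact : compact (states A : set (weakstar A)).
Proof.
pose D a := projT1 (cid2 (disc_compact (rnorm a))).
have DP a : compact (D a) /\ forall z : R[i], rnorm z <= rnorm a -> D a z.
  by rewrite /D; case: cid2.
have Dc : compact ([set f | forall a, D a (f a)] : set (weakstar A)).
  by apply: (@tychonoff A (fun=> R[i]^o : topologicalType)) => a;
    exact: (DP a).1.
apply: subclosed_compact Dc _; last first.
  by move=> phi phiS a; apply: (DP a).2; exact: state_norm_le uU _ _ phiS.
move=> phi clphi.
have approx (l : seq A) (e : R) : 0 < e ->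
    exists2 psi, states A psi & forall a, a \in l -> rnorm (phi a - psi a) < e.
  by move=> e0; have [psi [? ?]] := clphi _ (weakstar_nbhs_seq phi l e0);
    exists psi.
apply/(statesE uU); split; [split|].
- move=> z a b; apply/eqP; rewrite -subr_eq0; apply/eqP.
  apply: (@rnorm_small0 _ _ _ (rnorm z + 2)) => e e0.
  have [psi psiS psie] := approx [:: z *: a + b; a; b] e e0.
  have [[psil _] _] := (statesE uU _).1 psiS.
  have -> : phi (z *: a + b) - (z * phi a + phi b) =
      (phi (z *: a + b) - psi (z *: a + b)) - (z * (phi a - psi a) + (phi b -
        psi b)).
    by rewrite psil; ring.
  have e1 : rnorm (phi (z *: a + b) - psi (z *: a + b)) < e.
    by apply: psie; rewrite !inE eqxx.
  have e2 : rnorm (phi a - psi a) < e by apply: psie; rewrite !inE eqxx orbT.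
  have e3 : rnorm (phi b - psi b) < e by apply: psie; rewrite !inE eqxx !orbT.
  rewrite (le_trans (rnormB _ _))//.
  have := rnormD (z * (phi a - psi a)) (phi b - psi b).
  have : rnorm z * rnorm (phi a - psi a) <= rnorm z * e.
    by rewrite ler_wpM2l ?rnorm_ge0 ?(ltW e2).
  by rewrite rnormM; lra.
- move=> a; set x := star a ** a.
  have near0 e : 0 < e -> - e <= complex.Re (phi x) /\
    `|complex.Im (phi x)| <= e.
    move=> e0; have [psi psiS /(_ x)] := approx [:: x] e e0.
    rewrite inE eqxx => /(_ isT) /ltW psie.
    have [[_ psi0] _] := (statesE uU _).1 psiS; have := psi0 a.
    rewrite -/x lecE => /andP[/eqP psi1 psi2].
    have := le_trans (Re_le_rnorm _) psie;
      have := le_trans (Im_le_rnorm _) psie.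
    rewrite !raddfB /= psi1 subr0 => imx /ler_normlP[re1 re2]; split => //.
    by move: psi2 re1 re2 => /=; lra.
  rewrite lecE; apply/andP; split.
    rewrite /= -normr_eq0 eq_le normr_ge0 andbT.
    by apply/ler_addgt0Pl => e /near0[_]; rewrite addr0.
  by apply/ler_addgt0Pl => e /near0[+ _] /=; lra.
- apply/eqP; rewrite -subr_eq0; apply/eqP.
  apply: (@rnorm_small0 _ _ _ 1) => e e0.
  have [psi psiS psie] := approx [:: u] e e0.
  have [_ <-] := (statesE uU _).1 psiS.
  by rewrite mul1r ltW// psie// inE.
Qed.

End WeakStar.

Definition totally_bounded_set {R : realType} {A : cstarType R} (S : set A) :=
  forall e : R, 0 < e -> exists m : seq A,
    forall a, S a -> exists2 b, b \in m & rnorm (a - b) < e.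

Definition lip_ball {R : realType} {A : cstarType R} (L : lipPair A) (K : R) :
    set A :=
  [set a | [/\ dom_sa L a, lip L a <= 1 & rnorm a <= K]].

(** Precompactness of a bounded set in finite dimension, with the net chosen inside [S]: the values
    of the first function are cut into strips of width [e], and the induction hypothesis is applied
    within each strip. *)
Lemma finite_value_net (R : realType) (T : eqType) (l : list (T ->
  R)) (S : set T)
    (K e : R) : 0 < e -> (forall f a, List.In f l -> S a -> `|f a| <= K) ->
  exists m : seq T, (forall b, b \in m -> S b) /\
    forall a, S a -> exists2 b, b \in m & forall f, List.In f l ->
      `|f a - f b| < e.
Proof.
move=> e0; elim: l S => [|f l IH] S lK.
  have [[a Sa]|S0] := pselect (S !=set0).
    exists [:: a]; split=> [b|b _]; first by rewrite inE => /eqP ->.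
    by exists a; rewrite ?inE.
  exists [::]; split => // a Sa; exfalso; apply: S0; exists a => //.
have step n : exists m : seq T, (forall b, b \in m -> S b) /\
    forall a, S a -> f a + K < n%:R * e ->
      exists2 b, b \in m & forall g, List.In g (cons f l) -> `|g a - g b| < e.
  elim: n => [|n [m [mS mP]]].
    exists [::]; split => // a Sa;
      have /ler_normlP[] := lK f a (or_introl erefl) Sa.
    by rewrite mul0r => ? ? ?; exfalso; lra.
  have [|m' [m'S m'P]] := IH [set a | S a /\ n%:R * e <= f a + K < n.+1%:R * e].
    by move=> g a lg [Sa _]; apply: lK => //; right.
  exists (m ++ m'); split.
    by move=> b; rewrite mem_cat => /orP[/mS//|/m'S[]].
  move=> a Sa fa; have [fn|fn] := ltP (f a + K) (n%:R * e).
    by have [b mb bP] := mP a Sa fn; exists b => //; rewrite mem_cat mb.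
  have [|b mb bP] := m'P a; first by split => //; rewrite fn fa.
  exists b; first by rewrite mem_cat mb orbT.
  have [_ /andP[b1 b2]] := m'S b mb.
  move=> g [<-|/bP//]; rewrite ltr_norml; move: b1 b2 fa fn.
  by rewrite -natr1 mulrDl mul1r => *; apply/andP; split; lra.
have [m [mS mP]] := step (Num.trunc ((K + K) / e)).+1.
exists m; split => // a Sa; apply: mP => //.
rewrite -ltr_pdivrMr//; have := truncnS_gt ((K + K) / e); apply: le_lt_trans.
rewrite ler_pM2r ?invr_gt0// lerD2r (le_trans (ler_norm _))//.
by apply: lK => //; left.
Qed.

Section CompactBounds.
Context {R : realType} {A : cstarType R} (L : lipPair A).
Variables (u : A) (uU : is_unit u).
Hypothesis (mkW : metrizes_weakstar (mk L)).
Implicit Types (a b : A) (phi psi mu : A -> R[i]).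

Lemma mk_ubound phi psi a : dom_sa L a -> lip L a <= 1 ->
  ((rnorm (phi a - psi a))%:E <= mk L phi psi)%E.
Proof. by move=> da la; apply: ereal_sup_ubound; exists a. Qed.

Lemma mk_finite_net (e : R) : 0 < e ->
  exists l : list (A -> R[i]), (forall phi, List.In phi l -> states A phi) /\
    forall psi, states A psi ->
      exists2 phi, List.In phi l & (mk L phi psi < e%:E)%E.
Proof.
move=> e0; have [mk1 mk2 mk3] := mkW.
(* The implication makes [N phi] a neighbourhood among all functionals, not only relative to the
   states. The triangle inequality shows that [mk]-balls are [mk]-open, hence relatively weak*
   open. *)
pose N phi : set (weakstar A) := [set psi | states A psi ->
  (mk L phi psi < e%:E)%E].
have [|l [lS lP]] := @compact_finite_net (weakstar A) _ N (states_compact uU).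
  move=> phi phiS.
  have [|_] := mk3 [set psi | states A psi /\ (mk L phi psi < e%:E)%E].
    by move=> psi [].
  case.
    move=> psi [psiS psie]; have [psi0 _ _] := mk1 _ _ phiS psiS.
    have [/andP[m0 moo] _ _] := mk1 _ _ phiS psiS.
    exists (e - fine (mk L phi psi)).
      by rewrite subr_gt0 -lte_fin fineK// ge0_fin_numE.
    move=> chi chiS psichi; split => //.
    rewrite (le_lt_trans (mk2 _ _ _ phiS psiS chiS))//.
    move: psichi; rewrite EFinB fineK ?ge0_fin_numE//.
    by rewrite lteBrDr ?ge0_fin_numE// addeC.
  move=> V oV VP; have Vphi : V phi.
    apply: ((VP phi).1 _).1; split => //.
    by have [_ [_ ->//] _] := mk1 _ _ phiS phiS; rewrite lte_fin.
  move: oV; rewrite openE => /(_ phi Vphi); rewrite /interior/=.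
  apply: filterS => psi Vpsi psiS.
  by have [] := (VP psi).2 (conj Vpsi psiS).
exists l; split => // psi psiS; have [phi lphi /(_ psiS)] := lP psi psiS.
by exists phi.
Qed.

Lemma compact_radius mu : states A mu ->
  exists K : R, 0 <= K /\ forall psi, states A psi -> (mk L psi mu <= K%:E)%E.
Proof.
move=> muS; have [l [lS lP]] := mk_finite_net ltr01; have [mk1 mk2 _] := mkW.
have [K [K0 KP]] : exists K : R, 0 <= K /\
    forall phi, List.In phi l -> (mk L phi mu <= K%:E)%E.
  move: lS {lP}; elim: l => [|phi l IH] lS; first by exists 0.
  have [|K [K0 KP]] := IH; first by move=> psi ?; apply: lS; right.
  have [/andP[m0 moo] _ _] := mk1 _ _ (lS phi (or_introl erefl)) muS.
  exists (Num.max K (fine (mk L phi mu))); split; first by rewrite le_max K0.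
  move=> psi [<-|/KP psiK].
    by rewrite -[leLHS]fineK ?ge0_fin_numE// lee_fin le_max lexx orbT.
  by rewrite (le_trans psiK)// lee_fin le_max lexx.
exists (1 + K); split; first by rewrite addr_ge0.
move=> psi psiS; have [phi lphi phipsi] := lP psi psiS.
rewrite (le_trans (mk2 _ phi _ psiS (lS _ lphi) muS))// EFinD leeD ?KP//.
have [_ _ ->] := mk1 _ _ psiS (lS _ lphi); exact: ltW.
Qed.

(** A state [psi] sends [a - mu(a) u] to [psi a - mu a], which the [mk]-radius around [mu] bounds;
    the norm is the supremum of these values. *)
Lemma compact_deviation mu : states A mu ->
  exists2 K : R, 0 <= K & forall a, dom_sa L a -> lip L a <= 1 ->
    exists2 t : R, mu a = t%:C & rnorm (a - t%:C *: u) <= K.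
Proof.
move=> muS; have [K [K0 KP]] := compact_radius muS; exists K => // a da la.
have [t tE _] := state_sa uU muS da.2; exists t => //.
apply: (state_norm_sa uU) => //; first by rewrite starB star_Zu// da.2.
move=> psi psiS; have [[psil _] psiu] := (statesE uU _).1 psiS.
rewrite (linformB psil) (linformZ psil) psiu mulr1 -tE -lee_fin.
by rewrite (le_trans (mk_ubound _ _ da la))// KP.
Qed.

(** An Arzela-Ascoli argument: elements of the ball are bounded and 1-Lipschitz as functions on the
    states with [mk], so their values on a finite [mk]-net determine them up to a small error. Two
    moves along [mk] and one comparison on the net cost [e / 4] each. *)
Lemma compact_totally_bounded (K : R) :
  totally_bounded_set (lip_ball L K).
Proof.
move=> e e0; have e40 : 0 < e / 4 by rewrite divr_gt0.
have [l [lS lP]] := mk_finite_net e40.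
pose ev (phi : A -> R[i]) a := complex.Re (phi a).
have [|m [mS mP]] := @finite_value_net R A (List.map ev l)
    (lip_ball L K) K (e / 4) e40.
  move=> _ a /List.in_map_iff[phi [<- lphi]] [da la aK].
  by rewrite (le_trans (Re_le_rnorm _))// (le_trans (state_norm_le uU _ (lS _
    lphi))).
exists m => a Sa; have [b mb bP] := mP a Sa; exists b => //.
have [[da asa] la aK] := Sa; have [[db bsa] lb bK] := mS b mb.
rewrite (@le_lt_trans _ _ (3 * (e / 4)))//; last by lra.
apply: (state_norm_sa uU); [by rewrite starB asa bsa| |lra].
move=> psi psiS; have [phi lphi phipsi] := lP psi psiS.
have [[psil _] _] := (statesE uU _).1 psiS.
have [s sE _] := state_sa uU (lS _ lphi) asa.
have [t tE _] := state_sa uU (lS _ lphi) bsa.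
have := bP (ev phi) (List.in_map ev l phi lphi).
rewrite /ev sE tE /= => st.
have pa : rnorm (phi a - psi a) < e / 4.
  by rewrite -lte_fin (le_lt_trans (mk_ubound _ _ _ _) phipsi).
have pb : rnorm (phi b - psi b) < e / 4.
  by rewrite -lte_fin (le_lt_trans (mk_ubound _ _ _ _) phipsi).
have := rnorm_dist_tri (phi a) (psi a) (psi b).
have := rnorm_dist_tri (phi b) (phi a) (psi b).
rewrite (linformB psil) (rnorm_distC (psi a)
  (phi a)) sE tE -rmorphB /= rnorm_real.
rewrite sE in pa; rewrite tE in pb.
by move: pa pb st; lra.
Qed.

End CompactBounds.

(** * Totally bounded Lipschitz balls *)

(* Rieffel's characterization of quantum compact metric spaces by the total
   boundedness of Lipschitz balls modulo constants, with the unit [u] named. *)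
Definition compact_lip {R : realType} {A : cstarType R} (L : lipPair A)
  (u : A) :
    Prop :=
  [/\ is_unit u, lip_norm L, closed [set a | dom_sa L a /\ lip L a <= 1],
      exists K : R, forall a, dom_sa L a -> lip L a <= 1 ->
        exists t : R, rnorm (a - t%:C *: u) <= K &
      forall K, totally_bounded_set (lip_ball L K)].

Lemma quantum_compact_lip (R : realType) (A : cstarType R) (L : lipPair A)
    (u : A) (mu : A -> R[i]) :
  quantum_compact L -> states A mu -> is_unit u -> compact_lip L u.
Proof.
move=> [_ Lnorm Lclosed mkW] muS uU; split => //.
  have [K _ KP] := compact_deviation uU mkW muS; exists K => a da la.
  by have [t _] := KP a da la; exists t.
by move=> K; exact: compact_totally_bounded uU mkW K.
Qed.

Section CompactLip.
Context {R : realType} {A : cstarType R} (L : lipPair A) (u : A).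
Hypothesis (LP : compact_lip L u).
Implicit Types (a b c : A) (phi psi mu : A -> R[i]).

Let uU : is_unit u. Proof. by case: LP. Qed.
Let Lnorm : lip_norm L. Proof. by case: LP. Qed.

Lemma dom0 : dom L 0. Proof. by have [[]] := Lnorm. Qed.
Lemma domD a b : dom L a -> dom L b -> dom L (a + b).
Proof. by have [[_ + _ _ _] _ _ _ _] := Lnorm; apply. Qed.
Lemma domZ z a : dom L a -> dom L (z *: a).
Proof. by have [[_ _ + _ _] _ _ _ _] := Lnorm; apply. Qed.
Lemma domM a b : dom L a -> dom L b -> dom L (a ** b).
Proof. by have [[_ _ _ + _] _ _ _ _] := Lnorm; apply. Qed.
Lemma dom_star a : dom L a -> dom L (star a).
Proof. by have [[_ _ _ _ +] _ _ _ _] := Lnorm; apply. Qed.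
Lemma lip_ge0 a : dom L a -> 0 <= lip L a.
Proof. by have [_ _ [[+ _ _] _] _ _] := Lnorm; apply. Qed.
Lemma lipD a b : dom L a -> dom L b -> lip L (a + b) <= lip L a + lip L b.
Proof. by have [_ _ [[_ + _] _] _ _] := Lnorm; apply. Qed.
Lemma lipZ z a : dom L a -> lip L (z *: a) = rnorm z * lip L a.
Proof. by have [_ _ [[_ _ +] _] _ _] := Lnorm; apply. Qed.
Lemma lip_star a : dom L a -> lip L (star a) = lip L a.
Proof. by have [_ _ [_ +] _ _] := Lnorm; apply. Qed.

Lemma lipZr (t : R) a : dom L a -> lip L (t%:C *: a) = `|t| * lip L a.
Proof. by move=> da; rewrite lipZ// rnorm_real. Qed.

Lemma scalarsP a : scalars A a <-> exists z, a = z *: u.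
Proof.
split=> [[v vU [z ->]]|[z ->]]; last by exists u => //; exists z.
by exists z; rewrite (unit_unique uU vU).
Qed.

Lemma lip_eq0 a : dom L a /\ lip L a = 0 <-> exists z, a = z *: u.
Proof.
have [_ _ _ [+ _] _] := Lnorm => /(_ (ex_intro _ u uU)) LE.
by rewrite -scalarsP -LE.
Qed.

Lemma dom_sa_Zu (t : R) : dom_sa L (t%:C *: u).
Proof.
split; last exact: star_Zu.
by have [|] := (lip_eq0 (t%:C *: u)).2; first by exists t%:C.
Qed.

Lemma lip_Zu z : lip L (z *: u) = 0.
Proof. by have [|] := (lip_eq0 (z *: u)).2; first by exists z. Qed.

Lemma dom_unit : dom L u.
Proof. by have [] := dom_sa_Zu 1; rewrite scale1r. Qed.

Lemma lip_unit : lip L u = 0.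
Proof. by rewrite -[u]scale1r lip_Zu. Qed.

Lemma dom_sa_unit : dom_sa L u.
Proof. by split; [exact: dom_unit|exact: star_unit]. Qed.

Lemma dom_saZ (t : R) a : dom_sa L a -> dom_sa L (t%:C *: a).
Proof.
by move=> [da asa]; split; [exact: domZ|rewrite /self_adjoint /= starZr asa].
Qed.

Lemma dom_sa_re_part a : dom L a -> dom_sa L (re_part a).
Proof.
by move=> da; split; [apply/domZ/domD => //; exact: dom_star|exact: re_part_sa].
Qed.

Lemma dom_sa_im_part a : dom L a -> dom_sa L (im_part a).
Proof.
move=> da; split; last exact: im_part_sa.
by apply/domZ/domD; [exact: dom_star|rewrite -scaleN1r; exact: domZ].
Qed.

Lemma dom_sa_dense a (e : R) : 0 < e -> star a = a ->
  exists2 b, dom_sa L b & rnorm (a - b) < e.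
Proof.
move=> e0 asa; have [_ /dense_rnormP/(_ a e e0)[b db ab] _ _ _] := Lnorm.
exists (re_part b); first exact: dom_sa_re_part.
by rewrite -{1}(re_part_id asa) -re_partB (le_lt_trans (re_part_norm _)).
Qed.

Lemma compact_lip_deviation : exists2 K : R, 0 <= K &
  forall mu a, states A mu -> dom_sa L a -> lip L a <= 1 ->
    exists2 t : R, mu a = t%:C & rnorm (a - t%:C *: u) <= K.
Proof.
(* The bound doubles because the constant [s] attached to [a] is replaced by [mu a], and
   [mu a - s = mu (a - s u)]. This makes it uniform in the state. *)
have [_ _ _ [K KP] _] := LP; exists (`|K| + `|K|); first exact: addr_ge0.
move=> mu a muS da la; have [s sK] := KP a da la.
have [t tE _] := state_sa uU muS da.2; exists t => //.
rewrite (le_trans (rnorm_dist_tri (s%:C *: u) _ _))// lerD//.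
  by rewrite (le_trans sK)// ler_norm.
rewrite -scalerBl -rmorphB (le_trans (rnormZu_le uU _))//.
have := state_norm_le uU (a - s%:C *: u) muS.
have [[mul _] muu] := (statesE uU _).1 muS.
rewrite linformB// linformZ// muu mulr1 tE -rmorphB rnorm_real distrC =>
  /le_trans.
by apply; rewrite (le_trans sK)// ler_norm.
Qed.

Lemma norm_LM_le1 M a : 0 < M ->
  norm_LM L M a <= 1 <-> rnorm a <= M /\ lip L a <= 1.
Proof.
move=> M0; rewrite /norm_LM ge_max mulrC ler_pdivrMr// mul1r.
by split=> [/andP//|[-> ->]].
Qed.

Lemma bl_ubound M phi psi a : 0 < M -> dom_sa L a -> rnorm a <= M ->
  lip L a <= 1 -> ((rnorm (phi a - psi a))%:E <= bl L M phi psi)%E.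
Proof.
by move=> M0 da aM la; apply: ereal_sup_ubound; exists a => //; split => //;
  apply/norm_LM_le1.
Qed.

Lemma bl_le M phi psi (K : R) : 0 < M ->
  (forall a, dom_sa L a -> rnorm a <= M -> lip L a <= 1 ->
    rnorm (phi a - psi a) <= K) -> (bl L M phi psi <= K%:E)%E.
Proof.
move=> M0 KP; apply: ge_ereal_sup => _ [a /= [da /norm_LM_le1[]// aM la] <-].
by rewrite lee_fin; exact: KP.
Qed.

Lemma mk_le phi psi (K : R) :
  (forall a, dom_sa L a -> lip L a <= 1 -> rnorm (phi a - psi a) <= K) ->
  (mk L phi psi <= K%:E)%E.
Proof.
by move=> KP; apply: ge_ereal_sup => _ [a /= [da la] <-]; rewrite lee_fin;
  exact: KP.
Qed.

Lemma bl_control b : dom_sa L b -> exists2 C : R, 0 < C &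
  forall phi psi (e : R), states A phi -> states A psi ->
    (bl L 1 phi psi < e%:E)%E -> rnorm (phi b - psi b) <= C * e.
Proof.
move=> db; pose C := 1 + rnorm b + lip L b.
have C0 : 0 < C by rewrite /C; have := rnorm_ge0 b; have := lip_ge0 db.1; lra.
exists C => // phi psi e phiS psiS ble.
have [[phil _] _] := (statesE uU _).1 phiS;
  have [[psil _] _] := (statesE uU _).1 psiS.
have Cn : `|C^-1| = C^-1 by rewrite ger0_norm// invr_ge0 ltW.
have : rnorm (phi (C^-1%:C *: b) - psi (C^-1%:C *: b)) <= e.
  rewrite -lee_fin (le_trans _ (ltW ble))//; apply: bl_ubound => //.
  - exact: dom_saZ.
  - rewrite rnormZr Cn mulrC ler_pdivrMr// mul1r /C.
    by have := rnorm_ge0 b; have := lip_ge0 db.1; lra.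
  - rewrite (lipZr _ db.1) Cn mulrC ler_pdivrMr// mul1r /C.
    by have := rnorm_ge0 b; have := lip_ge0 db.1; lra.
rewrite !linformZ// -mulrBr rnormM rnorm_real Cn mulrC ler_pdivrMr//.
by rewrite mulrC.
Qed.

(** Evaluations at Lipschitz elements are controlled by [bl] and these elements are dense, which
    gives one direction. For the other, a finite net of the bounded Lipschitz ball lets finitely
    many evaluations control [bl]. *)
Lemma compact_lip_weakstar : induces_weakstar (bl L 1).
Proof.
move=> U US; split.
  move=> [V oV VU] phi Uphi; have phiS := US _ Uphi.
  pose F := filter_from [set e : R | 0 < e]
    (fun e => [set psi : weakstar A | states A psi /\
      (bl L 1 phi psi < e%:E)%E]).
  have FF : Filter F.
    apply: filter_from_filter; first by exists 1 => /=.
    move=> e e' /= e0 e'0; exists (Num.min e e'); first by rewrite /= lt_min e0.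
    move=> psi [psiS]; rewrite EFin_min lt_min => /andP[? ?].
    by split.
  have Fphi : F --> (phi : weakstar A).
    apply/(@pointwise_cvgP A R[i]^o) => a W /nbhs_rnormP[e e0 sub].
    (* The real and the imaginary part of [a] each cost [3 * (e / 8)]: an approximation under [phi],
       one under [psi], and the [bl] estimate in between. *)
    have e80 : 0 < e / 8 by rewrite divr_gt0.
    have [b db ab] := dom_sa_dense e80 (re_part_sa a).
    have [c dc ac] := dom_sa_dense e80 (im_part_sa a).
    have [C C0 CP] := bl_control db; have [D D0 DP] := bl_control dc.
    pose d := Num.min (e / 8 / C) (e / 8 / D).
    exists d; first by rewrite /= lt_min !divr_gt0.
    move=> psi [psiS]; rewrite EFin_min lt_min => /andP[psib psic]; apply: sub.
    have := CP _ _ _ phiS psiS psib; rewrite mulrC divfK ?gt_eqF// => {}psib.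
    have := DP _ _ _ phiS psiS psic; rewrite mulrC divfK ?gt_eqF// => {}psic.
    have [[phil _] _] := (statesE uU _).1 phiS;
      have [[psil _] _] := (statesE uU _).1 psiS.
    have near_eq x y : rnorm (x - y) < e / 8 ->
      rnorm (phi y - psi y) <= e / 8 ->
        rnorm (phi x - psi x) < 3 * (e / 8).
      move=> xy pxy.
      have := state_norm_le uU (x - y) phiS;
        have := state_norm_le uU (x - y) psiS.
      rewrite !linformB//.
      have := rnorm_dist_tri (phi y) (phi x) (psi x).
      have := rnorm_dist_tri (psi y) (phi y) (psi x).
      by rewrite (rnorm_distC (psi y)); lra.
    rewrite (re_im_part a) !(linformD phil, linformD psil).
    rewrite (linformZ phil 'i%C) (linformZ psil 'i%C) opprD addrACA -mulrBr.
    rewrite (le_lt_trans (rnormD _ _))// rnormM rnormi mul1r.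
    by have := near_eq _ _ ab psib; have := near_eq _ _ ac psic; lra.
  have : F V by apply: Fphi; move: oV; rewrite openE; apply;
    apply: ((VU phi).1 Uphi).1.
  move=> [e e0 FV]; exists e => // psi psiS psie; apply/VU; split => //.
  by apply: FV.
move=> Uopen; exists (interior ([set psi | states A psi ->
  U psi] : set (weakstar A))).
  exact: open_interior.
move=> phi; split=> [Uphi|[Vphi phiS]]; last by apply: interior_subset Vphi _.
split; last exact: US.
have [e e0 eU] := Uopen phi Uphi; have [_ _ _ _ /(_ 1)] := LP.
have e40 : 0 < e / 4 by rewrite divr_gt0.
move=> /(_ _ e40)[m mP]; rewrite /interior /=.
have FF := nbhs_filter (phi : weakstar A).
apply: filterS (weakstar_nbhs_seq phi m e40) => psi /= psim psiS.
apply: eU => //; have phiS := US _ Uphi.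
rewrite (@le_lt_trans _ _ (3 * (e / 4))%:E) ?lte_fin//; last by lra.
apply: bl_le => // a da a1 la; have [b mb ab] := mP a (And3 da la a1).
have [[phil _] _] := (statesE uU _).1 phiS;
  have [[psil _] _] := (statesE uU _).1 psiS.
have := state_norm_le uU (a - b) phiS; have := state_norm_le uU (a - b) psiS.
rewrite !linformB//; have := psim b mb.
have := rnorm_dist_tri (phi b) (phi a) (psi a).
have := rnorm_dist_tri (psi b) (phi b) (psi a).
by rewrite (rnorm_distC (psi b)); move: ab; lra.
Qed.

Lemma scale_lip_ball b (N : R) : 0 < N -> dom_sa L b -> rnorm b <= N ->
  lip L b <= N -> lip_ball L 1 (N^-1%:C *: b).
Proof.
move=> N0 db bN lb; have Nn : `|N^-1| = N^-1 by rewrite ger0_norm// invr_ge0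
  ltW.
split; first exact: dom_saZ.
  by rewrite lipZr ?Nn 1?mulrC ?ler_pdivrMr ?mul1r//; case: db.
by rewrite rnormZr Nn mulrC ler_pdivrMr// mul1r.
Qed.

(** A self-adjoint Lipschitz element is an integer multiple of a point of [lip_ball L 1], so the
    multiples of the points of countably many finite nets are dense in the self-adjoint part; pairs
    of them give real and imaginary parts. *)
Lemma compact_lip_separable : separable A.
Proof.
have [_ _ _ _ /(_ 1) tb] := LP.
have k0 (k : nat) : 0 < k.+1%:R^-1 :> R by rewrite invr_gt0.
pose net k := projT1 (cid (tb _ (k0 k))).
have netP k a : lip_ball L 1 a -> exists2 b,
  b \in net k & rnorm (a - b) < k.+1%:R^-1.
  by rewrite /net; case: cid => m /= mP /mP.
pose pt (i : nat * nat * nat) : A := i.1.1%:R%:C *: seq.nth 0 (net i.1.2) i.2.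
have ptP a (e : R) : 0 < e -> star a = a -> exists i, rnorm (a - pt i) < e.
  move=> e0 asa; have e20 : 0 < e / 2 by rewrite divr_gt0.
  have [b db ab] := dom_sa_dense e20 asa.
  pose n := (Num.trunc (rnorm b + lip L b)).+1.
  have bn : rnorm b + lip L b < n%:R by exact: truncnS_gt.
  have n0 : 0 < n%:R :> R by rewrite ltr0n.
  have lb0 := lip_ge0 db.1; have b0 := rnorm_ge0 b.
  have bb : lip_ball L 1 ((n%:R)^-1%:C *: b) by apply: scale_lip_ball => //;
    lra.
  pose k := Num.trunc (n%:R / (e / 2)).
  have [c ck bc] := netP k _ bb.
  exists (n, k, index c (net k)); rewrite /pt /= nth_index//.
  have : rnorm (b - n%:R%:C *: c) < e / 2.
    have -> : b - n%:R%:C *: c = n%:R%:C *: (n%:R^-1%:C *: b - c).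
      by rewrite scalerBr scalerA -rmorphM /= divff ?gt_eqF// scale1r.
    rewrite rnormZr ger0_norm ?ler0n//.
    have := truncnS_gt (n%:R / (e / 2)); rewrite -/k ltr_pdivrMr// => nk.
    rewrite mulrC -ltr_pdivlMr// (lt_trans bc)// -[X in X < _]mul1r
      ltr_pdivrMr//.
    by rewrite mulrAC ltr_pdivlMr// mul1r mulrC.
  by have := rnorm_dist_tri b a (n%:R%:C *: c); lra.
exists (range (fun ij : (nat * nat * nat) * (nat * nat * nat) =>
  pt ij.1 + 'i%C *: pt ij.2)).
  exact: card_le_trans (card_image_le _ _) (countableP _).
apply/dense_rnormP => a e e0; have e20 : 0 < e / 2 by rewrite divr_gt0.
have [i ai] := ptP _ _ e20 (re_part_sa a);
  have [j aj] := ptP _ _ e20 (im_part_sa a).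
exists (pt i + 'i%C *: pt j); first by exists (i, j).
rewrite [X in X - _]re_im_part opprD addrACA -scalerBr (le_lt_trans (rnormD _
  _))//.
by rewrite rnormZ rnormi mul1r; lra.
Qed.

Lemma strictly_positive_unit : strictly_positive u.
Proof.
split; first exact: star_unit.
by move=> phi /(statesE uU)[_ ->]; exact: ltr01.
Qed.

(** With the unit as the strictly positive element, the sandwiched elements are the [b - mu(b) u],
    whose norm is the deviation of [b] from a constant. *)
Lemma lip_sandwich_bounded mu : states A mu ->
  bounded_set (lip_sandwich L u mu).
Proof.
move=> muS; have [K K0 KP] := compact_lip_deviation.
exists K%:C; split; first by rewrite complex_real.
move=> x /ltW Kx _ [b [t [db lb mub ->]]].
have [s sE sK] := KP mu b muS db lb.
rewrite /= (le_trans _ Kx)// normE lecR !(uU _).1 (uU _).2.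
move: mub; rewrite sE -rmorphN => /complexI st.
by rewrite -[t]opprK -st rmorphN scaleNr.
Qed.

Lemma compact_lip_sqlcms mu : states A mu -> sqlcms L.
Proof.
move=> muS; have [_ _ Lclosed _ _] := LP; split => //.
- exact: compact_lip_separable.
- exact: compact_lip_weakstar.
exists u, mu; split => //;
  [exact: strictly_positive_unit|by case/(statesE uU): muS|].
exact: lip_sandwich_bounded.
Qed.

Lemma unit_neq0 mu : states A mu -> u != 0.
Proof.
move=> /(statesE uU)[[mul _] muu]; apply/eqP => u0; move: muu.
by rewrite u0 linform0// => /eqP; rewrite eq_sym oner_eq0.
Qed.

Lemma character_on_scalars mu : states A mu -> character_on (scalars A) mu.
Proof.
move=> /(statesE uU)[[mul _] muu]; split.
  move=> _ _ /scalarsP[z ->] /scalarsP[w ->].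
  by rewrite cmulZl cmulZr (uU u).1 !linformZ// muu !mulr1.
by exists u; [apply/scalarsP; exists 1; rewrite scale1r|rewrite muu oner_eq0].
Qed.

Lemma scalars_abelian mu : states A mu -> abelian_cstar_subalgebra (scalars A).
Proof.
move=> muS; have [[mul _] muu] := (statesE uU _).1 muS; split; first split.
- by apply/scalarsP; exists 0; rewrite scale0r.
- by move=> _ _ /scalarsP[z ->] /scalarsP[w ->]; apply/scalarsP;
    exists (z + w); rewrite scalerDl.
- by move=> w _ /scalarsP[z ->]; apply/scalarsP; exists (w * z);
    rewrite scalerA.
- move=> _ _ /scalarsP[z ->] /scalarsP[w ->]; apply/scalarsP; exists (z * w).
  by rewrite cmulZl cmulZr (uU u).1 scalerA.
- move=> _ /scalarsP[z ->]; apply/scalarsP; exists z^*.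
  by rewrite starZ (star_unit uU).
(* The state reads off the coordinate: a limit of scalars can only be [mu a *: u]. *)
- apply/closed_rnormP => a aS; apply/scalarsP; exists (mu a).
  apply/eqP; rewrite -subr_eq0; apply/eqP/(@rnorm_small0 _ _ _ 2) => e e0.
  have [_ /scalarsP[z ->] az] := aS e e0.
  have := state_norm_le uU (a - z *: u) muS.
  rewrite linformB// linformZ// muu mulr1 => muz.
  have := rnorm_dist_tri (z *: u) a (mu a *: u).
  rewrite -scalerBl rnormZ (rnorm_distC z) => H.
  have := rnorm_unit_le1 uU; have := rnorm_ge0 (mu a - z); have := rnorm_ge0 u.
  by nra.
- move=> _ _ /scalarsP[z ->] /scalarsP[w ->].
  by rewrite !cmulZl !cmulZr !scalerA mulrC.
Qed.

Lemma compact_lip_topographic mu : states A mu ->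
  topographic_sqlcms L (scalars A).
Proof.
move=> muS; split; first exact: compact_lip_sqlcms muS.
split; first exact: scalars_abelian muS.
exists u; split; [|exact: dom_unit|exact: strictly_positive_unit|].
  by apply/scalarsP; exists 1; rewrite scale1r.
exists mu; split => //; first exact: character_on_scalars.
exact: lip_sandwich_bounded.
Qed.

Lemma mk_finite phi mu : states A phi -> states A mu -> (mk L phi mu < +oo)%E.
Proof.
move=> phiS muS; have [K K0 KP] := compact_lip_deviation.
rewrite (@le_lt_trans _ _ K%:E) ?ltry//; apply: mk_le => a da la.
have [t tE tK] := KP mu a muS da la.
have [[phil _] phiu] := (statesE uU _).1 phiS.
have := state_norm_le uU (a - t%:C *: u) phiS.
by rewrite linformB// linformZ// phiu mulr1 tE => /le_trans; apply.
Qed.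

(** All states lie at finite distance from one another, so the set required to be dense is the whole
    state space. *)
Lemma compact_lip_pin mu : states A mu -> pin L mu.
Proof.
move=> muS; split => // phi phiS; apply: subset_closure; split => //.
exact: mk_finite.
Qed.

Lemma compact_lip_proper mu : states A mu -> pointed_proper L (scalars A) mu.
Proof.
move=> muS; split; [exact: compact_lip_topographic muS|exact: compact_lip_pin|
  exact: character_on_scalars|].
exists (fun=> u); last by move=> _; apply/scalarsP; exists 1; rewrite scale1r.
have [_ muu] := (statesE uU _).1 muS.
split; [by move=> _; exact: dom_sa_unit|rewrite lip_unit; exact: cvg_cst| |].
  by rewrite muu; exact: cvg_cst.
by rewrite (rnorm_unit uU (unit_neq0 muS)); exact: cvg_cst.
Qed.

End CompactLip.

(** * Direct sums of C*-algebras *)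

Section ProductComplete.
Context {K : numFieldType} {U V : completeNormedModType K}.

HB.instance Definition _ := isPointed.Build (U * V)%type (0, 0).

Lemma prod_cauchy_cvg (F : set_system (U * V)) :
  ProperFilter F -> cauchy F -> cvg F.
Proof.
move=> FF /cauchy_ballP FC.
have proj_cauchy (W : completeNormedModType K) (f : U * V -> W) :
    (forall p q e, ball p e q -> ball (f p) e (f q)) -> cauchy (f @ F).
  move=> fb; apply/cauchy_ballP => e e0; have := FC e e0; rewrite !near_simpl.
  move=> [[P Q] [/= FP FQ] PQ]; exists (f @` P, f @` Q) => /=.
    by split; [apply: filterS FP|apply: filterS FQ] => x; exists x.
  by move=> [x y] /= [[p Pp <-] [q Qq <-]]; apply/fb/(PQ (p, q)).
have /cauchy_cvg/cvg_ex[l Fl] : cauchy (fst @ F).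
  by apply: proj_cauchy => p q e [].
have /cauchy_cvg/cvg_ex[m Fm] : cauchy (snd @ F).
  by apply: proj_cauchy => p q e [].
apply/cvg_ex; exists (l, m) => W [[P Q] [/= lP mQ] PQ].
have FP : F (fst @^-1` P) by exact: Fl.
have FQ : F (snd @^-1` Q) by exact: Fm.
apply: (@filterS _ F _ _ _ _ (filterI FP FQ)) => -[x y] /= [Px Qy].
exact: (PQ (x, y)).
Qed.

HB.instance Definition _ := Uniform_isComplete.Build (U * V)%type
  prod_cauchy_cvg.

End ProductComplete.

Section ProductCStar.
Context {R : realType} {A B : cstarType R}.
Implicit Types p q r : A * B.

Lemma rnorm_pair (U V : normedZmodType R[i]) (p : U * V) :
  rnorm p = Num.max (rnorm p.1) (rnorm p.2).
Proof.
apply: complexI; rewrite -normE prod_normE !normE.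
have [le|/ltW le] := leP (rnorm p.1) (rnorm p.2).
  by rewrite max_r// lecR.
by rewrite max_l// lecR.
Qed.

Definition pair_mul p q : A * B := (p.1 ** q.1, p.2 ** q.2).
Definition pair_star p : A * B := (star p.1, star p.2).

Lemma pair_mulA p q r : pair_mul p (pair_mul q r) = pair_mul (pair_mul p q) r.
Proof. by rewrite /pair_mul !cmulA. Qed.
Lemma pair_mulDl p q r : pair_mul (p + q) r = pair_mul p r + pair_mul q r.
Proof. by rewrite /pair_mul !cmulDl. Qed.
Lemma pair_mulDr p q r : pair_mul p (q + r) = pair_mul p q + pair_mul p r.
Proof. by rewrite /pair_mul !cmulDr. Qed.
Lemma pair_mulZl (z : R[i]) p q : pair_mul (z *: p) q = z *: pair_mul p q.
Proof. by rewrite /pair_mul !cmulZl. Qed.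
Lemma pair_mulZr (z : R[i]) p q : pair_mul p (z *: q) = z *: pair_mul p q.
Proof. by rewrite /pair_mul !cmulZr. Qed.
Lemma pair_starK p : pair_star (pair_star p) = p.
Proof. by case: p => a b; rewrite /pair_star !starK. Qed.
Lemma pair_starD p q : pair_star (p + q) = pair_star p + pair_star q.
Proof. by rewrite /pair_star !starD. Qed.
Lemma pair_starZ (z : R[i]) p : pair_star (z *: p) = z^* *: pair_star p.
Proof. by rewrite /pair_star !starZ. Qed.
Lemma pair_starM p q :
  pair_star (pair_mul p q) = pair_mul (pair_star q) (pair_star p).
Proof. by rewrite /pair_star !starM. Qed.

Lemma pair_norm_mul p q : `|pair_mul p q| <= `|p| * `|q|.
Proof.
rewrite !normE -rmorphM lecR !rnorm_pair ge_max; apply/andP; split.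
  rewrite (le_trans (rnorm_cmul _ _))// ler_pM ?rnorm_ge0// le_max lexx//.
by rewrite (le_trans (rnorm_cmul _ _))// ler_pM ?rnorm_ge0// le_max lexx orbT.
Qed.

Lemma pair_norm_star p : `|pair_mul (pair_star p) p| = `|p| ^+ 2.
Proof.
rewrite !normE -rmorphXn !rnorm_pair !rnorm_cstar; congr (_%:C).
have [le|/ltW le] := leP (rnorm p.1) (rnorm p.2).
  by rewrite max_r// lerXn2r ?nnegrE ?rnorm_ge0.
by rewrite max_l// lerXn2r ?nnegrE ?rnorm_ge0.
Qed.

HB.instance Definition _ := CompleteNormedModule_isCStarAlgebra.Build R (A *
  B)%type
  pair_mulA pair_mulDl pair_mulDr pair_mulZl pair_mulZr pair_starK pair_starD
  pair_starZ pair_starM pair_norm_mul pair_norm_star.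

End ProductCStar.

(** * From compact tunnels to M-tunnels *)

Section QuantumIsometry.
Context {R : realType} {D A : cstarType R}.
Variables (LD : lipPair D) (LA : lipPair A) (uD : D) (uA : A) (pi : D -> A).
Hypotheses (LDP : compact_lip LD uD) (LAP : compact_lip LA uA).
Hypothesis (piP : quantum_isometry LD LA pi).

Let uDU : is_unit uD. Proof. by case: LDP. Qed.
Let uAU : is_unit uA. Proof. by case: LAP. Qed.

Lemma isometryD x y : pi (x + y) = pi x + pi y.
Proof. by have [[+ _ _] _ _ _] := piP => /(_ 1 x y); rewrite !scale1r. Qed.

Lemma isometry0 : pi 0 = 0.
Proof. by apply: (addrI (pi 0)); rewrite -isometryD !addr0. Qed.

Lemma isometryZ z x : pi (z *: x) = z *: pi x.
Proof.
by have [[+ _ _] _ _ _] := piP => /(_ z x 0); rewrite isometry0 !addr0.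
Qed.

Lemma isometryN x : pi (- x) = - pi x.
Proof. by rewrite -scaleN1r isometryZ scaleN1r. Qed.

Lemma isometryM x y : pi (x ** y) = pi x ** pi y.
Proof. by have [[_ + _] _ _ _] := piP; apply. Qed.

Lemma isometry_star x : pi (star x) = star (pi x).
Proof. by have [[_ _ +] _ _ _] := piP; apply. Qed.

Lemma isometry_unit : pi uD = uA.
Proof.
have [piM pis _ _] := piP.
exact: unit_unique (star_morphism_unit uDU piM pis) uAU.
Qed.

Lemma isometry_contractive x : rnorm (pi x) <= rnorm x.
Proof. by have [piM pis _ _] := piP;
  exact: (star_morphism_contractive uDU piM pis). Qed.

Lemma isometry_dom_sa x : dom_sa LD x -> dom_sa LA (pi x).
Proof.
have [_ _ pid _] := piP => -[dx xsa]; split; first by apply: pid; exists x.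
by rewrite /self_adjoint /= -isometry_star xsa.
Qed.

Lemma isometry_lip_le x : dom_sa LD x -> lip LA (pi x) <= lip LD x.
Proof.
move=> dx; have [_ _ _ /(_ _ (isometry_dom_sa dx))] := piP.
by rewrite -lee_fin => ->; apply: ereal_inf_lbound; exists x.
Qed.

Lemma isometry_lift a (l : R) : dom_sa LA a -> lip LA a < l ->
  exists d, [/\ dom_sa LD d, pi d = a & lip LD d < l].
Proof.
have [_ _ _ piinf] := piP => da.
rewrite -lte_fin piinf// => /ereal_inf_lt[_ [d [dd pd] <-]].
by rewrite lte_fin; exists d.
Qed.

Lemma pullback_positive phi : positive_functional phi ->
  positive_functional (phi \o pi).
Proof.
move=> [phil phip]; split=> [z x y|x] /=.
  by rewrite isometryD isometryZ phil.
by rewrite isometryM isometry_star.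
Qed.

Lemma pullback_state phi : states A phi -> states D (phi \o pi).
Proof.
move=> /(statesE uAU)[phip phiu]; apply/(statesE uDU); split.
  exact: pullback_positive.
by rewrite /= isometry_unit.
Qed.

Section Extent.
Variable (e : R).
Hypothesis (e_gt : (hausdorff_dist (mk LD) (states D)
  (pullback pi (states A)) < e%:E)%E).

Lemma isometry_near_state phi : states D phi ->
  exists2 psi, states A psi & forall d, dom_sa LD d -> lip LD d <= 1 ->
    rnorm (phi d - psi (pi d)) <= e.
Proof.
move=> phiS; move: e_gt; rewrite /hausdorff_dist gt_max => /andP[supe _].
have : (ereal_inf [set mk LD phi y | y in pullback pi (states A)] < e%:E)%E.
  by apply: le_lt_trans supe; apply: ereal_sup_ubound; exists phi.
move=> /ereal_inf_lt[_ [_ [psi psiS <-] <-] mke].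
exists psi => // d dd ld; rewrite -lee_fin (le_trans _ (ltW mke))//.
exact: (mk_ubound phi (psi \o pi) dd ld).
Qed.

(** A functional of mass [c = phi u] is normalized, approximated by a pulled back state and scaled
    back; as [c <= 1] the error does not grow. Mass zero means that the functional vanishes. *)
Lemma isometry_near_quasi_state phi : quasi_states D phi ->
  exists2 psi, quasi_states A psi & forall d, dom_sa LD d -> lip LD d <= 1 ->
    rnorm (phi d - psi (pi d)) <= `|e|.
Proof.
move=> /(quasi_statesE uDU)[phip]; have [phil phi0] := phip.
have := positive_functional_unit uDU phip; move=> /ge0_Re.
have := positive_functional_unit uDU phip; rewrite lecE => /andP[_] /=.
set c := complex.Re _ => c0 cE c1; have [c00|cn0] := eqVneq c 0.
  exists (fun=> 0).
    apply/(quasi_statesE uAU); split; last by rewrite /= ler01.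
    by split=> [z x y|x] /=; rewrite ?mulr0 ?addr0.
  move=> d _ _; rewrite subr0.
  have := positive_functional_norm_le uDU d phip; rewrite -/c c00 mul0r.
  by move=> /le_trans; apply; rewrite normr_ge0.
have cp : 0 < c by rewrite lt_neqAle eq_sym cn0.
have ci : 0 <= (c^-1)%:C :> R[i] by rewrite lecR invr_ge0.
have [|psi psiS psie] := @isometry_near_state (fun d => c^-1%:C * phi d).
  apply/(statesE uDU); split; last by rewrite cE -rmorphM /= mulVf.
  split=> [z x y|x] /=; first by rewrite phil; ring.
  by rewrite mulr_ge0.
have [[psil psi0] psiu] := (statesE uAU _).1 psiS.
exists (fun a => c%:C * psi a).
  apply/(quasi_statesE uAU); split; last by rewrite psiu mulr1.
  split=> [z x y|x] /=; first by rewrite psil; ring.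
  by rewrite mulr_ge0// lecR.
move=> d dd ld; have := psie d dd ld.
have -> : phi d - c%:C * psi (pi d) = c%:C * (c^-1%:C * phi d - psi (pi d)).
  by rewrite mulrBr mulrA -rmorphM /= divff// mul1r.
rewrite rnormM rnorm_real (ger0_norm c0) => H.
by rewrite (le_trans _ (ler_norm e))// (le_trans _ H)// ler_piMl ?rnorm_ge0.
Qed.

Lemma isometry_lift_norm d (l : R) : 0 < l -> dom_sa LD d -> lip LD d <= l ->
  rnorm d <= rnorm (pi d) + l * `|e|.
Proof.
move=> l0 dd ld; have [_ dsa] := dd.
apply: (state_norm_sa uDU) => //;
  last by rewrite addr_ge0 ?rnorm_ge0// mulr_ge0// ltW.
move=> phi phiS; have [psi psiS psie] := isometry_near_state phiS.
have [[phil _] _] := (statesE uDU _).1 phiS;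
  have [[psil _] _] := (statesE uAU _).1 psiS.
have ln : `|l^-1| = l^-1 by rewrite ger0_norm// invr_ge0 ltW.
have := psie _ (dom_saZ LDP l^-1 dd); rewrite (lipZr LDP _ dd.1) ln.
rewrite mulrC ler_pdivrMr// mul1r => /(_ ld).
rewrite isometryZ !linformZ// -mulrBr rnormM rnorm_real ln mulrC ler_pdivrMr//.
move=> H; rewrite -[phi d](subrK (psi (pi d))) (le_trans (rnormD _ _))//.
rewrite addrC lerD ?(state_norm_le uAU)// (le_trans H)// mulrC.
by rewrite ler_wpM2l ?ler_norm// ltW.
Qed.

(* An exact lift of [a] may have a larger norm than [a]; rescaling it restores
   the norm, at the cost of moving its image by at most [l e]. *)
Lemma isometry_near_lift a (l : R) : 0 < l -> dom_sa LA a -> lip LA a < l ->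
  exists d, [/\ dom_sa LD d, lip LD d <= l, rnorm d <= rnorm a &
                rnorm (a - pi d) <= `|e| * l].
Proof.
move=> l0 da /(isometry_lift da)[d [dd pd /ltW ld]].
have := isometry_lift_norm l0 dd ld; rewrite pd; set n := rnorm a => dn.
have n0 : 0 <= n by exact: rnorm_ge0.
have le0 : 0 <= l * `|e| by rewrite mulr_ge0// ltW.
(* For [a = 0] the quotient [s] below could be [0 / 0]; zero is then taken as the lift. *)
have [n00|nn0] := eqVneq n 0.
  exists 0; rewrite isometry0 subr0 rnorm0.
  have d0 : dom_sa LD 0 by split; [exact: dom0 LDP|exact: star0].
  split => //; last by rewrite -/n n00 mulrC.
  by rewrite -(scale0r 0) (lipZ LDP _ d0.1) rnorm0 mul0r ltW.
have np : 0 < n by rewrite lt_neqAle eq_sym nn0.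
pose s := n / (n + l * `|e|).
have nl0 : 0 < n + l * `|e| by rewrite ltr_wpDr.
have s0 : 0 <= s by rewrite divr_ge0 ?addr_ge0.
have s1 : s <= 1 by rewrite ler_pdivrMr// mul1r lerDl.
exists (s%:C *: d); split.
- exact: (dom_saZ LDP).
- by rewrite (lipZr LDP _ dd.1) ger0_norm// (le_trans _ ld)// ler_piMl//
    (lip_ge0 LDP dd.1).
- rewrite rnormZr ger0_norm// (le_trans (ler_wpM2l s0 dn))//.
  by rewrite /s divfK// gt_eqF.
- have -> : a - pi (s%:C *: d) = (1 - s)%:C *: a.
    by rewrite isometryZ pd rmorphB /= scalerBl scale1r.
  rewrite rnormZr ger0_norm ?subr_ge0// -/n mulrC.
  have -> : n * (1 - s) = s * (l * `|e|).
    by rewrite /s; field; rewrite gt_eqF.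
  by rewrite mulrC [leRHS]mulrC ler_piMr.
Qed.

End Extent.

End QuantumIsometry.

Section Bridge.
Context {R : realType} {A D B : cstarType R}.
Variables (LA : lipPair A) (LD : lipPair D) (LB : lipPair B).
Variables (uA : A) (uD : D) (uB : B) (pi : D -> A) (rho : D -> B).
Hypotheses (LAP : compact_lip LA uA) (LDP : compact_lip LD uD)
  (LBP : compact_lip LB uB).
Hypotheses (piP : quantum_isometry LD LA pi)
  (rhoP : quantum_isometry LD LB rho).
Variable (e : R).
Hypothesis (e0 : 0 < e).

Local Notation E := (A * (D * B))%type.
Implicit Types (x y : E).

Let uE : E := (uA, (uD, uB)).

Definition bridge : lipPair E := LipPair
  [set x | [/\ dom LA x.1, dom LD x.2.1 & dom LB x.2.2]]
  (fun x => Num.max (Num.max (lip LA x.1) (lip LD x.2.1))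
    (Num.max (lip LB x.2.2)
     (Num.max (e^-1 * rnorm (x.1 - pi x.2.1))
       (e^-1 * rnorm (x.2.2 - rho x.2.1))))).

Lemma bridge_lipP x r : lip bridge x <= r <->
  [/\ lip LA x.1 <= r, lip LD x.2.1 <= r, lip LB x.2.2 <= r,
      rnorm (x.1 - pi x.2.1) <= e * r & rnorm (x.2.2 - rho x.2.1) <= e * r].
Proof.
rewrite /bridge /= !ge_max ![e^-1 * _]mulrC !ler_pdivrMr// ![r * e]mulrC.
by split=> [/andP[/andP[-> ->] /andP[-> /andP[-> ->]]]//|[-> -> -> -> ->]].
Qed.

Lemma rnorm_tripleP x r : rnorm x <= r <->
  [/\ rnorm x.1 <= r, rnorm x.2.1 <= r & rnorm x.2.2 <= r].
Proof.
rewrite !rnorm_pair !ge_max.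
by split=> [/andP[-> /andP[-> ->]]//|[-> -> ->]].
Qed.

Lemma rnorm_triple x :
  [/\ rnorm x.1 <= rnorm x, rnorm x.2.1 <= rnorm x & rnorm x.2.2 <= rnorm x].
Proof. exact/rnorm_tripleP. Qed.

Lemma bridge_dom_saP x : dom_sa bridge x <->
  [/\ dom_sa LA x.1, dom_sa LD x.2.1 & dom_sa LB x.2.2].
Proof.
case: x => a [d b]; split=> [[[/= da dd db]]|[[da sa] [dd sd] [db sb]]].
  by move=> [sa sd sb].
by split; [split|congr (_, (_, _)); [exact: sa|exact: sd|exact: sb]].
Qed.

Lemma bridge_unit : is_unit uE.
Proof.
have [uAU _ _ _ _] := LAP; have [uDU _ _ _ _] := LDP; have [uBU _ _ _ _] := LBP.
move=> [a [d b]]; rewrite /cmul /= /pair_mul /=.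
by split; congr (_, (_, _)); by [apply (uAU a)|apply (uDU d)|apply (uBU b)].
Qed.

(** The difference splits as [a ** (a' - f d') + (a - f d) ** f d']. With the contractivity of [f],
    this is the Leibniz inequality for each bridge term. *)
Lemma leibniz_diff (C : cstarType R) (f : D -> C) (a a' : C) (d d' : D) :
  f (d ** d') = f d ** f d' -> rnorm (f d') <= rnorm d' ->
  rnorm (a ** a' - f (d ** d')) <=
    rnorm a * rnorm (a' - f d') + rnorm (a - f d) * rnorm d'.
Proof.
move=> -> fd'.
have -> : a ** a' - f d ** f d' = a ** (a' - f d') + (a - f d) ** f d'.
  by rewrite cmulDl cmulDr cmulNr cmulNl addrA subrK.
rewrite (le_trans (rnormD _ _))// lerD// (le_trans (rnorm_cmul _ _))//.
by rewrite ler_wpM2l ?rnorm_ge0.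
Qed.

Lemma bridge_lip_norm : lip_norm bridge.
Proof.
have lipge0 x : dom bridge x -> 0 <= lip bridge x.
  by move=> [dA _ _]; rewrite /bridge /= le_max le_max (lip_ge0 LAP dA).
split.
- split.
  + by split; [exact: dom0 LAP|exact: dom0 LDP|exact: dom0 LBP].
  + move=> x y [xA xD xB] [yA yD yB].
    by split; [exact: (domD LAP)|exact: (domD LDP)|exact: (domD LBP)].
  + move=> z x [xA xD xB].
    by split; [exact: (domZ LAP)|exact: (domZ LDP)|exact: (domZ LBP)].
  + move=> x y [xA xD xB] [yA yD yB].
    by split; [exact: (domM LAP)|exact: (domM LDP)|exact: (domM LBP)].
  + move=> x [xA xD xB].
    by split; [exact: (dom_star LAP)|exact: (dom_star LDP)|exact: (dom_star
      LBP)].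
- apply/dense_rnormP => -[a [d b]] r r0.
  have [_ [_ /dense_rnormP/(_ a r r0)[a' da ra] _ _ _] _ _ _] := LAP.
  have [_ [_ /dense_rnormP/(_ d r r0)[d' dd rd] _ _ _] _ _ _] := LDP.
  have [_ [_ /dense_rnormP/(_ b r r0)[b' db rb] _ _ _] _ _ _] := LBP.
  exists (a', (d', b')); first by split.
  by rewrite !rnorm_pair /= !gt_max ra rd rb.
- split; first split => //.
  + move=> x y [xA xD xB] [yA yD yB]; apply/bridge_lipP.
    have [x1 x2 x3 x4 x5] := (bridge_lipP x _).1 (lexx _).
    have [y1 y2 y3 y4 y5] := (bridge_lipP y _).1 (lexx _).
    split.
    * by rewrite (le_trans (lipD LAP xA yA))// lerD.
    * by rewrite (le_trans (lipD LDP xD yD))// lerD.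
    * by rewrite (le_trans (lipD LBP xB yB))// lerD.
    * by rewrite /= (isometryD piP) opprD addrACA mulrDr (le_trans (rnormD _
        _))// lerD.
    * by rewrite /= (isometryD rhoP) opprD addrACA mulrDr (le_trans (rnormD _
        _))// lerD.
  + move=> z x [xA xD xB]; rewrite /bridge /=.
    rewrite (lipZ LAP _ xA) (lipZ LDP _ xD) (lipZ LBP _ xB).
    rewrite (isometryZ piP) (isometryZ rhoP) -!scalerBr !rnormZ.
    by rewrite ![e^-1 * (_ * _)]mulrCA !maxr_pMr ?rnorm_ge0.
  + move=> x [xA xD xB]; rewrite /bridge /=.
    rewrite (lip_star LAP xA) (lip_star LDP xD) (lip_star LBP xB).
    by rewrite (isometry_star piP) (isometry_star rhoP) -!starB !rnorm_star.
- split=> [_|[]]; last by exists uE; exact: bridge_unit.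
  apply/seteqP; split=> x.
    move=> [[xA xD xB] x0]; have := (bridge_lipP x 0).1.
    rewrite x0 lexx mulr0 => /(_ isT)[x1 x2 x3 x4 x5].
    (* The seminorm of D makes the middle coordinate scalar, and the vanishing bridge terms then
       force the outer coordinates to be its images. *)
    have [z xz] : exists z, x.2.1 = z *: uD.
      apply/(lip_eq0 LDP); split => //; apply/eqP.
      by rewrite eq_le x2 (lip_ge0 LDP xD).
    have sub0 (C : cstarType R) (a b : C) : rnorm (a - b) <= 0 -> a = b.
      move=> ab; apply/eqP; rewrite -subr_eq0; apply/eqP/rnorm_eq0/eqP.
      by rewrite eq_le ab rnorm_ge0.
    exists uE; first exact: bridge_unit.
    exists z; case: x {xA xD xB x0 x1 x2 x3} xz x4 x5 =>
      a [d b] /= -> /sub0 -> /sub0 ->.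
    by rewrite (isometryZ piP) (isometryZ rhoP) (isometry_unit LDP LAP piP)
      (isometry_unit LDP LBP rhoP).
  move=> [v vU [z ->]]; rewrite (unit_unique vU bridge_unit) {vU}.
  have dz : dom bridge (z *: uE).
    by split; [apply: (domZ LAP); exact: (dom_unit LAP)|
      apply: (domZ LDP); exact: (dom_unit LDP)|apply: (domZ LBP);
        exact: (dom_unit LBP)].
  split => //; apply/eqP; rewrite eq_le lipge0// andbT; apply/bridge_lipP.
  rewrite /= (lip_Zu LAP) (lip_Zu LDP) (lip_Zu LBP) (isometryZ piP)
    (isometryZ rhoP).
  rewrite (isometry_unit LDP LAP piP) (isometry_unit LDP LBP rhoP) !subrr
    !rnorm0.
  by rewrite mulr0.
- move=> x y [xA xD xB] [yA yD yB]; apply/bridge_lipP.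
  have [_ [_ _ _ _ leibA] _ _ _] := LAP; have [_ [_ _ _ _ leibD] _ _ _] := LDP.
  have [_ [_ _ _ _ leibB] _ _ _] := LBP.
  have [x1 x2 x3 x4 x5] := (bridge_lipP x _).1 (lexx _).
  have [y1 y2 y3 y4 y5] := (bridge_lipP y _).1 (lexx _).
  have [nx1 nx2 nx3] := rnorm_triple x; have [ny1 ny2 ny3] := rnorm_triple y.
  have up (C : cstarType R) (a b : C) l m : 0 <= l -> 0 <= m ->
     rnorm a <= rnorm x -> l <= lip bridge y -> 
     m <= lip bridge x -> rnorm b <= rnorm y ->
     rnorm a * l + m * rnorm b <= rnorm x * lip bridge y + lip bridge x * rnorm
       y.
    by move=> *; rewrite lerD// ler_pM ?rnorm_ge0.
  split.
  + rewrite (le_trans (leibA _ _ xA yA))//.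
    by apply: up => //; [exact: (lip_ge0 LAP yA)|exact: (lip_ge0 LAP xA)].
  + rewrite (le_trans (leibD _ _ xD yD))//.
    by apply: up => //; [exact: (lip_ge0 LDP yD)|exact: (lip_ge0 LDP xD)].
  + rewrite (le_trans (leibB _ _ xB yB))//.
    by apply: up => //; [exact: (lip_ge0 LBP yB)|exact: (lip_ge0 LBP xB)].
  + rewrite (le_trans (leibniz_diff _ _ (isometryM piP _ _)
      (isometry_contractive LDP piP _)))//.
    have : rnorm x.1 * rnorm (y.1 - pi y.2.1) <= rnorm x * (e * lip bridge y).
      by rewrite ler_pM ?rnorm_ge0.
    have : rnorm (x.1 - pi x.2.1) * rnorm y.2.1 <= e * lip bridge x * rnorm y.
      by rewrite ler_pM ?rnorm_ge0.
    by lra.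
  + rewrite (le_trans (leibniz_diff _ _ (isometryM rhoP _ _)
      (isometry_contractive LDP rhoP _)))//.
    have : rnorm x.2.2 * rnorm (y.2.2 - rho y.2.1) <= rnorm x * (e * lip bridge
      y).
      by rewrite ler_pM ?rnorm_ge0.
    have : rnorm (x.2.2 - rho x.2.1) * rnorm y.2.1 <= e * lip bridge x * rnorm
      y.
      by rewrite ler_pM ?rnorm_ge0.
    by lra.
Qed.

(** Closedness passes to the sum because the bridge terms are continuous in [x], and total
    boundedness because a product of nets is a net. *)
Lemma bridge_compact_lip : compact_lip bridge uE.
Proof.
have [_ _ LAc [_ _] LAtb] := LAP; have [_ _ LDc [K KP] LDtb] := LDP.
have [_ _ LBc [_ _] LBtb] := LBP.
split; [exact: bridge_unit|exact: bridge_lip_norm| | |].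
- apply/closed_rnormP => x xS.
  have near (r : R) : 0 < r -> exists y, [/\ dom_sa bridge y, lip bridge y <= 1,
      rnorm (x.1 - y.1) < r, rnorm (x.2.1 - y.2.1) < r & rnorm (x.2.2 - y.2.2)
        < r].
    move=> r0; have [y [dy ly] xy] := xS r r0; exists y; split => //.
    + by have [+ _ _] := rnorm_triple (x - y) => /le_lt_trans; apply.
    + by have [_ + _] := rnorm_triple (x - y) => /le_lt_trans; apply.
    + by have [_ _ +] := rnorm_triple (x - y) => /le_lt_trans; apply.
  have [xA lA] : [set a | dom_sa LA a /\ lip LA a <= 1] x.1.
    move/closed_rnormP: LAc;
      apply => r /near[y [/bridge_dom_saP[? _ _] /bridge_lipP[? _ _ _ _] ? _
        _]].
    by exists y.1.
  have [xD lD] : [set a | dom_sa LD a /\ lip LD a <= 1] x.2.1.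
    move/closed_rnormP: LDc;
      apply => r /near[y [/bridge_dom_saP[_ ? _] /bridge_lipP[_ ? _ _ _] _ ?
        _]].
    by exists y.2.1.
  have [xB lB] : [set a | dom_sa LB a /\ lip LB a <= 1] x.2.2.
    move/closed_rnormP: LBc;
      apply => r /near[y [/bridge_dom_saP[_ _ ?] /bridge_lipP[_ _ ? _ _] _ _
        ?]].
    by exists y.2.2.
  have gap (C : cstarType R) (LC : lipPair C) (uC : C) (f : D ->
    C) (a a' : C) (d d' : D) (r : R) :
      compact_lip LC uC -> quantum_isometry LD LC f ->
      rnorm (a - a') < r -> rnorm (d - d') < r -> rnorm (a' - f d') <= e * 1 ->
      rnorm (a - f d) <= e * 1 + 2 * r.
    move=> LCP fP aa dd ad; have := isometry_contractive LDP fP (d' - d).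
    rewrite (isometryD fP) (isometryN fP) (rnorm_distC d').
    have := rnorm_dist_tri a' a (f d); have := rnorm_dist_tri (f d') a' (f d).
    by lra.
  split; first exact/bridge_dom_saP.
  apply/bridge_lipP; split => //; apply/ler_addgt0Pl => r r0.
    have [y [_ /bridge_lipP[_ _ _ ? _] ? ? _]] := near (r / 2)
      (divr_gt0 r0 (ltr0Sn _ 1)).
    have := gap _ _ _ _ _ _ _ _ _ LAP piP;
      move=> /(_ x.1 y.1 x.2.1 y.2.1 (r / 2)) H.
    by rewrite (le_trans (H _ _ _))//; lra.
  have [y [_ /bridge_lipP[_ _ _ _ ?] _ ? ?]] := near (r / 2)
    (divr_gt0 r0 (ltr0Sn _ 1)).
  have := gap _ _ _ _ _ _ _ _ _ LBP rhoP;
    move=> /(_ x.2.2 y.2.2 x.2.1 y.2.1 (r / 2)) H.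
  by rewrite (le_trans (H _ _ _))//; lra.
- exists (e * 1 + K) => x /bridge_dom_saP[xA xD xB] /bridge_lipP[lA lD lB xa
    xb].
  (* One constant must serve all three coordinates. It is taken from D and carried over by [pi] and
     [rho], which preserve units; the bridge terms add at most [e]. *)
  have [t tK] := KP _ xD lD; exists t.
  have gap (C : cstarType R) (LC : lipPair C) (uC : C) (f : D ->
    C) (a : C) (d : D) :
      compact_lip LC uC -> quantum_isometry LD LC f ->
      rnorm (d - t%:C *: uD) <= K -> rnorm (a - f d) <= e * 1 ->
      rnorm (a - t%:C *: uC) <= e * 1 + K.
    move=> LCP fP dt ad; have := isometry_contractive LDP fP (d - t%:C *: uD).
    rewrite (isometryD fP) (isometryN fP) (isometryZ fP)
      (isometry_unit LDP LCP fP).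
    by have := rnorm_dist_tri (f d) a (t%:C *: uC); lra.
  apply/rnorm_tripleP; split.
  + exact: gap LAP piP tK xa.
  + by rewrite (le_trans tK)// lerDr mulr1 ltW.
  + exact: gap LBP rhoP tK xb.
- move=> N r r0; have [mA mAP] := LAtb N r r0; have [mD mDP] := LDtb N r r0.
  have [mB mBP] := LBtb N r r0.
  exists [seq (a, p) | a <- mA, p <- [seq (d, b) | d <- mD, b <- mB]].
  move=> x [/bridge_dom_saP[xA xD xB] /bridge_lipP[lA lD lB _ _]
    /rnorm_tripleP[nA nD nB]].
  have [a ma xa] := mAP x.1 (And3 xA lA nA);
    have [d md xd] := mDP x.2.1 (And3 xD lD nD).
  have [b mb xb] := mBP x.2.2 (And3 xB lB nB).
  exists (a, (d, b)); first by apply: allpairs_f => //; exact: allpairs_f.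
  by rewrite !rnorm_pair /= !gt_max xa xd xb.
Qed.

End Bridge.

Lemma unit_approximate_unit (R : realType) (F : cstarType R)
  (u : F) : is_unit u ->
  approximate_unit (fun _ _ : unit => True) (fun=> u).
Proof.
move=> uU; split.
- by split; [exists tt|by []|by []|move=> i j; exists tt].
- move=> _; split; last exact: rnorm_unit_le1.
  by exists u; rewrite (star_unit uU) (uU u).1.
- by move=> _ _ _; exists 0; rewrite subrr cmul0r.
- move=> a e e0; exists tt => _ _.
  by rewrite (uU a).1 (uU a).2 subrr rnorm0.
Qed.

Section LiftIsometry.
Context {R : realType} {E C : cstarType R}.
Variables (LE : lipPair E) (LC : lipPair C) (uE : E) (uC : C) (p : E -> C).
Hypotheses (LEP : compact_lip LE uE) (LCP : compact_lip LC uC).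
Hypotheses (pM : star_morphism p) (psurj : forall a, exists x, p x = a).
Hypothesis (pdom : p @` dom LE `<=` dom LC).
Hypothesis (plip : forall x, dom_sa LE x -> lip LC (p x) <= lip LE x).
Hypothesis (plift : forall a l, 0 < l -> dom_sa LC a -> lip LC a < l ->
  exists x, [/\ dom_sa LE x, p x = a, lip LE x <= l & rnorm x <= rnorm a]).

Let uEU : is_unit uE. Proof. by case: LEP. Qed.
Let uCU : is_unit uC. Proof. by case: LCP. Qed.

Let pD x y : p (x + y) = p x + p y.
Proof. by have [+ _ _] := pM => /(_ 1 x y); rewrite !scale1r. Qed.

Let p0 : p 0 = 0.
Proof. by apply: (addrI (p 0)); rewrite -pD !addr0. Qed.

Let pZ z x : p (z *: x) = z *: p x.
Proof. by have [+ _ _] := pM => /(_ z x 0); rewrite p0 !addr0. Qed.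

Let pu : p uE = uC.
Proof. exact: unit_unique (star_morphism_unit uEU pM psurj) uCU. Qed.

Lemma lift_dom_sa a : dom_sa LC a -> exists2 x, dom LE x & p x = a.
Proof.
move=> da; have l0 : 0 < lip LC a + 1 by rewrite ltr_wpDl// (lip_ge0 LCP da.1).
by have [|x [[dx _] px _ _]] := plift l0 da; [rewrite ltrDl|exists x].
Qed.

(** One inequality holds because [p] decreases the norm and the seminorm separately, the other
    because [plift] increases neither beyond an arbitrary margin. Both are insensitive to the weight
    [M^-1]. *)
Lemma lift_M_isometry M : 0 < M -> quantum_M_isometry M LE LC p.
Proof.
move=> M0; split => //.
- exists unit, (fun _ _ => True), (fun=> uE).
  split; first exact: unit_approximate_unit.
  by rewrite /comp pu; exact: unit_approximate_unit.
- apply/seteqP; split=> // a da.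
  (* Lifts are available for self-adjoint elements only; a general element is lifted through its
     real and imaginary parts. *)
  have [x dx px] := lift_dom_sa (dom_sa_re_part LCP da).
  have [y dy py] := lift_dom_sa (dom_sa_im_part LCP da).
  exists (x + 'i%C *: y); first by apply: (domD LEP) => //; exact: (domZ LEP).
  by rewrite pD pZ px py -re_im_part.
move=> a da; apply/eqP; rewrite eq_le; apply/andP; split.
  apply: le_ereal_inf_tmp => _ [x [dx <-] <-]; rewrite lee_fin.
  rewrite /norm_LM ge_max !le_max plip// orbT andbT; apply/orP; left.
  apply: ler_wpM2l; first by rewrite invr_ge0 ltW.
  exact: (star_morphism_contractive uEU pM psurj).
apply/lee_addgt0Pr => e e0; rewrite -EFinD.
have [la na] : lip LC a <= norm_LM LC M a /\ M^-1 * rnorm a <= norm_LM LC M a.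
  by rewrite /norm_LM !le_max !lexx orbT.
have l0 := lip_ge0 LCP da.1.
have [||x [dx px lx nx]] := @plift a (norm_LM LC M a + e) _ da.
- by rewrite ltr_wpDl// (le_trans l0).
- by rewrite (le_lt_trans la)// ltrDl.
have : (norm_LM LE M x <= norm_LM LC M a + e).
  rewrite /norm_LM ge_max lx andbT -/(norm_LM LC M a).
  rewrite (le_trans (ler_wpM2l _ nx)) ?invr_ge0 1?ltW//.
  by rewrite (le_lt_trans na)// ltrDl.
by rewrite -lee_fin; apply: le_trans; apply: ereal_inf_lbound; exists x.
Qed.

Lemma lift_topographic : uE != 0 -> uC != 0 ->
  topographic_isometry LE (scalars E) LC (scalars C) p.
Proof.
move=> uE0 uC0; split.
  by move=> _ [x /(scalarsP LEP)[z ->] <-]; apply/(scalarsP LCP); exists z;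
    rewrite pZ pu.
move=> a e da /(scalarsP LCP)[z az] e0.
(* Since [uC] is not 0, self-adjointness of [a = z *: uC] forces [z] to be real, so the lift is
   self-adjoint too. *)
have nz : z *: uE = star (z *: uE).
  have := da.2; rewrite /self_adjoint /= az starZ (star_unit uCU) => /eqP.
  rewrite -subr_eq0 -scalerBl scaler_eq0 (negbTE uC0) orbF subr_eq0 => /eqP zz.
  by rewrite starZ (star_unit uEU) zz.
exists (z *: uE); split.
- by apply/(scalarsP LEP); exists z.
- by split => //; apply/(domZ LEP)/(dom_unit LEP).
- by rewrite pZ pu az.
- rewrite az !rnormZ (rnorm_unit uEU uE0) (rnorm_unit uCU uC0) mulr1.
  by rewrite ler_peMl ?rnorm_ge0// ltW// expR_gt1.
- by rewrite az (lip_Zu LEP) (lip_Zu LCP) mulr0.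
Qed.

End LiftIsometry.

Section BridgeTunnel.
Context {R : realType} {A D B : cstarType R}.
Variables (LA : lipPair A) (LD : lipPair D) (LB : lipPair B).
Variables (uA : A) (uD : D) (uB : B) (pi : D -> A) (rho : D -> B).
Hypotheses (LAP : compact_lip LA uA) (LDP : compact_lip LD uD)
  (LBP : compact_lip LB uB).
Hypotheses (piP : quantum_isometry LD LA pi)
  (rhoP : quantum_isometry LD LB rho).
Variable (e : R).
Hypothesis (e0 : 0 < e).
Hypothesis (pi_e : (hausdorff_dist (mk LD) (states D)
  (pullback pi (states A)) < e%:E)%E).
Hypothesis (rho_e : (hausdorff_dist (mk LD) (states D)
  (pullback rho (states B)) < e%:E)%E).

Local Notation E := (A * (D * B))%type.
Local Notation L := (bridge LA LD LB pi rho e).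
Local Notation uE := (uA, (uD, uB)).

Let LP : compact_lip L uE.
Proof. exact: (bridge_compact_lip LAP LDP LBP piP rhoP e0). Qed.

Definition proj_left (x : E) : A := x.1.
Definition proj_right (x : E) : B := x.2.2.

Lemma proj_left_morphism : star_morphism proj_left.
Proof. by split. Qed.

Lemma proj_right_morphism : star_morphism proj_right.
Proof. by split. Qed.

Lemma proj_left_surj a : exists x, proj_left x = a.
Proof. by exists (a, 0). Qed.

Lemma proj_right_surj b : exists x, proj_right x = b.
Proof. by exists (0, (0, b)). Qed.

Lemma proj_left_dom : proj_left @` dom L `<=` dom LA.
Proof. by move=> _ [x [xA _ _] <-]. Qed.

Lemma proj_right_dom : proj_right @` dom L `<=` dom LB.
Proof. by move=> _ [x [_ _ xB] <-]. Qed.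

Lemma proj_left_lip x : lip LA (proj_left x) <= lip L x.
Proof. by have [] := (bridge_lipP LA LD LB pi rho e0 x _).1 (lexx _). Qed.

Lemma proj_right_lip x : lip LB (proj_right x) <= lip L x.
Proof. by have [] := (bridge_lipP LA LD LB pi rho e0 x _).1 (lexx _). Qed.

(** The error [e * l] left by [isometry_near_lift] is exactly what a bridge term, divided by [e],
    tolerates at level [l]; the other bridge term vanishes because the third coordinate is
    [rho d]. *)
Lemma proj_left_lift a l : 0 < l -> dom_sa LA a -> lip LA a < l ->
  exists x, [/\ dom_sa L x, proj_left x = a, lip L x <= l & rnorm x <= rnorm a].
Proof.
move=> l0 da la; have [d [dd ld nd]] := isometry_near_lift LDP LAP piP pi_e l0
  da la.
rewrite (gtr0_norm e0) => ad; exists (a, (d, rho d)); split => //.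
- by apply/bridge_dom_saP; split => //; exact: (isometry_dom_sa rhoP dd).
- apply/(bridge_lipP _ _ _ _ _ e0); split => //=; first exact: ltW.
    exact: le_trans (isometry_lip_le rhoP dd) ld.
  by rewrite subrr rnorm0 mulr_ge0// ltW.
- apply/rnorm_tripleP; split => //=.
  exact: le_trans (isometry_contractive LDP rhoP d) nd.
Qed.

Lemma proj_right_lift b l : 0 < l -> dom_sa LB b -> lip LB b < l ->
  exists x, [/\ dom_sa L x, proj_right x = b,
    lip L x <= l & rnorm x <= rnorm b].
Proof.
move=> l0 db lb; have [d [dd ld nd]] := isometry_near_lift LDP LBP rhoP rho_e
  l0 db lb.
rewrite (gtr0_norm e0) => bd; exists (pi d, (d, b)); split => //.
- by apply/bridge_dom_saP; split => //; exact: (isometry_dom_sa piP dd).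
- apply/(bridge_lipP _ _ _ _ _ e0); split => //=.
  + exact: (le_trans (isometry_lip_le piP dd) ld).
  + exact: ltW.
  + by rewrite subrr rnorm0 mulr_ge0// ltW.
- apply/rnorm_tripleP; split => //=.
  exact: le_trans (isometry_contractive LDP piP d) nd.
Qed.

(** A copy of D in the sum as a unital *-subalgebra. Functionals on the sum are restricted to it in
    order to be compared with functionals on D. *)
Definition diagonal (d : D) : E := (pi d, (d, rho d)).

Lemma diagonal_near x : lip L x <= 1 -> rnorm (x - diagonal x.2.1) <= e.
Proof.
move=> /(bridge_lipP _ _ _ _ _ e0)[_ _ _ xa xb]; rewrite mulr1 in xa xb.
by apply/rnorm_tripleP; split => //=; rewrite subrr rnorm0 ltW.
Qed.

Lemma diagonal_quasi_state phi : quasi_states E phi ->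
  quasi_states D (phi \o diagonal).
Proof.
have [uU _ _ _ _] := LP; have [uDU _ _ _ _] := LDP.
move=> /(quasi_statesE uU)[[phil phi0] phi1]; apply/(quasi_statesE uDU); split;
  [split|].
- move=> z x y /=; rewrite -phil; congr (phi _).
  by rewrite /diagonal !(isometryD piP) !(isometryD rhoP) !(isometryZ piP)
    !(isometryZ rhoP).
- move=> x /=; rewrite (_ : diagonal _ = star (diagonal x) ** diagonal x)//.
  by rewrite /diagonal !(isometryM piP) !(isometryM rhoP) !(isometry_star piP)
    !(isometry_star rhoP).
- by rewrite /= /diagonal (isometry_unit LDP LAP piP)
    (isometry_unit LDP LBP rhoP).
Qed.

(** Compression by the unit is the identity. Each of three moves costs [e]: [x] to the diagonal
    under [phi], the restriction of [phi] to a quasi-state of C, and [f x.2.1] to [p x] under [psi].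
    All three rest on the seminorm bound for [x], whence the same constant for every [M]. *)
Lemma bridge_quasi_states (C : cstarType R) (LC : lipPair C) (uC : C) (f : D ->
  C)
    (p : E -> C) (M : R) : compact_lip LC uC ->
  (hausdorff_dist (mk LD) (states D) (pullback f (states C)) < e%:E)%E ->
  (forall x, lip L x <= 1 -> rnorm (f x.2.1 - p x) <= e) ->
  included_upto (bl L M) (3 * e) (compressed_quasi_states (uE : E))
    (pullback p (quasi_states C)).
Proof.
have [uU _ _ _ _] := LP; move=> LCP f_e pe _ [phi phiQ <-].
have uCU : is_unit uC by case: LCP.
have [psi psiQ psie] := isometry_near_quasi_state LDP LCP f_e
  (diagonal_quasi_state phiQ).
apply: ge_ereal_inf.
exists (bl L M (fun d => phi ((uE : E) ** d ** (uE : E))) (psi \o p)).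
  by exists (psi \o p) => //; exists psi.
apply: ge_ereal_sup => _ [x [dx nx] <-]; rewrite lee_fin.
have lx : lip L x <= 1 by move: nx; rewrite /norm_LM ge_max => /andP[].
have -> : (uE : E) ** x ** (uE : E) = x by rewrite (uU x).1 (uU x).2.
have [[phil _] _] := (quasi_statesE uU _).1 phiQ.
have [[psil _] _] := (quasi_statesE uCU _).1 psiQ.
have /bridge_dom_saP[_ dd _] := dx.
have [_ ld _ _ _] := (bridge_lipP _ _ _ _ _ e0 _ _).1 lx.
have := psie _ dd ld; rewrite (gtr0_norm e0) /=.
have := quasi_state_norm_le uU (x - diagonal x.2.1) phiQ; rewrite linformB//.
have := diagonal_near lx; have := pe x lx.
have := quasi_state_norm_le uCU (f x.2.1 - p x) psiQ; rewrite linformB//.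
have := rnorm_dist_tri (phi (diagonal x.2.1)) (phi x) (psi (p x)).
have := rnorm_dist_tri (psi (f x.2.1)) (phi (diagonal x.2.1)) (psi (p x)).
rewrite /=; lra.
Qed.

(** The path goes from [phi x.1] through [phi (pi x.2.1)] and [psi (rho x.2.1)] to [psi x.2.2]; the
    bridge terms pay for the two outer moves, the compact tunnel for the middle one. *)
Lemma bridge_mk phi psi : states A phi -> states B psi ->
  (mk LD (phi \o pi) (psi \o rho) <= e%:E)%E ->
  (mk L (phi \o proj_left) (psi \o proj_right) <= (3 * e)%:E)%E.
Proof.
have [uAU _ _ _ _] := LAP; have [uBU _ _ _ _] := LBP.
move=> phiS psiS mke; apply: ge_ereal_sup => _ [x [dx lx] <-]; rewrite lee_fin.
have /bridge_dom_saP[_ dd _] := dx.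
have [_ ld _ xa xb] := (bridge_lipP _ _ _ _ _ e0 _ _).1 lx.
have : rnorm (phi (pi x.2.1) - psi (rho x.2.1)) <= e.
  by rewrite -lee_fin (le_trans _ mke)//;
    exact: (mk_ubound (phi \o pi) (psi \o rho) dd ld).
have [[phil _] _] := (statesE uAU _).1 phiS.
have [[psil _] _] := (statesE uBU _).1 psiS.
have := state_norm_le uAU (x.1 - pi x.2.1) phiS; rewrite linformB//.
have := state_norm_le uBU (x.2.2 - rho x.2.1) psiS; rewrite linformB//.
rewrite mulr1 in xa xb; rewrite /= /proj_left /proj_right.
have := rnorm_dist_tri (phi (pi x.2.1)) (phi x.1) (psi x.2.2).
have := rnorm_dist_tri (psi (rho x.2.1)) (phi (pi x.2.1)) (psi x.2.2).
by rewrite (rnorm_distC (psi x.2.2)); lra.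
Qed.

End BridgeTunnel.

(** * Quantum diameters across a tunnel *)

Section QuantumDiameter.
Context {R : realType} {A : cstarType R} (LA : lipPair A) (uA : A).
Hypothesis (LAP : compact_lip LA uA).

Lemma mk_le_qdiam phi psi : states A phi -> states A psi ->
  (mk LA phi psi <= qdiam LA)%E.
Proof. by move=> phiS psiS; apply: ereal_sup_ubound; exists (phi, psi). Qed.

Lemma mk_ge0 phi psi : (0 <= mk LA phi psi)%E.
Proof.
have d0 : dom_sa LA 0 by split; [exact: (dom0 LAP)|exact: star0].
apply: le_trans (mk_ubound phi psi d0 _); first by rewrite lee_fin rnorm_ge0.
by rewrite -(scale0r 0) (lipZ LAP _ d0.1) rnorm0 mul0r.
Qed.

Lemma qdiam_ge0 mu : states A mu -> (0 <= qdiam LA)%E.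
Proof. by move=> muS; apply: le_trans (mk_ge0 mu mu) (mk_le_qdiam muS muS). Qed.

Lemma qdiam_fin_num mu : states A mu -> qdiam LA \is a fin_num.
Proof.
move=> muS; have [uAU _ _ _ _] := LAP;
  have [K K0 KP] := compact_lip_deviation LAP.
rewrite ge0_fin_numE; last exact: qdiam_ge0 muS.
rewrite (@le_lt_trans _ _ (K + K)%:E) ?ltry//; apply: ge_ereal_sup.
move=> _ [[phi psi] [/= phiS psiS] <-]; apply: mk_le => a da la.
have [s sE sK] := KP phi a phiS da la.
have [[psil _] psiu] := (statesE uAU _).1 psiS.
have := state_norm_le uAU (a - s%:C *: uA) psiS.
rewrite linformB// linformZ// psiu mulr1 sE rnorm_distC => H.
by rewrite (le_trans H)// (le_trans sK)// lerDl.
Qed.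

End QuantumDiameter.

Section QuantumDiameterIsometry.
Context {R : realType} {D A : cstarType R}.
Variables (LD : lipPair D) (LA : lipPair A) (uD : D) (uA : A) (pi : D -> A).
Hypotheses (LDP : compact_lip LD uD) (LAP : compact_lip LA uA).
Hypothesis (piP : quantum_isometry LD LA pi).

Lemma mk_pullback phi psi : states A phi -> states A psi ->
  (mk LA phi psi <= mk LD (phi \o pi) (psi \o pi))%E.
Proof.
move=> phiS psiS; set m := mk LD _ _.
have m0 : (0 <= m)%E by exact: (mk_ge0 LDP).
have mfin : m \is a fin_num.
  by rewrite ge0_fin_numE//; apply: (mk_finite LDP);
    exact: (pullback_state LDP LAP piP).
rewrite -(fineK mfin); apply: mk_le => a da la; apply/ler_addgt0Pr => r r0.
have f0 : 0 <= fine m by exact: fine_ge0.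
(* The infimum defining the quotient seminorm need not be attained, so the lift has seminorm below
   some [l > 1] and is rescaled by [l^-1]. The choice of [l] ensures [m l <= m + r]; the added 1
   covers [m = 0]. *)
pose l := 1 + r / (fine m + 1).
have fm1 : 0 < fine m + 1 by rewrite ltr_wpDl.
have rf : 0 < r / (fine m + 1) by rewrite divr_gt0.
have l0 : 0 < l by rewrite addr_gt0.
have ln : `|l^-1| = l^-1 by rewrite ger0_norm// invr_ge0 ltW.
have [|d [dd pd ld]] := isometry_lift piP (l := l) da.
  by rewrite (le_lt_trans la)// ltrDl.
have := mk_ubound (phi \o pi) (psi \o pi) (dom_saZ LDP l^-1 dd).
rewrite (lipZr LDP _ dd.1) ln mulrC ler_pdivrMr// mul1r => /(_ (ltW ld)).
rewrite -/m -(fineK mfin) lee_fin /=.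
have [uAU _ _ _ _] := LAP.
have [[phil _] _] := (statesE uAU _).1 phiS;
  have [[psil _] _] := (statesE uAU _).1 psiS.
rewrite (isometryZ piP) pd !linformZ// -mulrBr rnormM rnorm_real ln mulrC
  ler_pdivrMr//.
move=> /le_trans; apply; rewrite /l mulrDr mulr1 lerD2l mulrA ler_pdivrMr//.
by rewrite mulrC ler_pM2l// lerDl.
Qed.

Lemma qdiam_isometry_le : (qdiam LA <= qdiam LD)%E.
Proof.
apply: ge_ereal_sup => _ [[phi psi] [/= phiS psiS] <-].
rewrite (le_trans (mk_pullback phiS psiS))//; apply: ereal_sup_ubound.
exists (phi \o pi, psi \o pi) => //; split; exact: (pullback_state LDP LAP piP).
Qed.

(** Two states of D are replaced by pulled back states of A, at a cost of [e] each, and [pi] does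
    not increase the seminorm of the test elements. *)
Lemma qdiam_isometry_ge (e : R) : (hausdorff_dist (mk LD) (states D)
    (pullback pi (states A)) < e%:E)%E -> (qdiam LD <= qdiam LA + (2 * e)%:E)%E.
Proof.
move=> pi_e; apply: ge_ereal_sup => _ [[phi psi] [/= phiS psiS] <-].
have [phi' phi'S phie] := isometry_near_state pi_e phiS.
have [psi' psi'S psie] := isometry_near_state pi_e psiS.
apply: ge_ereal_sup => _ [d [dd ld] <-].
have := mk_ubound phi' psi' (isometry_dom_sa piP dd)
  (le_trans (isometry_lip_le piP dd) ld).
move=> /le_trans/(_ (mk_le_qdiam LA phi'S psi'S)).
rewrite -(fineK (qdiam_fin_num LAP phi'S)) -EFinD !lee_fin.
have := phie d dd ld; have := psie d dd ld.
have := rnorm_dist_tri (phi' (pi d)) (phi d) (psi d).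
have := rnorm_dist_tri (psi' (pi d)) (phi' (pi d)) (psi d).
by rewrite (rnorm_distC (psi d)); lra.
Qed.

End QuantumDiameterIsometry.

(** * Estimates for a single compact tunnel *)

Section CompactTunnel.
Context {R : realType} (X Y : pointedQCMS R) (t : compactTunnel X Y).
Variable (e : R).
Hypothesis (e0 : 0 < e).
Hypothesis (te : (pointed_extent t < e%:E)%E).

Local Notation A := (qcms_alg X).
Local Notation B := (qcms_alg Y).
Local Notation D := (ct_alg t).
Local Notation LA := (qcms_lip X).
Local Notation LB := (qcms_lip Y).
Local Notation LD := (ct_lip t).
Local Notation pi := (@ct_left _ _ _ t).
Local Notation rho := (@ct_right _ _ _ t).

Lemma pointed_qcms_lip (Z : pointedQCMS R) : exists u,
  compact_lip (qcms_lip Z) u.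
Proof.
have [[u uU] _ _ _] := qcms_compact Z; exists u.
exact: (quantum_compact_lip (qcms_compact Z) (qcms_state Z) uU).
Qed.

Lemma compact_tunnel_lip : exists u, compact_lip LD u.
Proof.
have [uA LAP] := pointed_qcms_lip X; have [uAU _ _ _ _] := LAP.
have [[uD uDU] _ _ _] := ct_compact t; exists uD.
have [[phip phiu] [piM pis _ _]] := ((statesE uAU _).1 (qcms_state X),
  ct_leftP t).
apply: (@quantum_compact_lip _ _ _ _ (qcms_pt X \o pi) (ct_compact t) _ uDU).
apply/(statesE uDU); split; first exact: (pullback_positive (ct_leftP t)).
by rewrite /= (unit_unique (star_morphism_unit uDU piM pis) uAU).
Qed.

Lemma pointed_extent_ge0 : (0 <= pointed_extent t)%E.
Proof.
have [uD LDP] := compact_tunnel_lip.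
by rewrite /pointed_extent le_max (mk_ge0 LDP) orbT.
Qed.

Lemma pointed_extent_lt :
  [/\ (hausdorff_dist (mk LD) (states D) (pullback pi (states A)) < e%:E)%E,
      (hausdorff_dist (mk LD) (states D) (pullback rho (states B)) < e%:E)%E &
      (mk LD (qcms_pt X \o pi) (qcms_pt Y \o rho) < e%:E)%E].
Proof. by move: te; rewrite /pointed_extent !gt_max => /andP[/andP[]]. Qed.

Lemma local_metametric_tunnel_le M : 1 <= M ->
  (local_metametric M (proper_of_compact X) (proper_of_compact Y)
     <= (3 * e)%:E)%E.
Proof.
move=> M1; have M0 : 0 < M by exact: lt_le_trans ltr01 M1.
have [uA LAP] := pointed_qcms_lip X; have [uB LBP] := pointed_qcms_lip Y.
have [uD LDP] := compact_tunnel_lip;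
  have [pi_e rho_e mk_e] := pointed_extent_lt.
have piP := ct_leftP t; have rhoP := ct_rightP t.
have muA := qcms_state X; have muB := qcms_state Y.
pose L := bridge LA LD LB pi rho e;
  pose u : (A * (D * B))%type := (uA, (uD, uB)).
have LP : compact_lip L u by exact: (bridge_compact_lip LAP LDP LBP piP rhoP
  e0).
have uA0 := unit_neq0 LAP muA; have uB0 := unit_neq0 LBP muB.
have u0 : u != 0 by apply: contra uA0 => /eqP [->].
have [uU _ _ _ _] := LP; have [uAU _ _ _ _] := LAP; have [uBU _ _ _ _] := LBP.
have leftS : states (A * (D * B))%type (qcms_pt X \o @proj_left _ A D B).
  have [[phil phi0] phiu] := (statesE uAU _).1 muA.
  by apply/(statesE uU); split => //; split => [z x y|x] /=;
    [exact: phil|exact: phi0].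
have leftM := lift_M_isometry LP LAP (@proj_left_morphism R A D B)
  (@proj_left_surj _ A D B)
  (@proj_left_dom _ A D B LA LD LB pi rho e)
  (fun x _ => proj_left_lip LA LD LB pi rho e0 x)
  (proj_left_lift LAP LDP piP rhoP e0 pi_e) M0.
have rightM := lift_M_isometry LP LBP (@proj_right_morphism R A D B)
  (@proj_right_surj _ A D B)
  (@proj_right_dom _ A D B LA LD LB pi rho e)
  (fun x _ => proj_right_lip LA LD LB pi rho e0 x)
  (proj_right_lift LDP LBP piP rhoP e0 rho_e) M0.
have leftT := lift_topographic LP LAP (@proj_left_morphism R A D B)
  (@proj_left_surj _ A D B) u0 uA0.
have rightT := lift_topographic LP LBP (@proj_right_morphism R A D B)
  (@proj_right_surj _ A D B) u0 uB0.
have uP : dom_sa L u /\ scalars (A * (D * B))%type u.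
  split; first exact: (dom_sa_unit LP).
  by apply/(scalarsP LP); exists 1; rewrite scale1r.
pose tau := @Tunnel R M (proper_of_compact X) (proper_of_compact Y)
  (A * (D * B))%type
  L (scalars _) (@proj_left _ A D B) (@proj_right _ A D B) u
  (compact_lip_proper LAP muA) (compact_lip_proper LBP muB)
  (compact_lip_topographic LP leftS) uP leftM leftT rightM rightT
  (compact_lip_pin LP leftS).
apply: (@le_trans _ _ (extent tau)); first by apply: ereal_inf_lbound;
  exists tau.
have e30 : 0 < 3 * e by rewrite mulr_gt0.
rewrite /extent !ge_max; apply/andP; split; last first.
  (* The element of the tunnel is the unit: its seminorm is 0 and both base states take the value 1,
     so this part of the extent vanishes, even with the factor [2 * M]. *)
  rewrite lee_fin !ge_max (lip_unit LP) mulr0.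
  rewrite /= /proj_left /proj_right /= ((statesE uAU _).1 muA).2.
  by rewrite ((statesE uBU _).1 muB).2 subrr rnorm0 ltW.
apply/andP; split; last first.
  by apply: (bridge_mk LAP LBP e0 muA muB); exact: ltW.
apply: ereal_inf_lbound; exists (3 * e) => //; split => //.
  apply: (bridge_quasi_states LAP LDP LBP piP rhoP e0 M LAP pi_e) => x.
  by move=> /(bridge_lipP _ _ _ _ _ e0)[_ _ _ + _]; rewrite mulr1 rnorm_distC.
apply: (bridge_quasi_states LAP LDP LBP piP rhoP e0 M LBP rho_e) => x.
by move=> /(bridge_lipP _ _ _ _ _ e0)[_ _ _ _]; rewrite mulr1 rnorm_distC.
Qed.

Lemma qdiam_tunnel_le : `|fine (qdiam LA) - fine (qdiam LB)| <= 2 * e.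
Proof.
have [uA LAP] := pointed_qcms_lip X; have [uB LBP] := pointed_qcms_lip Y.
have [uD LDP] := compact_tunnel_lip; have [pi_e rho_e _] := pointed_extent_lt.
have piP := ct_leftP t; have rhoP := ct_rightP t.
have fA := qdiam_fin_num LAP (qcms_state X).
have fB := qdiam_fin_num LBP (qcms_state Y).
have fD := qdiam_fin_num LDP (pullback_state LDP LAP piP (qcms_state X)).
have := qdiam_isometry_le LDP LAP piP; have := qdiam_isometry_ge LAP piP pi_e.
have := qdiam_isometry_le LDP LBP rhoP;
  have := qdiam_isometry_ge LBP rhoP rho_e.
rewrite -(fineK fA) -(fineK fB) -(fineK fD) -!EFinD !lee_fin.
by move=> *; rewrite ler_norml; apply/andP; split; lra.
Qed.

End CompactTunnel.

(** For [a <= b] the difference is [expR (- a)] times [1 - expR (a - b)]; the first factor is at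
    most 1 and the second at most [b - a] by convexity of the exponential. *)
Lemma expR_opp_lipschitz {R : realType} (x y : R) : 0 <= x -> 0 <= y ->
  `|expR (- x) - expR (- y)| <= `|x - y|.
Proof.
have le (a b : R) : 0 <= a -> a <= b -> 0 <= expR (- a) - expR (- b) <= b - a.
  move=> a0 ab; rewrite subr_ge0 ler_expR lerN2 ab /=.
  have -> : expR (- b) = expR (- a) * expR (a - b) by rewrite -expRD addrA
    addNr add0r.
  have := expR_ge1Dx (a - b); have := expR_gt0 (- a); have : expR (- a) <= 1.
    by rewrite -expR0 ler_expR oppr_le0.
  have : expR (a - b) <= 1 by rewrite -expR0 ler_expR subr_le0.
  by nra.
move=> x0 y0; have [xy|/ltW yx] := leP x y.
  have /andP[h1 h2] := le _ _ x0 xy.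
  by rewrite ger0_norm// distrC ger0_norm ?subr_ge0.
have /andP[h1 h2] := le _ _ y0 yx.
by rewrite distrC ger0_norm// ger0_norm ?subr_ge0.
Qed.

(** * Passage to the limit *)

Section Convergence.
Context {R : realType}.

Lemma local_metametric_ge0 (M : R) (X Y : pointedPQMS R) :
  (0 <= local_metametric M X Y)%E.
Proof.
apply: le_ereal_inf_tmp => _ [tau ->]; rewrite /extent !le_max; apply/orP;
  right.
by rewrite lee_fin !le_max rnorm_ge0 !orbT.
Qed.

Lemma ereal_cvg0P (f : nat -> \bar R) : (forall n, (0 <= f n)%E) ->
  f n @[n --> \oo] --> 0%E <->
  forall e : R, 0 < e -> \forall n \near \oo, (f n < e%:E)%E.
Proof.
move=> f0; split=> [/fine_cvgP[ffin /cvgrPdist_lt fcvg] e e0|fe].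
  near=> n; have fn : f n \is a fin_num by near: n.
  rewrite -(fineK fn) lte_fin; have : `|0 - fine (f n)| < e by near: n;
    exact: fcvg.
  by rewrite sub0r normrN ger0_norm ?fine_ge0.
apply/fine_cvgP; split.
  near=> n; rewrite ge0_fin_numE//; have : (f n < 1%:E)%E by near: n; exact: fe.
  by move=> /lt_trans; apply; rewrite ltry.
apply/cvgrPdist_lt => e e0; near=> n.
have fn : (f n < e%:E)%E by near: n; exact: fe.
rewrite sub0r normrN ger0_norm ?fine_ge0// -lte_fin fineK// ge0_fin_numE//.
by rewrite (lt_trans fn)// ltry.
Unshelve. all: by end_near. Qed.

End Convergence.

Theorem corollary5p12 (R : realType) (X : nat -> pointedQCMS R)
    (Y : pointedQCMS R) :
  pointed_propinquity (X n) Y @[n --> \oo] --> 0%E ->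
  ereal_sup [set local_metametric M (proper_of_compact (X n))
                   (proper_of_compact Y) | M in [set M : R | 1 <= M]]
    @[n --> \oo] --> 0%E /\
  metametric (proper_of_compact (X n)) (proper_of_compact Y)
    @[n --> \oo] --> 0%E.
Proof.
have prop0 n : (0 <= pointed_propinquity (X n) Y)%E.
  by apply: le_ereal_inf_tmp => _ [t ->]; exact: pointed_extent_ge0.
move=> /(ereal_cvg0P prop0) cvg0.
have near_tunnel (e : R) : 0 < e ->
    \forall n \near \oo, exists t : compactTunnel (X n) Y,
      (pointed_extent t < e%:E)%E.
  move=> e0; near=> n.
  have : (pointed_propinquity (X n) Y < e%:E)%E.
    by near: n; exact: cvg0.
  by move=> /ereal_inf_lt[_ [t ->] te]; exists t.
split; apply/ereal_cvg0P.
- move=> n; apply: le_trans (ereal_sup_ubound _); last by exists 1 => //=.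
  exact: local_metametric_ge0.
- move=> e e0; have e40 : 0 < e / 4 by rewrite divr_gt0.
  near=> n; have [t te] : exists t : compactTunnel (X n) Y,
    (pointed_extent t < (e / 4)%:E)%E.
    by near: n; exact: near_tunnel.
  rewrite (@le_lt_trans _ _ (3 * (e / 4))%:E)//; last by rewrite lte_fin; lra.
  by apply: ge_ereal_sup => _ [M /= M1 <-];
    exact: (local_metametric_tunnel_le e40 te M1).
- by move=> n; rewrite le_max abse_ge0 orbT.
- move=> e e0; have e50 : 0 < e / 5 by rewrite divr_gt0.
  near=> n; have [t te] : exists t : compactTunnel (X n) Y,
    (pointed_extent t < (e / 5)%:E)%E.
    by near: n; exact: near_tunnel.
  rewrite (@le_lt_trans _ _ (4 * (e / 5))%:E)//; last by rewrite lte_fin; lra.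
  rewrite /metametric ge_max; apply/andP; split.
    (* The supremum must be strictly below the witness, which is therefore placed between the
       uniform bound [3 * (e / 5)] and [e]. The convention for an empty range of [r] amounts to the
       nonnegativity of that bound. *)
    apply: ereal_inf_lbound; exists (4 * (e / 5)) => //; split.
      by rewrite mulr_gt0.
    rewrite (@le_lt_trans _ _ (3 * (e / 5))%:E)//; last by rewrite lte_fin; lra.
    rewrite ge_max lee_fin mulr_ge0 ?(ltW e50)//=.
    apply: ge_ereal_sup => _ [M /= /andP[M1 _] <-].
    exact: (local_metametric_tunnel_le e50 te M1).
  have [uX LXP] := pointed_qcms_lip (X n); have [uY LYP] := pointed_qcms_lip Y.
  have qX := qdiam_fin_num LXP (qcms_state (X n)).
  have qY := qdiam_fin_num LYP (qcms_state Y).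
  have qX0 := qdiam_ge0 LXP (qcms_state (X n)).
  have qY0 := qdiam_ge0 LYP (qcms_state Y).
  (* The diameters are finite and differ by at most [2 * (e / 5)], and the negative exponential is
     1-Lipschitz on nonnegative reals. *)
  have := qdiam_tunnel_le te;
    have := expR_opp_lipschitz (fine_ge0 qX0) (fine_ge0 qY0).
  rewrite /= -(fineK qX) -(fineK qY) -!EFinN /= lee_fin => h1 h2.
  by rewrite (le_trans h1)// (le_trans h2)//; lra.
Unshelve. all: by end_near. Qed.
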